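(* The fundamental group of $G=\mathbb{P}GL_3(\mathbb{C})$ is $\mathbb{Z}_3$. The fundamental group of each standard orbit has order $12$ and is isomorphic to $V_4\times\mathbb{Z}_3$, while the fundamental group of the special orbit has order $36$.
   Context: A conic in $\mathbb{CP}^2$ is identified with its symmetric $3\times 3$ complex matrix up to a non-zero scalar. $\mathfrak{O}\subset\mathbb{CP}^5\times\mathbb{CP}^5$ is the set of pairs $(C,D)$ of non-degenerate conics that intersect transversely, i.e. in four distinct points. $G=\mathbb{P}GL_3(\mathbb{C})$ acts on $\mathfrak{O}$ by congruence: $A$ sends $(C,D)$ to $(A^TCA,A^TDA)$ (up to non-zero scalars in each entry). Every orbit contains a pair $(I_3,\operatorname{diag}(\lambda_1,\lambda_2,\lambda_3))$ with $\lambda_i$ distinct and non-zero. With $\omega=e^{2\pi i/3}$, the special orbit is the orbit of $(I_3,\operatorname{diag}(1,\omega,\omega^2))$; all other orbits are called standard orbits. $V_4$ is the Klein four-group and $\mathbb{Z}_3=\mathbb{Z}/3\mathbb{Z}$. *)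

(* Defs.v *)
From HB Require Import structures.
From mathcomp Require Import all_boot all_order all_algebra all_fingroup.
From mathcomp Require Import generic_quotient.
From mathcomp Require Import all_classical all_reals all_analysis homotopy.
From mathcomp Require Import complex ring lra.

Set Implicit Arguments.
Unset Strict Implicit.
Unset Printing Implicit Defensive.

Import Order.TTheory GRing.Theory Num.Theory.
Import numFieldNormedType.Exports.

Local Open Scope classical_set_scope.
Local Open Scope quotient_scope.
Local Open Scope card_scope.
Local Open Scope ring_scope.

(* The Euclidean topology on the complex numbers: [R[i]] is a numFieldType,
   whose regular module R[i]^o carries the topology of the modulus. *)
HB.instance Definition _ (R : realType) := NormedModule.copy R[i] R[i]^o.

Definition unitI (R : realType) : Type := set_type `[0%R : R, 1%R].

Section UnitInterval.
Variable R : realType.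

HB.instance Definition _ := Topological.copy (unitI R) (set_type `[0%R : R, 1%R]).

(* The retraction of the real line onto the unit interval. *)
Definition clipR (r : R) : R := Num.max 0 (Num.min 1 r).

Lemma clipR_itv r : clipR r \in (`[0%R : R, 1%R]%classic : set R).
Proof.
apply/mem_set; rewrite /= in_itv /= /clipR.
by rewrite le_max lexx ge_max ler01 ge_min lexx.
Qed.

Definition clip (r : R) : unitI R := exist _ (clipR r) (clipR_itv r).

Definition uval (s : unitI R) : R := set_val s.

Lemma uval_ge0 s : 0 <= uval s.
Proof. by have /= := set_valP s; rewrite in_itv /= => /andP[]. Qed.

Lemma uval_le1 s : uval s <= 1.
Proof. by have /= := set_valP s; rewrite in_itv /= => /andP[]. Qed.

Lemma uval_inj : injective uval.
Proof. by move=> s t st; apply/val_inj. Qed.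

Lemma uval_clip r : uval (clip r) = clipR r.
Proof. by []. Qed.

Lemma clipR_id r : 0 <= r -> r <= 1 -> clipR r = r.
Proof.
by move=> r0 r1; rewrite /clipR (min_idPr r1) (max_idPr r0).
Qed.

Lemma uvalK s : clip (uval s) = s.
Proof. by apply: uval_inj; rewrite uval_clip clipR_id ?uval_ge0 ?uval_le1. Qed.

Lemma clip_neq01 : clip 0 != clip 1.
Proof.
apply/eqP => /(congr1 uval); rewrite !uval_clip !clipR_id ?ler01 ?lexx // => /eqP.
by rewrite eq_sym oner_eq0.
Qed.

HB.instance Definition _ := isBiPointed.Build (unitI R) clip_neq01.

Lemma uval0 : uval zero = 0.
Proof. by rewrite /zero /= uval_clip clipR_id. Qed.

Lemma uval1 : uval one = 1.
Proof. by rewrite /one /= uval_clip clipR_id. Qed.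

Lemma uval_continuous : continuous uval.
Proof. exact: initial_continuous. Qed.

Lemma clip_continuous : continuous clip.
Proof.
apply: continuous_comp_initial => /= x.
apply: (@continuous_max R R (cst 0)); first exact: cvg_cst.
apply: (@continuous_min R R (cst 1) id); first exact: cvg_cst.
exact: cvg_id.
Qed.

End UnitInterval.

Lemma comp_continuous (U V W : topologicalType) (f : U -> V) (g : V -> W) :
  continuous f -> continuous g -> continuous (fun u => g (f u)).
Proof.
by move=> cf cg u; apply: (@continuous_comp _ _ _ f g); [exact: cf|exact: cg].
Qed.

Lemma pair_continuous (U V W : topologicalType) (f : U -> V) (g : U -> W) :
  continuous f -> continuous g -> continuous (fun u => (f u, g u)).
Proof.
by move=> cf cg u; apply: cvg_pair; [exact: cf|exact: cg].
Qed.

Lemma min_fun_continuous (R : realType) (U : topologicalType) (f g : U -> R) :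
  continuous f -> continuous g -> continuous (fun u => Num.min (f u) (g u)).
Proof.
by move=> cf cg u; apply: (@continuous_min R U f g); [exact: cf|exact: cg].
Qed.

Lemma max_fun_continuous (R : realType) (U : topologicalType) (f g : U -> R) :
  continuous f -> continuous g -> continuous (fun u => Num.max (f u) (g u)).
Proof.
by move=> cf cg u; apply: (@continuous_max R U f g); [exact: cf|exact: cg].
Qed.

Section Pasting.
Variables (R : realType) (Z X : topologicalType).

Lemma pasting (u : Z -> R) (F G : Z -> X) : continuous u -> continuous F ->
  continuous G -> (forall z, u z = 2^-1 -> F z = G z) ->
  continuous (fun z => if u z <= 2^-1 then F z else G z).
Proof.
move=> cu cF cG FG; apply/continuous_subspace_setT.
pose A := u @^-1` [set x | x <= 2^-1]; pose B := u @^-1` [set x | x >= 2^-1].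
have -> : [set: Z] = A `|` B.
  by apply/seteqP; split=> // z _; rewrite /A /B /=; case: (lerP (u z) 2^-1) => h;
    [left|right; exact: ltW].
apply: withinU_continuous.
- by apply: closed_comp => [z _|]; [exact: cu|exact: closed_le].
- by apply: closed_comp => [z _|]; [exact: cu|exact: closed_ge].
- apply: (@subspace_eq_continuous _ _ _ F); last exact: continuous_subspaceT.
  by move=> z /set_mem; rewrite /A /= /from_subspace => ->.
- apply: (@subspace_eq_continuous _ _ _ G); last exact: continuous_subspaceT.
  move=> z /set_mem; rewrite /B /= /from_subspace => zB.
  by case: lerP => // zA; rewrite FG //; apply/eqP; rewrite eq_le zA zB.
Qed.

End Pasting.

Section Paths.
Variables (R : realType) (X : topologicalType).
Local Notation I := (unitI R).

(* In each branch the argument of clip already lies in [0, 1]. *)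
Definition concat_fun (f g : I -> X) (s : I) : X :=
  if uval s <= 2^-1 then f (clip (2 * uval s)) else g (clip (2 * uval s - 1)).

Lemma clip2_half : clip (2 * 2^-1) = one :> I.
Proof. by apply: uval_inj; rewrite uval1 uval_clip clipR_id; lra. Qed.

Lemma clip2B1_half : clip (2 * 2^-1 - 1) = zero :> I.
Proof. by apply: uval_inj; rewrite uval0 uval_clip clipR_id; lra. Qed.

Lemma affine_continuous (Z : topologicalType) (u : Z -> R) (a b : R) :
  continuous u -> continuous (fun z => a * u z + b).
Proof.
by move=> cu z; apply: cvgD; [apply: cvgMr; exact: cu|exact: cvg_cst].
Qed.

Lemma clip_affine_continuous (Z : topologicalType) (u : Z -> R) (a b : R) :
  continuous u -> continuous (fun z => clip (a * u z + b)).
Proof.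
move=> cu; apply: comp_continuous; last exact: clip_continuous.
exact: affine_continuous.
Qed.

Section Concat.
Variables (x y z : X) (f : {path I from x to y}) (g : {path I from y to z}).

Lemma concat_cts : continuous (concat_fun f g).
Proof.
apply: pasting; first exact: uval_continuous.
- apply: comp_continuous; last exact: cts_fun.
  rewrite (_ : (fun _ => _) = fun s : I => clip (2 * uval s + 0)); last first.
    by apply/funext => t; rewrite addr0.
  exact: (clip_affine_continuous (@uval_continuous R)).
- apply: comp_continuous; last exact: cts_fun.
  exact: (clip_affine_continuous (@uval_continuous R)).
- by move=> s ->; rewrite clip2_half clip2B1_half path_one path_zero.
Qed.

Lemma concat_zero : concat_fun f g zero = x.
Proof. 
rewrite /concat_fun uval0 invr_ge0 ler0n -[RHS](@path_zero _ _ _ _ f); congr (f _).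
by apply: uval_inj; rewrite uval0 uval_clip clipR_id; lra.
Qed.

Lemma concat_one : concat_fun f g one = z.
Proof.
rewrite /concat_fun uval1 ifF; last by apply/negbTE; rewrite -ltNge; lra.
rewrite -[RHS](@path_one _ _ _ _ g); congr (g _).
by apply: uval_inj; rewrite uval1 uval_clip clipR_id; lra.
Qed.

Definition concat : {path I from x to z} :=
  mk_path concat_cts concat_zero concat_one.

End Concat.

Section Reverse.
Variables (x y : X) (f : {path I from x to y}).

Definition reverse_fun (s : I) : X := f (clip (1 - uval s)).

Lemma reverse_cts : continuous reverse_fun.
Proof.
apply: comp_continuous; last exact: cts_fun.
rewrite (_ : (fun _ => _) = fun s : I => clip (-1 * uval s + 1)); last first.
  by apply/funext => t; rewrite mulN1r addrC.
exact: (clip_affine_continuous (@uval_continuous R)).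
Qed.

Lemma reverse_zero : reverse_fun zero = y.
Proof.
rewrite /reverse_fun uval0 -[RHS](@path_one _ _ _ _ f); congr (f _).
by apply: uval_inj; rewrite uval1 uval_clip clipR_id; lra.
Qed.

Lemma reverse_one : reverse_fun one = x.
Proof.
rewrite /reverse_fun uval1 -[RHS](@path_zero _ _ _ _ f); congr (f _).
by apply: uval_inj; rewrite uval0 uval_clip clipR_id; lra.
Qed.

Definition reverse : {path I from y to x} :=
  mk_path reverse_cts reverse_zero reverse_one.

End Reverse.

(* Homotopy relative to the endpoints. *)
Definition homotopic x y (f g : {path I from x to y}) : Prop :=
  exists H : I * I -> X,
    [/\ continuous H,
        forall s, H (s, zero) = f s, forall s, H (s, one) = g s,
        forall t, H (zero, t) = x & forall t, H (one, t) = y].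

Lemma reparam_homotopic x y (p q : {path I from x to y}) (f : I -> X)
    (phi psi : R -> R) :
  continuous f -> continuous phi -> continuous psi ->
  phi 0 = psi 0 -> phi 1 = psi 1 ->
  (forall s, p s = f (clip (phi (uval s)))) ->
  (forall s, q s = f (clip (psi (uval s)))) -> homotopic p q.
Proof.
move=> cf cphi cpsi e0 e1 pE qE.
exists (fun st => f (clip
  ((1 - uval st.2) * phi (uval st.1) + uval st.2 * psi (uval st.1)))).
have c1 : continuous (fun st : I * I => uval st.1).
  apply: (comp_continuous (f := fst)); last exact: uval_continuous.
  by move=> st; exact: cvg_fst.
have c2 : continuous (fun st : I * I => uval st.2).
  apply: (comp_continuous (f := snd)); last exact: uval_continuous.
  by move=> st; exact: cvg_snd.
split.
- apply: comp_continuous; last exact: cf.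
  apply: comp_continuous; last exact: clip_continuous.
  have cc (h : R -> R) : continuous h ->
      continuous (fun st : I * I => h (uval st.1)).
    by move=> ch; exact: (comp_continuous c1 ch).
  move=> st; apply: cvgD; apply: cvgM; try exact: cc; try exact: c2.
  by apply: cvgB; [exact: cvg_cst|exact: c2].
- by move=> s; rewrite uval0 subr0 mul1r mul0r addr0 pE.
- by move=> s; rewrite uval1 subrr mul1r mul0r add0r qE.
- move=> t; rewrite uval0 -e0 -mulrDl subrK mul1r -(uval0 R) -pE.
  exact: path_zero.
- move=> t; rewrite uval1 -e1 -mulrDl subrK mul1r -(uval1 R) -pE.
  exact: path_one.
Qed.

Lemma homotopic_refl x y (f : {path I from x to y}) : homotopic f f.
Proof.
apply: (@reparam_homotopic _ _ _ _ f id id) => //; try exact: cts_fun.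
- by move=> ?; exact: cvg_id.
- by move=> ?; exact: cvg_id.
- by move=> s; rewrite uvalK.
- by move=> s; rewrite uvalK.
Qed.

Lemma homotopic_sym x y (f g : {path I from x to y}) :
  homotopic f g -> homotopic g f.
Proof.
move=> [H [cH H0 H1 Hx Hy]].
exists (fun st => H (st.1, clip (-1 * uval st.2 + 1))); split => //=.
- apply: (comp_continuous _ cH).
  apply: pair_continuous; first by move=> st; exact: cvg_fst.
  apply: (@clip_affine_continuous _ (fun st : I * I => uval st.2)).
  apply: (comp_continuous (f := snd)); last exact: uval_continuous.
  by move=> u; exact: cvg_snd.
- move=> s; rewrite -H1; congr (H (_, _)); apply: uval_inj.
  by rewrite uval_clip uval0 uval1 clipR_id; lra.
- move=> s; rewrite -H0; congr (H (_, _)); apply: uval_inj.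
  by rewrite uval_clip uval0 uval1 clipR_id; lra.
Qed.

Lemma homotopic_trans x y (f g h : {path I from x to y}) :
  homotopic f g -> homotopic g h -> homotopic f h.
Proof.
move=> [H [cH H0 H1 Hx Hy]] [K [cK K0 K1 Kx Ky]].
have c2 : continuous (fun st : I * I => uval st.2).
  apply: (comp_continuous (f := snd)); last exact: uval_continuous.
  by move=> st; exact: cvg_snd.
exists (fun st => if uval st.2 <= 2^-1 then H (st.1, clip (2 * uval st.2 + 0))
   else K (st.1, clip (2 * uval st.2 + -1))); split => /=.
- apply: (@pasting _ _ _ (fun st : I * I => uval st.2)) => //.
  + apply: (comp_continuous _ cH).
    by apply: pair_continuous; [move=> st; exact: cvg_fst|exact: clip_affine_continuous].
  + apply: (comp_continuous _ cK).
    by apply: pair_continuous; [move=> st; exact: cvg_fst|exact: clip_affine_continuous].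
  + by move=> [s t] /= ->; rewrite addr0 clip2_half clip2B1_half H1 K0.
- move=> s; rewrite uval0 invr_ge0 ler0n -H0; congr (H (_, _)); apply: uval_inj.
  by rewrite uval_clip uval0 clipR_id; lra.
- move=> s; rewrite uval1 ifF; last by apply/negbTE; rewrite -ltNge; lra.
  rewrite -K1; congr (K (_, _)); apply: uval_inj.
  by rewrite uval_clip uval1 clipR_id; lra.
- by move=> t; rewrite Hx Kx if_same.
- by move=> t; rewrite Hy Ky if_same.
Qed.

Lemma concat_homotopic x y z (f f' : {path I from x to y})
    (g g' : {path I from y to z}) :
  homotopic f f' -> homotopic g g' -> homotopic (concat f g) (concat f' g').
Proof.
move=> [H [cH H0 H1 Hx Hy]] [K [cK K0 K1 Kx Ky]].
have c1 : continuous (fun st : I * I => uval st.1).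
  apply: (comp_continuous (f := fst)); last exact: uval_continuous.
  by move=> st; exact: cvg_fst.
exists (fun st => if uval st.1 <= 2^-1 then H (clip (2 * uval st.1 + 0), st.2)
   else K (clip (2 * uval st.1 + -1), st.2)); split => /=.
- apply: (@pasting _ _ _ (fun st : I * I => uval st.1)) => //.
  + apply: (comp_continuous _ cH).
    by apply: pair_continuous; [exact: clip_affine_continuous|move=> st; exact: cvg_snd].
  + apply: (comp_continuous _ cK).
    by apply: pair_continuous; [exact: clip_affine_continuous|move=> st; exact: cvg_snd].
  + by move=> [s t] /= ->; rewrite addr0 clip2_half clip2B1_half Hy Kx.
- by move=> s; rewrite addr0 H0 K0.
- by move=> s; rewrite addr0 H1 K1.
- move=> t; rewrite uval0 invr_ge0 ler0n -(Hx t); congr (H (_, _)).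
  by apply: uval_inj; rewrite uval_clip uval0 clipR_id; lra.
- move=> t; rewrite uval1 ifF; last by apply/negbTE; rewrite -ltNge; lra.
  rewrite -(Ky t); congr (K (_, _)); apply: uval_inj.
  by rewrite uval_clip uval1 clipR_id; lra.
Qed.

Lemma reverse_homotopic x y (f f' : {path I from x to y}) :
  homotopic f f' -> homotopic (reverse f) (reverse f').
Proof.
move=> [H [cH H0 H1 Hx Hy]].
exists (fun st => H (clip (-1 * uval st.1 + 1), st.2)); split => //=.
- apply: (comp_continuous _ cH).
  apply: pair_continuous; last by move=> st; exact: cvg_snd.
  apply: (@clip_affine_continuous _ (fun st : I * I => uval st.1)).
  apply: (comp_continuous (f := fst)); last exact: uval_continuous.
  by move=> u; exact: cvg_fst.
- by move=> s; rewrite H0 mulN1r addrC.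
- by move=> s; rewrite H1 mulN1r addrC.
- move=> t; rewrite -(Hy t); congr (H (_, _)).
  by apply: uval_inj; rewrite uval_clip uval0 uval1 clipR_id; lra.
- move=> t; rewrite -(Hx t); congr (H (_, _)).
  by apply: uval_inj; rewrite uval_clip uval0 uval1 clipR_id; lra.
Qed.

Definition const_path (x : X) : {path I from x to x} := (cst x : I -> X).

Lemma ltNhalf (r : R) : 2^-1 < r -> (r <= 2^-1) = false.
Proof. by move=> h; apply/negbTE; rewrite -ltNge. Qed.

Lemma concatA_homotopic x y z t (p : {path I from x to y})
    (q : {path I from y to z}) (r : {path I from z to t}) :
  homotopic (concat (concat p q) r) (concat p (concat q r)).
Proof.
pose phi (s : R) := Num.min (2 * s) (Num.min (s + 4^-1) (2^-1 * s + 2^-1)).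
apply: (@reparam_homotopic _ _ _ _ (concat p (concat q r)) phi id).
- exact: cts_fun.
- have c (a b : R) : continuous (fun s : R => a * s + b).
    by apply: affine_continuous => s; exact: cvg_id.
  have -> : phi = fun s => Num.min (2 * s + 0)
      (Num.min (1 * s + 4^-1) (2^-1 * s + 2^-1)).
    by apply/funext => s; rewrite /phi mul1r addr0.
  by do 2![apply: min_fun_continuous; first exact: c]; exact: c.
- by move=> s; exact: cvg_id.
- by rewrite /phi mulr0 !add0r mulr0 add0r; case: (lerP (4^-1 : R) 2^-1) => ?; case: lerP => ?; lra.
- by rewrite /phi !mulr1; case: (lerP (1 + 4^-1 : R)) => ?; case: lerP => ?; lra.
- move=> s; have s0 := uval_ge0 s; have s1 := uval_le1 s.
  have phiE : uval (clip (phi (uval s))) = phi (uval s).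
    rewrite uval_clip clipR_id //.
      by rewrite /phi !le_min; apply/and3P; split; lra.
    by rewrite /phi !ge_min; apply/or3P; apply: Or33; lra.
  rewrite /= /mk_path /concat_fun /= /mk_path phiE /concat_fun.
  rewrite uval_clip [in X in _ = X]uval_clip.
  case: (lerP (uval s) 2^-1) => h1.
    rewrite clipR_id; [|lra|lra].
    case: (lerP (2 * uval s) 2^-1) => h2.
      have -> : phi (uval s) = 2 * uval s.
        by rewrite /phi !min_l // ?le_min; try (apply/andP; split); lra.
      by rewrite h2.
    have -> : phi (uval s) = uval s + 4^-1.
      by rewrite /phi [X in Num.min _ X]min_l ?min_r //; lra.
    rewrite ltNhalf; last lra.
    rewrite clipR_id; [|lra|lra].
    rewrite ifT; last lra.
    by congr (q (clip _)); lra.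
  have -> : phi (uval s) = 2^-1 * uval s + 2^-1.
    by rewrite /phi [X in Num.min _ X]min_r ?min_r //; lra.
  rewrite ltNhalf; last lra.
  rewrite clipR_id; [|lra|lra].
  rewrite ltNhalf; last lra.
  by congr (r (clip _)); lra.
- by move=> s; rewrite uvalK.
Qed.

Lemma const_concat_homotopic x y (p : {path I from x to y}) :
  homotopic (concat (const_path x) p) p.
Proof.
apply: (@reparam_homotopic _ _ _ _ p (fun s => Num.max 0 (2 * s + -1)) id).
- exact: cts_fun.
- apply: (@max_fun_continuous _ _ (cst 0)); first by move=> s; exact: cvg_cst.
  by apply: affine_continuous => u; exact: cvg_id.
- by move=> s; exact: cvg_id.
- by rewrite max_l //; lra.
- by rewrite max_r //; lra.
- move=> s; have s0 := uval_ge0 s; have s1 := uval_le1 s.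
  rewrite /= /mk_path /concat_fun; case: lerP => h.
    rewrite max_l; last lra.
    exact: (esym (@path_zero _ _ _ _ p)).
  by rewrite max_r //; lra.
- by move=> s; rewrite uvalK.
Qed.

Lemma concat_const_homotopic x y (p : {path I from x to y}) :
  homotopic (concat p (const_path y)) p.
Proof.
apply: (@reparam_homotopic _ _ _ _ p (fun s => Num.min 1 (2 * s + 0)) id).
- exact: cts_fun.
- apply: (@min_fun_continuous _ _ (cst 1)); first by move=> s; exact: cvg_cst.
  by apply: affine_continuous => u; exact: cvg_id.
- by move=> s; exact: cvg_id.
- by rewrite min_r //; lra.
- by rewrite min_l //; lra.
- move=> s; have s0 := uval_ge0 s; have s1 := uval_le1 s.
  rewrite /= /mk_path /concat_fun addr0; case: lerP => h.
    by rewrite min_r //; lra.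
  rewrite min_l; last lra.
  exact: (esym (@path_one _ _ _ _ p)).
- by move=> s; rewrite uvalK.
Qed.

Lemma concat_reverse_homotopic x y (p : {path I from x to y}) :
  homotopic (concat p (reverse p)) (const_path x).
Proof.
apply: (@reparam_homotopic _ _ _ _ p
  (fun s => Num.min (2 * s + 0) (- 2 * s + 2)) (cst 0)).
- exact: cts_fun.
- by apply: min_fun_continuous; apply: affine_continuous => u; exact: cvg_id.
- by move=> s; exact: cvg_cst.
- by rewrite /cst min_l //; lra.
- by rewrite /cst min_r //; lra.
- move=> s; have s0 := uval_ge0 s; have s1 := uval_le1 s.
  rewrite /= /mk_path /concat_fun addr0; case: lerP => h.
    by rewrite min_l //; lra.
  rewrite min_r; last lra.
  rewrite /mk_path /reverse_fun uval_clip clipR_id; [|lra|lra].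
  by congr (p (clip _)); lra.
- by move=> s /=; rewrite -[LHS](@path_zero _ _ _ _ p).
Qed.

Lemma reverse_concat_homotopic x y (p : {path I from x to y}) :
  homotopic (concat (reverse p) p) (const_path y).
Proof.
apply: (@reparam_homotopic _ _ _ _ p
  (fun s => Num.max (2 * s + -1) (- 2 * s + 1)) (cst 1)).
- exact: cts_fun.
- by apply: max_fun_continuous; apply: affine_continuous => u; exact: cvg_id.
- by move=> s; exact: cvg_cst.
- by rewrite /cst max_r //; lra.
- by rewrite /cst max_l //; lra.
- move=> s; have s0 := uval_ge0 s; have s1 := uval_le1 s.
  rewrite /= /mk_path /concat_fun; case: lerP => h.
    rewrite max_r; last lra.
    rewrite /mk_path /reverse_fun uval_clip clipR_id; [|lra|lra].
    by congr (p (clip _)); lra.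
  by rewrite max_l //; lra.
- by move=> s /=; rewrite -[LHS](@path_one _ _ _ _ p).
Qed.

End Paths.

Section FundamentalGroup.
Variables (R : realType) (X : topologicalType) (x : X).
Local Notation loop := {path (unitI R) from x to x}.

Definition loop_rel (f g : loop) : bool := `[< homotopic f g >].

Lemma loop_rel_refl : reflexive loop_rel.
Proof. by move=> f; apply/asboolP; exact: homotopic_refl. Qed.

Lemma loop_rel_sym : symmetric loop_rel.
Proof. by move=> f g; apply/asboolP/asboolP; exact: homotopic_sym. Qed.

Lemma loop_rel_trans : transitive loop_rel.
Proof.
by move=> g f h /asboolP fg /asboolP gh; apply/asboolP; exact: homotopic_trans gh.
Qed.

Canonical loop_equiv := EquivRel loop_rel loop_rel_refl loop_rel_sym loop_rel_trans.

Definition pi1 := {eq_quot loop_equiv}.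
HB.instance Definition _ := Choice.on pi1.
HB.instance Definition _ := EqQuotient.on pi1.

Lemma pi1_eqP (f g : loop) : \pi_pi1 f = \pi_pi1 g <-> homotopic f g.
Proof.
split=> [/eqmodP/asboolP //|fg]; by apply/eqmodP/asboolP.
Qed.

Definition pi1_one : pi1 := \pi_pi1 (const_path R x).
Definition pi1_mul (a b : pi1) : pi1 := \pi_pi1 (concat (repr a) (repr b)).
Definition pi1_inv (a : pi1) : pi1 := \pi_pi1 (reverse (repr a)).

Lemma pi1_mulE (f g : loop) : pi1_mul (\pi_pi1 f) (\pi_pi1 g) = \pi_pi1 (concat f g).
Proof.
by apply/pi1_eqP/concat_homotopic; apply/pi1_eqP; rewrite reprK.
Qed.

Lemma pi1_invE (f : loop) : pi1_inv (\pi_pi1 f) = \pi_pi1 (reverse f).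
Proof. by apply/pi1_eqP/reverse_homotopic; apply/pi1_eqP; rewrite reprK. Qed.

Lemma pi1_mulA : associative pi1_mul.
Proof.
elim/quotW => f; elim/quotW => g; elim/quotW => h.
rewrite (pi1_mulE g h) (pi1_mulE f g) !pi1_mulE.
by apply/esym/pi1_eqP; exact: concatA_homotopic.
Qed.

Lemma pi1_mul1 : left_id pi1_one pi1_mul.
Proof.
by elim/quotW => f; rewrite pi1_mulE; apply/pi1_eqP; exact: const_concat_homotopic.
Qed.

Lemma pi1_mulr1 : right_id pi1_one pi1_mul.
Proof.
by elim/quotW => f; rewrite pi1_mulE; apply/pi1_eqP; exact: concat_const_homotopic.
Qed.

Lemma pi1_mulV : left_inverse pi1_one pi1_inv pi1_mul.
Proof.
elim/quotW => f; rewrite (pi1_invE f) pi1_mulE; apply/pi1_eqP.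
exact: reverse_concat_homotopic.
Qed.

Lemma pi1_mulrV : right_inverse pi1_one pi1_inv pi1_mul.
Proof.
elim/quotW => f; rewrite (pi1_invE f) pi1_mulE; apply/pi1_eqP.
exact: concat_reverse_homotopic.
Qed.

HB.instance Definition _ := isGroup.Build pi1
  pi1_mulA pi1_mul1 pi1_mulr1 pi1_mulV pi1_mulrV.

End FundamentalGroup.
Arguments pi1 R {X} x.

Definition isomorphic_groups (G H : groupType) : Prop :=
  exists f : {multiplicative G -> H}, bijective f.

Definition klein4 : groupType := ('Z_2 * 'Z_2)%type.

(* The image of a set of matrices in the projectivization of its ambient space:
   the quotient of A by non-zero complex scalars, with the quotient topology. *)
Section Projectivization.
Variables (R : realType) (m n : nat) (A : set 'M[R[i]]_(m, n)).

Definition proportional (M N : A) : bool :=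
  `[< exists2 c : R[i], c != 0 & set_val N = c *: set_val M >].

Lemma proportional_refl : reflexive proportional.
Proof. by move=> M; apply/asboolP; exists 1; rewrite ?oner_neq0 ?scale1r. Qed.

Lemma proportional_sym : symmetric proportional.
Proof.
suff H (M N : A) : proportional M N -> proportional N M.
  by move=> M N; apply/idP/idP; exact: H.
move=> /asboolP[c c0 NM]; apply/asboolP; exists c^-1; rewrite ?invr_eq0 //.
by rewrite NM scalerA mulVf // scale1r.
Qed.

Lemma proportional_trans : transitive proportional.
Proof.
move=> N M P /asboolP[c c0 NM] /asboolP[d d0 PN]; apply/asboolP.
by exists (d * c); rewrite ?mulf_neq0 // PN NM scalerA.
Qed.

Canonical proportional_equiv := EquivRel proportional
  proportional_refl proportional_sym proportional_trans.

Definition proj := {eq_quot proportional_equiv}.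
HB.instance Definition _ := Topological.copy proj (quotient_topology proj).
HB.instance Definition _ := EqQuotient.on proj.

Definition proj_class (M : A) : proj := \pi_proj M.

Definition proj_of (M : 'M[R[i]]_(m, n)) (AM : M \in A) : proj :=
  proj_class (exist (fun N => N \in A) M AM).

(* A chosen representative; conic_pointsE, nondegenerateE and congruenceE below
   show that the notions built on it do not depend on the choice. *)
Definition proj_mx (p : proj) : 'M[R[i]]_(m, n) := set_val (repr p).

Lemma proj_classP (M N : A) : proj_class M = proj_class N <->
  exists2 c : R[i], c != 0 & set_val N = c *: set_val M.
Proof. by split=> [/eqmodP/asboolP //|MN]; apply/eqmodP/asboolP. Qed.

Lemma proj_mxP (M : A) :
  exists2 c : R[i], c != 0 & proj_mx (proj_class M) = c *: set_val M.
Proof. by apply/proj_classP; rewrite /proj_class reprK. Qed.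

Lemma proj_mx_in (p : proj) : A (proj_mx p).
Proof. exact: set_valP. Qed.

End Projectivization.

Section Conics.
Variable R : realType.

Definition CP2 := proj [set x : 'cV[R[i]]_3 | x != 0].

Definition conic_mx : set 'M[R[i]]_3 := [set M | M^T = M /\ M != 0].

(* All conics, degenerate or not: this is CP^5. *)
Definition conic := proj conic_mx.

Definition PGL3 := proj [set M : 'M[R[i]]_3 | M \in unitmx].

Definition conic_points (C : conic) : set CP2 :=
  [set x | (proj_mx x)^T *m proj_mx C *m proj_mx x = 0].

Definition nondegenerate (C : conic) : Prop := \det (proj_mx C) != 0.

Definition transverse (C D : conic) : Prop :=
  conic_points C `&` conic_points D #= `I_4.

Definition transverse_pairs : set (conic * conic) :=
  [set p | [/\ nondegenerate p.1, nondegenerate p.2 & transverse p.1 p.2]].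

Lemma conic_pointsE (M : conic_mx) (x : [set x : 'cV[R[i]]_3 | x != 0]) :
  conic_points (proj_class M) (proj_class x) <->
  (set_val x)^T *m set_val M *m set_val x = 0.
Proof.
rewrite /conic_points /=.
have [c c0 ->] := proj_mxP M; have [d d0 ->] := proj_mxP x.
rewrite [(_ *: _)^T]linearZ /= -!(scalemxAl, scalemxAr) !scalerA.
split=> [/eqP|->]; last by rewrite scaler0.
by rewrite scaler_eq0 !mulf_eq0 (negbTE c0) (negbTE d0) => /eqP.
Qed.

Lemma nondegenerateE (M : conic_mx) :
  nondegenerate (proj_class M) <-> \det (set_val M) != 0.
Proof.
rewrite /nondegenerate; have [c c0 ->] := proj_mxP M.
by rewrite detZ mulf_eq0 expf_eq0 (negbTE c0).
Qed.

Lemma congruence_subproof (A M : 'M[R[i]]_3) :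
  A \in unitmx -> conic_mx M -> A^T *m M *m A \in conic_mx.
Proof.
move=> uA [sM M0]; apply/mem_set; split.
  by rewrite !trmx_mul trmxK sM mulmxA.
apply: contra M0 => /eqP AMA; apply/eqP.
by rewrite -(mulmxK uA M) -(mulKmx (_ : A^T \in unitmx) (M *m A)) ?unitmx_tr //
  [A^T *m _]mulmxA AMA mulmx0 mul0mx.
Qed.

(* The congruence action M |-> A^T M A on conics. *)
Definition congruence (A : PGL3) (C : conic) : conic :=
  proj_of (congruence_subproof (proj_mx_in A) (proj_mx_in C)).

Lemma congruenceE (A : [set M : 'M[R[i]]_3 | M \in unitmx]) (M N : conic_mx) :
  set_val N = (set_val A)^T *m set_val M *m set_val A ->
  congruence (proj_class A) (proj_class M) = proj_class N.
Proof.
move=> NE; apply/esym/proj_classP.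
have [c c0 Ec] := proj_mxP A; have [d d0 Ed] := proj_mxP M.
exists (c * (d * c)); first by rewrite !mulf_neq0.
rewrite -[LHS]/((proj_mx (proj_class A))^T *m proj_mx (proj_class M)
  *m proj_mx (proj_class A)) NE Ec Ed.
rewrite [(_ *: _)^T]linearZ /= -!(scalemxAl, scalemxAr) !scalerA.
by congr (_ *: _); ring.
Qed.

Definition orbit (p : conic * conic) : set (conic * conic) :=
  [set (congruence A p.1, congruence A p.2) | A in [set: PGL3]].

Definition is_orbit (S : set (conic * conic)) : Prop :=
  exists2 p, transverse_pairs p & S = orbit p.

(* exp(2 i pi / 3) *)
Definition omega : R[i] := (cos (2 * pi / 3) +i* sin (2 * pi / 3))%C.

Definition special_diag : 'M[R[i]]_3 :=
  diag_mx (\row_j [:: 1; omega; omega ^+ 2]`_j).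

Lemma id_conic_mx : 1%:M \in conic_mx.
Proof.
apply/mem_set; split; first by rewrite trmx1.
exact: oner_neq0.
Qed.

Lemma special_diag_conic_mx : special_diag \in conic_mx.
Proof.
apply/mem_set; split; first by rewrite tr_diag_mx.
apply/eqP => /matrixP/(_ 0 0); rewrite !mxE /= => /eqP.
by rewrite oner_eq0.
Qed.

Definition special_pair : conic * conic :=
  (proj_of id_conic_mx, proj_of special_diag_conic_mx).

Definition special_orbit : set (conic * conic) := orbit special_pair.

Definition standard_orbit (S : set (conic * conic)) : Prop :=
  is_orbit S /\ S <> special_orbit.

End Conics.
Arguments transverse_pairs : clear implicits.
Arguments special_orbit : clear implicits.

(* Main.v *)
(* SL_3(C) is simply connected. A loop of invertible matrices moves together with its
   first row, because u |-> w is realized by right multiplication by a matrix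
   depending continuously on u and w; and a loop of non-zero first rows contracts
   after a detour avoiding three real coordinates. Dividing by determinants then
   brings the contraction back into SL_3(C).

   PGL_3(C) and the orbits in question are quotients of SL_3(C) by the finite group
   of matrices whose class fixes the base point. A lift of a loop ends at A0 times
   an element of that group, which identifies the group with the fundamental group.
   For PGL_3(C) this is the group of cube roots of unity. For the pair
   (I, diag l), with the l_i distinct and non-zero, a stabilizing matrix h satisfies
   l_i h_ij = mu h_ij l_j with mu^3 = 1, hence is a diagonal sign matrix of
   determinant 1 times a cube root of unity (12 elements), unless a rotation of the
   indices multiplies l by a primitive cube root of unity (36 elements); the latter
   happens only on the special orbit.

   Two non-degenerate conics through four common points become diagonal together in
   coordinates where the four points are (1 : +-1 : +-1), and the entries of the
   normalized second conic are distinct since otherwise the conics coincide. *)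

Require Import Defs.
From HB Require Import structures.
From mathcomp Require Import all_boot all_order all_algebra all_fingroup.
From mathcomp Require Import generic_quotient.
From mathcomp Require Import all_classical all_reals all_analysis homotopy.
From mathcomp Require Import complex ring lra.

Set Implicit Arguments.
Unset Strict Implicit.
Unset Printing Implicit Defensive.

Import Order.TTheory GRing.Theory Num.Theory.
Import numFieldNormedType.Exports.

Local Open Scope classical_set_scope.
Local Open Scope ring_scope.

(** * Limits of complex matrices *)

(** A single lemma, [transport_lift], does all the lifting: a homotopy is followed by multiplying on
    the right by matrices [d v w] depending continuously on two nearby points of the square. For the
    first-row map of GL_n the fibres are large and the transport is chosen by a formula. For a
    quotient of SL_3(C) by a finite group the transport is unique: conjugation keeps the trace, and
    a group element other than 1 has trace different from 3, so its conjugates stay away from 1. The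
    group acts on the left and transports act on the right, so one transport serves a whole fibre.
    What remains to prove about each quotient is that nearby points have nearby preimages.
    Compactness reduces this to a local bound on the determinant-one matrices over a point. For
    PGL_3(C) the bound comes from a scale-invariant ratio of determinant and norm; on an orbit the
    same ratio bounds A^T A and A^T L A, and interpolation at the distinct l_i then bounds A. A
    continuous loop of first rows may fill space, so it is replaced by a polygon before general
    position is applied. *)

Section MatrixLimits.
Context (R : realType) (Z : Type) (F : set_system Z) {FF : Filter F}.
Local Notation C := R[i].

Lemma cvg_mx (T : topologicalType) m n (f : Z -> 'M[T]_(m, n)) (M : 'M[T]_(m, n)) :
  (forall i j, (fun z => f z i j) @ F --> M i j) -> f @ F --> M.
Proof.
move=> fM A [P MP PA]; rewrite /nbhs /= /fmap /=.
suff : \forall z \near F, forall i j, P i j (f z i j) by apply: filterS => z; exact: PA.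
apply: filter_forall => i; apply: filter_forall => j.
exact: (fM i j (P i j) (MP i j)).
Qed.

Lemma cvg_entry (T : topologicalType) m n (f : Z -> 'M[T]_(m, n)) (M : 'M[T]_(m, n)) i j :
  f @ F --> M -> (fun z => f z i j) @ F --> M i j.
Proof.
move=> fM A MA; apply: (fM [set N | A (N i j)]).
exists (fun i' j' => [set x | i' = i -> j' = j -> A x]) => /=.
  move=> i' j'; have [->|/eqP ne] := eqVneq i' i; last (apply: filterS (@filterT _ (nbhs _) _) => x _; by [move/ne|move=> _ /ne]).
  have [->|/eqP ne] := eqVneq j' j; last (apply: filterS (@filterT _ (nbhs _) _) => x _; by [move/ne|move=> _ /ne]).
  by apply: filterS MA => x Ax.
by move=> N /(_ i j) /=; exact.
Qed.

Lemma cvg_addC (f g : Z -> C) (a b : C) :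
  f @ F --> a -> g @ F --> b -> (fun z => f z + g z) @ F --> (a + b : C).
Proof. by move=> fa gb; have := @cvgD C C Z F FF f g a b fa gb. Qed.

Lemma cvg_mulC (f g : Z -> C) (a b : C) :
  f @ F --> a -> g @ F --> b -> (fun z => f z * g z) @ F --> (a * b : C).
Proof. by move=> fa gb; have := @cvgM C Z F FF f g a b fa gb. Qed.

Lemma cvg_invC (f : Z -> C) (a : C) : a != 0 ->
  f @ F --> a -> (fun z => (f z)^-1) @ F --> (a^-1 : C).
Proof. by move=> a0 fa; have := @cvgV C Z F FF f a a0 fa. Qed.

Lemma cvg_sumC (I : Type) (r : seq I) (f : I -> Z -> C) (a : I -> C) :
  (forall i, f i @ F --> a i) ->
  (fun z => \sum_(i <- r) f i z) @ F --> (\sum_(i <- r) a i : C).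
Proof.
move=> fa; elim: r => [|i r IH].
  by under eq_fun do rewrite big_nil; rewrite big_nil; exact: cvg_cst.
under eq_fun do rewrite big_cons; rewrite big_cons.
exact: (@cvg_addC (f i) _ _ _ (fa i) IH).
Qed.

Lemma cvg_prodC (I : Type) (r : seq I) (f : I -> Z -> C) (a : I -> C) :
  (forall i, f i @ F --> a i) ->
  (fun z => \prod_(i <- r) f i z) @ F --> (\prod_(i <- r) a i : C).
Proof.
move=> fa; elim: r => [|i r IH].
  by under eq_fun do rewrite big_nil; rewrite big_nil; exact: cvg_cst.
under eq_fun do rewrite big_cons; rewrite big_cons.
exact: (@cvg_mulC (f i) _ _ _ (fa i) IH).
Qed.

Lemma cvg_mulmx m n p (f : Z -> 'M[C]_(m, n)) (g : Z -> 'M[C]_(n, p))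
    (a : 'M[C]_(m, n)) (b : 'M[C]_(n, p)) :
  f @ F --> a -> g @ F --> b -> (fun z => f z *m g z) @ F --> a *m b.
Proof.
move=> fa gb; apply: cvg_mx => i j; rewrite mxE.
rewrite (_ : (fun _ => _) = fun z => \sum_k f z i k * g z k j); last first.
  by apply/funext => z; rewrite mxE.
apply: cvg_sumC => k.
exact: (@cvg_mulC (fun z => f z i k) (fun z => g z k j) _ _ (cvg_entry fa) (cvg_entry gb)).
Qed.

Lemma cvg_addmx m n (f g : Z -> 'M[C]_(m, n)) (a b : 'M[C]_(m, n)) :
  f @ F --> a -> g @ F --> b -> (fun z => f z + g z) @ F --> (a + b : 'M[C]_(m, n)).
Proof.
move=> fa gb; apply: cvg_mx => i j; rewrite mxE.
rewrite (_ : (fun _ => _) = fun z => f z i j + g z i j); last first.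
  by apply/funext => z; rewrite mxE.
exact: (@cvg_addC (fun z => f z i j) (fun z => g z i j) _ _ (cvg_entry fa) (cvg_entry gb)).
Qed.

Lemma cvg_scalemx m n (f : Z -> C) (g : Z -> 'M[C]_(m, n)) (a : C) (b : 'M[C]_(m, n)) :
  f @ F --> a -> g @ F --> b -> (fun z => f z *: g z) @ F --> (a *: b : 'M[C]_(m, n)).
Proof.
move=> fa gb; apply: cvg_mx => i j; rewrite mxE.
rewrite (_ : (fun _ => _) = fun z => f z * g z i j); last first.
  by apply/funext => z; rewrite mxE.
exact: (@cvg_mulC f (fun z => g z i j) a (b i j) fa (cvg_entry gb)).
Qed.

Lemma cvg_oppmx m n (f : Z -> 'M[C]_(m, n)) (a : 'M[C]_(m, n)) :
  f @ F --> a -> (fun z => - f z) @ F --> (- a : 'M[C]_(m, n)).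
Proof.
move=> fa; rewrite -scaleN1r (_ : (fun _ => _) = fun z => -1 *: f z).
  exact: (@cvg_scalemx _ _ (fun=> -1) f _ _ (@cvg_cst _ _ _ _ FF) fa).
by apply/funext => z; rewrite scaleN1r.
Qed.

Lemma cvg_trmx m n (f : Z -> 'M[C]_(m, n)) (a : 'M[C]_(m, n)) :
  f @ F --> a -> (fun z => (f z)^T) @ F --> a^T.
Proof.
move=> fa; apply: cvg_mx => i j; rewrite mxE.
rewrite (_ : (fun _ => _) = fun z => f z j i); first exact: cvg_entry.
by apply/funext => z; rewrite mxE.
Qed.

Lemma cvg_det n (f : Z -> 'M[C]_n) (a : 'M[C]_n) :
  f @ F --> a -> (fun z => \det (f z)) @ F --> \det a.
Proof.
move=> fa; apply: cvg_sumC => s.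
apply: (@cvg_mulC (fun=> _) (fun z => \prod_i f z i (s i))); first exact: cvg_cst.
by apply: cvg_prodC => i; exact: (cvg_entry fa).
Qed.

Lemma cvg_adj n (f : Z -> 'M[C]_n) (a : 'M[C]_n) :
  f @ F --> a -> (fun z => \adj (f z)) @ F --> \adj a.
Proof.
move=> fa; apply: cvg_mx => i j; rewrite mxE.
rewrite (_ : (fun _ => _) = fun z => cofactor (f z) j i); last first.
  by apply/funext => z; rewrite mxE.
apply: (@cvg_mulC (fun=> _) (fun z => \det (row' j (col' i (f z)))));
  first exact: cvg_cst.
apply: cvg_det; apply: cvg_mx => k l; rewrite !mxE.
rewrite (_ : (fun _ => _) = fun z => f z (lift j k) (lift i l)); last first.
  by apply/funext => z; rewrite !mxE.
exact: cvg_entry.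
Qed.

Lemma cvg_conj (f : Z -> C) (a : C) :
  f @ F --> a -> (fun z => (f z)^*%C) @ F --> (a^*%C : C).
Proof.
move=> fa; apply/(@cvgrPdist_lt C C Z F FF) => e e0.
move/(@cvgrPdist_lt C C Z F FF)/(_ e e0): fa.
by apply: filterS => z; rewrite -rmorphB normcJ.
Qed.

Lemma near_neq0 (f : Z -> C) (a : C) :
  f @ F --> a -> a != 0 -> \forall z \near F, f z != 0.
Proof. by move=> fa a0; have := @cvgr_neq0 C C Z F FF f a fa a0. Qed.

Lemma cvg_Re (f : Z -> C) (a : C) :
  f @ F --> a -> (fun z => complex.Re (f z)) @ F --> complex.Re a.
Proof.
move=> fa; apply/(@cvgrPdist_lt R R Z F FF) => e e0.
have e0' : 0 < e%:C%C :> C by rewrite ltcR.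
move/(@cvgrPdist_lt C C Z F FF)/(_ _ e0'): fa.
apply: filterS => z h; rewrite -ltcR; apply: le_lt_trans h.
by apply: le_trans (normc_ge_Re _); rewrite raddfB.
Qed.

Lemma cvg_real (f : Z -> R) (a : R) : f @ F --> a -> (fun z => (f z)%:C%C : C) @ F --> (a%:C%C : C).
Proof.
move=> fa; apply/(@cvgrPdist_lt C C Z F FF) => e e0.
have eE : e = (complex.Re e)%:C%C by rewrite RRe_real // gtr0_real.
move: e0; rewrite eE ltcR => e0; move/(@cvgrPdist_lt R R Z F FF)/(_ _ e0): fa.
by apply: filterS => z; rewrite -rmorphB normc_def /= expr0n addr0 sqrtr_sqr ltcR.
Qed.

Lemma cvg_complex (f g : Z -> R) (a b : R) : f @ F --> a -> g @ F --> b ->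
   (fun z => (f z +i* g z)%C : C) @ F --> ((a +i* b)%C : C).
Proof.
move=> fa gb; rewrite (complexE (a +i* b)%C) /=.
rewrite (_ : (fun _ => _) = fun z => (f z)%:C%C + 'i%C * (g z)%:C%C); last first.
  by apply/funext => z; rewrite (complexE (_ +i* _)%C).
apply: (@cvg_addC (fun z => (f z)%:C%C) (fun z => 'i%C * (g z)%:C%C)); first exact: cvg_real.
exact: (@cvg_mulC (fun=> _) _ _ _ (@cvg_cst _ _ _ _ FF) (cvg_real gb)).
Qed.

End MatrixLimits.

(** * Lifting homotopies by local transport *)

Section UnitSquare.
Variable R : realType.
Local Notation C := R[i].
Local Notation I := (unitI R).

Lemma nbhs_unitI (s : I) (W : set I) : nbhs s W ->
  exists2 r : R, 0 < r & forall t : I, `|uval s - uval t| < r -> W t.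
Proof.
rewrite -{1}(uvalK s) => /(@clip_continuous R (uval s)).
rewrite /nbhs /= => /nbhs_ballP[r /= r0 rW]; exists r => // t st.
by rewrite -(uvalK t); exact: rW.
Qed.

Lemma unitI_image : [set: I] = @clip R @` `[0, 1].
Proof.
apply/seteqP; split=> // s _; exists (uval s); last exact: uvalK.
by rewrite /= in_itv /= uval_ge0 uval_le1.
Qed.

Lemma unitI_compact : compact [set: I].
Proof.
rewrite unitI_image; apply: continuous_compact; last exact: segment_compact.
by apply: continuous_subspaceT; exact: clip_continuous.
Qed.

Lemma unitI_connected : connected [set: I].
Proof.
rewrite unitI_image; apply: connected_continuous_connected; first exact: segment_connected.
by apply: continuous_subspaceT; exact: clip_continuous.
Qed.

(** A Lebesgue number: a neighbourhood of the diagonal of the compact square contains a band of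
    uniform width. Near-covering compactness, applied to the filter of large [N], fixes the width
    once for all points. *)
Lemma square_lebesgue (D : I * I -> I * I -> Prop) :
  (forall v : I * I, nbhs (v, v) [set w | D w.1 w.2]) ->
  exists N : nat, forall v w,
    `|uval v.1 - uval w.1| <= N.+1%:R^-1 -> `|uval v.2 - uval w.2| <= N.+1%:R^-1 -> D v w.
Proof.
move=> Ddiag.
have /compact_near_coveringP cov : compact [set: I * I].
  have -> : [set: I * I] = [set: I] `*` [set: I] by apply/seteqP; split.
  by apply: compact_setX; exact: unitI_compact.
pose P (N : nat) (v : I * I) := forall w,
    `|uval v.1 - uval w.1| <= N.+1%:R^-1 -> `|uval v.2 - uval w.2| <= N.+1%:R^-1 -> D v w.
have [|N _ PN] := cov nat \oo P _; last first.
  by exists N => v w; apply: (PN N) => //=.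
move=> [s t] _; have [[A B] /= [[[A1 A2] /= [A1s A2t] AA] [[B1 B2] /= [B1s B2t] BB]] sub] := Ddiag (s, t).
have [a a0 aP] := nbhs_unitI (filterI A1s B1s).
have [b b0 bP] := nbhs_unitI (filterI A2t B2t).
(* Half of both radii, so that a point [e]-close to one that is itself [e]-close to [(s, t)] is
   still inside. *)
pose e : R := Num.min a b / 2.
have e0 : 0 < e by rewrite divr_gt0 // lt_min a0.
have ea : e + e <= a by rewrite -splitr ge_min lexx.
have eb : e + e <= b by rewrite -splitr ge_min lexx orbT.
clearbody e.
have near1 (u : I) : \forall u' \near u, `|uval u - uval u'| < e.
  by have /cvgrPdist_lt/(_ e e0) := @uval_continuous R u.
exists ([set v : I * I | `|uval s - uval v.1| < e /\ `|uval t - uval v.2| < e],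
        [set N : nat | N.+1%:R^-1 < e]).
  split=> /=; last exact: (near_infty_natSinv_lt (PosNum e0)).
  exists ([set u | `|uval s - uval u| < e], [set u | `|uval t - uval u| < e]) => //=.
  by split; exact: near1.
move=> [[s' t'] N] /= [[ss' tt'] Ne] [s'' t''] /= h1 h2.
have ea' : e <= a by apply: le_trans ea; rewrite lerDl ltW.
have eb' : e <= b by apply: le_trans eb; rewrite lerDl ltW.
apply: (sub ((s', t'), (s'', t''))); split=> /=.
  by apply: AA; split=> /=; [apply: (aP _ (lt_le_trans ss' ea')).1
    |apply: (bP _ (lt_le_trans tt' eb')).1].
apply: BB; split=> /=.
  apply: (aP _ _).2; apply: le_lt_trans (ler_distD (uval s') _ _) _.
  by apply: lt_le_trans ea; rewrite ltr_leD // (le_trans h1) // ltW.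
apply: (bP _ _).2; apply: le_lt_trans (ler_distD (uval t') _ _) _.
by apply: lt_le_trans eb; rewrite ltr_leD // (le_trans h2) // ltW.
Qed.

(** Subdividing [[0, t]] for each [t], instead of [[0, 1]] once, makes every lift a product of
    exactly [N.+1] transports; it is then continuous in [t] with no strips to glue. *)
Definition subtime (N k : nat) (t : I) : I := clip (k%:R / N.+1%:R * uval t).

Lemma uval_subtime N k t : (k <= N.+1)%N -> uval (subtime N k t) = k%:R / N.+1%:R * uval t.
Proof.
move=> kN; rewrite uval_clip clipR_id // ?mulr_ge0 ?uval_ge0 //.
by rewrite mulr_ile1 ?uval_ge0 ?uval_le1 // ler_pdivrMr ?mul1r ?ler_nat // ltr0n.
Qed.

Lemma subtime0 N t : subtime N 0 t = zero.
Proof. by apply: uval_inj; rewrite uval_subtime // uval0 !mul0r. Qed.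

Lemma subtime_last N t : subtime N N.+1 t = t.
Proof. by apply: uval_inj; rewrite uval_subtime // divff ?mul1r ?pnatr_eq0. Qed.

Lemma subtime_continuous N k : continuous (subtime N k).
Proof.
rewrite (_ : subtime N k = fun t => clip (k%:R / N.+1%:R * uval t + 0)).
  by apply: clip_affine_continuous; exact: uval_continuous.
by apply/funext => t; rewrite addr0.
Qed.

Lemma subtime_dist N k t : (k <= N)%N ->
  `|uval (subtime N k t) - uval (subtime N k.+1 t)| <= N.+1%:R^-1.
Proof.
move=> kN; rewrite !uval_subtime // 1?ltnW // -mulrBl -mulrBl -natr1 opprD addNKr.
rewrite mulN1r mulNr normrN ger0_norm ?mulr_ge0 ?uval_ge0 ?invr_ge0 //.
by rewrite ler_piMr ?uval_le1 ?invr_ge0.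
Qed.

(* [d v w] is a transport matrix carrying the fibre of [q] over [F v] into the
   fibre over [F w], defined when [v] and [w] are close. *)
Lemma transport_lift (X : Type) n (E : set 'M[C]_n) (q : 'M[C]_n -> X)
    (F : I * I -> X) (d : I * I -> I * I -> 'M[C]_n)
    (D : I * I -> I * I -> Prop) (g : I -> 'M[C]_n) :
  (forall v : I * I, nbhs (v, v) [set w | D w.1 w.2]) ->
  (forall v w, D v w -> (fun u => d u.1 u.2) @ (v, w) --> d v w) ->
  (forall v w A, D v w -> E A -> q A = F v -> E (A *m d v w) /\ q (A *m d v w) = F w) ->
  (forall v w, D v w -> F v = F w -> d v w = 1%:M) ->
  continuous g -> (forall s, E (g s)) -> (forall s, q (g s) = F (s, zero)) ->
  exists G : I * I -> 'M[C]_n,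
    [/\ continuous G, forall v, E (G v), forall v, q (G v) = F v,
        forall s, G (s, zero) = g s &
        forall s, (forall t, F (s, t) = F (s, zero)) -> forall t, G (s, t) = g s].
Proof.
move=> Ddiag dc dE d1 gc gE gF.
have [N DN] := square_lebesgue Ddiag.
have Dk k s t : (k <= N)%N -> D (s, subtime N k t) (s, subtime N k.+1 t).
  by move=> kN; apply: DN => /=; [rewrite subrr normr0 invr_ge0|exact: subtime_dist].
pose G := fix G k (v : I * I) := if k is j.+1 then
  G j v *m d (v.1, subtime N j v.2) (v.1, subtime N j.+1 v.2) else g v.1.
have GP k : (k <= N.+1)%N -> [/\ continuous (G k), forall v, E (G k v),
    forall v, q (G k v) = F (v.1, subtime N k v.2) &
    forall s t, (forall t', F (s, t') = F (s, zero)) -> G k (s, t) = g s].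
  elim: k => [|k IH] kN.
    split=> [|v|v|s t] //=; last by rewrite gF subtime0.
    by apply: (comp_continuous (f := fst)) => // v; exact: cvg_fst.
  have {IH} [cG EG qG cstG] := IH (ltnW kN).
  split=> /= [|v|v|s t Fs].
  - move=> v.
    have cs j : (fun v : I * I => (v.1, subtime N j v.2)) @ v --> (v.1, subtime N j v.2).
      apply: (@pair_continuous _ _ _ fst (fun v : I * I => subtime N j v.2)).
        by move=> u; exact: cvg_fst.
      by apply: (comp_continuous (f := snd)); [move=> u; exact: cvg_snd|exact: subtime_continuous].
    have cd : (fun u : I * I => d (u.1, subtime N k u.2) (u.1, subtime N k.+1 u.2)) @ v
        --> d (v.1, subtime N k v.2) (v.1, subtime N k.+1 v.2).
      exact: (cvg_comp _ _ (cvg_pair (cs k) (cs k.+1)) (dc _ _ (Dk k v.1 v.2 kN))).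
    exact: (@cvg_mulmx R _ (nbhs v) _ _ _ _ (G k) _ _ _ (cG v) cd).
  - exact: (dE _ _ _ (Dk k v.1 v.2 kN) (EG v) (qG v)).1.
  - exact: (dE _ _ _ (Dk k v.1 v.2 kN) (EG v) (qG v)).2.
  (* Where [F] is constant in time, every transport along the way is the identity. *)
  - rewrite cstG // d1 ?mulmx1 //; first exact: Dk.
    by rewrite (Fs (subtime _ _ _)) [RHS]Fs.
have [cG EG qG cstG] := GP N.+1 (leqnn _).
exists (G N.+1); split=> // [v|s|s Fs t].
- by rewrite qG subtime_last; case: v.
- suff H k : (k <= N.+1)%N -> G k (s, zero) = g s by exact: H.
  elim: k => //= k IH kN; rewrite IH 1?ltnW // d1 ?mulmx1 //; first exact: Dk.
  congr (F (s, _)); apply: uval_inj; rewrite !uval_subtime ?uval0 ?mulr0 //.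
  exact: ltnW.
- exact: cstG.
Qed.

End UnitSquare.

Lemma poly_nonroot (R : realFieldType) (p : {poly R}) : p != 0 -> exists x : R, p.[x] != 0.
Proof.
move=> p0; apply/not_existsP => np.
have np' x : root p x by have := np x; rewrite /root; case: eqP.
have := max_poly_roots (rs := [seq (i%:R : R) | i <- iota 0 (size p)]) p0.
rewrite size_map size_iota ltnn => H; apply: (notF (H _ _)).
  by apply/allP => x _; exact: np'.
by rewrite map_inj_uniq ?iota_uniq // => i j /eqP; rewrite eqr_nat => /eqP.
Qed.

(** Sherman-Morrison: [a *m b] squares to [x] times itself, so the inverse is
    [1 - a b / (1 + x)]. *)
Lemma unitmx_add1_rank1 (K : fieldType) n (a : 'cV[K]_n) (b : 'rV[K]_n) :
  1 + (b *m a) 0 0 != 0 -> 1%:M + a *m b \in unitmx.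
Proof.
set x := (b *m a) 0 0 => x0; pose k := (1 + x)^-1.
have MM : (a *m b) *m (a *m b) = x *: (a *m b).
  by rewrite -mulmxA (mulmxA b) [b *m a]mx11_scalar mul_scalar_mx -scalemxAr.
have E : (1%:M + a *m b) *m (1%:M - k *: (a *m b)) = 1%:M.
  rewrite mulmxDl mul1mx mulmxBr mulmx1 -scalemxAr MM scalerA.
  by apply/matrixP => i j; rewrite !mxE /k; field.
by have [] := mulmx1_unit E.
Qed.

(** * Loops in GL_n(C) and SL_3(C) *)

Section RowTransport.
Variables (K : fieldType) (n : nat) (u w : 'rV[K]_n) (c : 'cV[K]_n).
Hypothesis uc : (u *m c) 0 0 != 0.

(** A rank-one correction of the identity: [c], normalized by [u *m c], sends [u] to 1, so the
    correction adds exactly [w - u] to [u]. It is affine in [w] and trivial for [w = u]. *)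
Definition row_transport : 'M[K]_n := 1%:M + ((u *m c) 0 0)^-1 *: (c *m (w - u)).

Lemma row_transport_unit : (w *m c) 0 0 != 0 -> row_transport \in unitmx.
Proof.
move=> wc; rewrite /row_transport scalemxAl; apply: unitmx_add1_rank1.
have -> : ((w - u) *m (((u *m c) 0 0)^-1 *: c)) 0 0 = ((u *m c) 0 0)^-1 * ((w *m c) 0 0 - (u *m c) 0 0).
  by rewrite -scalemxAr [in LHS]mxE mulmxBl; congr (_ * _); rewrite [LHS]mxE; congr (_ + _); rewrite mxE.
by rewrite mulrBr mulVf // addrC subrK mulf_neq0 // invr_eq0.
Qed.

Lemma mul_row_transport : u *m row_transport = w.
Proof.
rewrite /row_transport mulmxDr mulmx1 -scalemxAr mulmxA [u *m c]mx11_scalar.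
by rewrite mul_scalar_mx scalerA mxE eqxx mulr1n mulVf // scale1r addrC subrK.
Qed.

End RowTransport.

Section GeneralLinearLoops.
Variable R : realType.
Local Notation C := R[i].
Local Notation I := (unitI R).

(** The groups GL and SL stay subsets [E] of the space of all matrices, so that the limit lemmas on
    matrices apply to the homotopies directly. *)
Definition homotopic_in (T : topologicalType) (E : set T) (f g : I -> T) : Prop :=
  exists H : I * I -> T,
    [/\ continuous H, forall v, E (H v), forall s, H (s, zero) = f s,
        forall s, H (s, one) = g s &
        forall t, H (zero, t) = f zero /\ H (one, t) = f one].

Lemma homotopic_in_trans (T : topologicalType) (E : set T) (f g h : I -> T) :
  homotopic_in E f g -> homotopic_in E g h -> homotopic_in E f h.
Proof.
move=> [H [cH EH H0 H1 He]] [K [cK EK K0 K1 Ke]].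
have c2 : continuous (fun st : I * I => uval st.2).
  apply: (comp_continuous (f := snd)); last exact: uval_continuous.
  by move=> st; exact: cvg_snd.
have fg : f zero = g zero /\ f one = g one.
  by rewrite -(He one).1 -(He one).2 !H1.
exists (fun st => if uval st.2 <= 2^-1 then H (st.1, clip (2 * uval st.2 + 0))
   else K (st.1, clip (2 * uval st.2 + -1))); split => /=.
- apply: (@pasting _ _ _ (fun st : I * I => uval st.2)) => //.
  + apply: (comp_continuous _ cH).
    by apply: pair_continuous; [move=> st; exact: cvg_fst|exact: clip_affine_continuous].
  + apply: (comp_continuous _ cK).
    by apply: pair_continuous; [move=> st; exact: cvg_fst|exact: clip_affine_continuous].
  + by move=> [s t] /= ->; rewrite addr0 clip2_half clip2B1_half H1 K0.
- by move=> v; case: ifP.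
- move=> s; rewrite uval0 invr_ge0 ler0n -H0; congr (H (_, _)); apply: uval_inj.
  by rewrite uval_clip uval0 clipR_id; lra.
- move=> s; rewrite uval1 ifF; last by apply/negbTE; rewrite -ltNge; lra.
  rewrite -K1; congr (K (_, _)); apply: uval_inj.
  by rewrite uval_clip uval1 clipR_id; lra.
- by move=> t; rewrite !(He _).1 !(He _).2 !(Ke _).1 !(Ke _).2 -fg.1 -fg.2 !if_same.
Qed.

(** Continuity of [phi] is asked only at points of [E]; this admits the retraction of GL_3 onto
    SL_3, which divides by the determinant. *)
Lemma homotopic_in_map (T U : topologicalType) (E : set T) (E' : set U) (phi : T -> U)
    (f g : I -> T) :
  (forall x, E x -> phi @ x --> phi x) -> (forall x, E x -> E' (phi x)) ->
  homotopic_in E f g -> homotopic_in E' (phi \o f) (phi \o g).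
Proof.
move=> cphi Ephi [H [cH EH H0 H1 He]]; exists (phi \o H); split=> [v|v|s|s|t] /=.
- by apply: (continuous_comp (cH v)); exact: cphi.
- exact/Ephi.
- by rewrite H0.
- by rewrite H1.
- by rewrite (He t).1 (He t).2.
Qed.

Definition GL n : set 'M[C]_n := [set A | A \in unitmx].

Definition ctrmx m n (u : 'M[C]_(m, n)) : 'M[C]_(n, m) := map_mx (fun z => z^*%C) u^T.

Definition hdot n (u w : 'rV[C]_n) : C := (u *m ctrmx w) 0 0.

Lemma hdotE n (u w : 'rV[C]_n) : hdot u w = \sum_j u 0 j * (w 0 j)^*%C.
Proof. by rewrite /hdot mxE; apply: eq_bigr => j _; rewrite !mxE. Qed.

Lemma hdot_ge0 n (u : 'rV[C]_n) : 0 <= hdot u u.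
Proof. by rewrite hdotE sumr_ge0 // => j _; rewrite -sqr_normc exprn_ge0. Qed.

Lemma hdot_eq0 n (u : 'rV[C]_n) : (hdot u u == 0) = (u == 0).
Proof.
rewrite hdotE; apply/idP/eqP => [/eqP /psumr_eq0P u0|->]; last first.
  by rewrite big1 // => j _; rewrite mxE mul0r.
apply/rowP => j; rewrite mxE; apply/eqP; rewrite -normr_eq0 -sqrf_eq0 sqr_normc u0 //.
by move=> k _; rewrite -sqr_normc exprn_ge0.
Qed.

Lemma Re_hdot_gt0 n (u : 'rV[C]_n) : u != 0 -> 0 < complex.Re (hdot u u).
Proof.
by move=> u0; have := hdot_ge0 u; rewrite le0r hdot_eq0 (negbTE u0) /= ltcE => /andP[].
Qed.

Lemma hdotDl n (u v w : 'rV[C]_n) : hdot (u + v) w = hdot u w + hdot v w.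
Proof. by rewrite /hdot mulmxDl mxE. Qed.

Lemma hdotZl n a (u w : 'rV[C]_n) : hdot (a *: u) w = a * hdot u w.
Proof. by rewrite /hdot -scalemxAl mxE. Qed.

Lemma cvg_ctrmx (Z : Type) (F : set_system Z) {FF : Filter F} m n
    (f : Z -> 'M[C]_(m, n)) (a : 'M[C]_(m, n)) :
  f @ F --> a -> (fun z => ctrmx (f z)) @ F --> ctrmx a.
Proof.
move=> fa; apply: cvg_mx => i j; rewrite !mxE.
under eq_fun do rewrite !mxE.
by apply: (@cvg_conj _ _ _ _ (fun z => f z j i)); exact: cvg_entry.
Qed.

Lemma cvg_hdot (Z : Type) (F : set_system Z) {FF : Filter F} n
    (f g : Z -> 'rV[C]_n) (a b : 'rV[C]_n) :
  f @ F --> a -> g @ F --> b -> (fun z => hdot (f z) (g z)) @ F --> hdot a b.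
Proof.
move=> fa gb; apply: (@cvg_entry _ _ _ _ _ (fun z => f z *m ctrmx (g z)) (a *m ctrmx b)).
by apply: cvg_mulmx => //; exact: cvg_ctrmx.
Qed.

Lemma cvg_row_transport (Z : Type) (F : set_system Z) {FF : Filter F} n
    (f g : Z -> 'rV[C]_n) (a b : 'rV[C]_n) :
  f @ F --> a -> g @ F --> b -> hdot a a != 0 ->
  (fun z => row_transport (f z) (g z) (ctrmx (f z))) @ F --> row_transport a b (ctrmx a).
Proof.
move=> fa gb aa; rewrite /row_transport.
have := cvg_addmx (@cvg_cst 'M[C]_n 1%:M _ F _) (cvg_scalemx (cvg_invC aa (cvg_hdot fa fa))
  (cvg_mulmx (cvg_ctrmx fa) (cvg_addmx gb (cvg_oppmx fa)))).
exact.
Qed.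

(* The transport [1 + (F v)^* (F w - F v) / |F v|^2] sends the row [F v] to [F w]. *)
Lemma row_homotopy n (g : I -> 'M[C]_n.+1) (c : I -> 'rV[C]_n.+1) :
  continuous g -> (forall s, g s \in unitmx) -> continuous c ->
  row 0 (g zero) = c zero -> row 0 (g one) = c one ->
  (forall s t : I, (1 - uval t)%:C%C *: row 0 (g s) + (uval t)%:C%C *: c s != 0) ->
  exists g', [/\ continuous g', homotopic_in (@GL n.+1) g g' &
    forall s, row 0 (g' s) = c s].
Proof.
move=> cg ug cc e0 e1 nz.
pose F (v : I * I) : 'rV[C]_n.+1 := (1 - uval v.2)%:C%C *: row 0 (g v.1) + (uval v.2)%:C%C *: c v.1.
have c1 : continuous (@fst I I) by move=> v; exact: cvg_fst.
have c2 : continuous (@snd I I) by move=> v; exact: cvg_snd.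
have cu2 := comp_continuous c2 (@uval_continuous R).
have cF : continuous F.
  move=> v; apply: (@cvg_addmx _ _ _ _ _ _ (fun v => _ *: row 0 (g v.1)) (fun v => _ *: c v.1)).
    apply: cvg_scalemx; first by apply: cvg_real; apply: cvgB; [exact: cvg_cst|exact: cu2].
    apply: cvg_mx => i j; rewrite mxE; under eq_fun do rewrite mxE.
    by apply: cvg_entry; exact: (comp_continuous c1 cg).
  by apply: cvg_scalemx; [apply: cvg_real; exact: cu2|exact: (comp_continuous c1 cc)].
pose d (v w : I * I) : 'M[C]_n.+1 := row_transport (F v) (F w) (ctrmx (F v)).
(* Exactly the condition under which the transport from [F v] to [F w] is invertible; it holds at
   [w = v] because the segments avoid 0. *)
pose D v w := hdot (F w) (F v) != 0.
have nF v : hdot (F v) (F v) != 0 by rewrite hdot_eq0; exact: nz.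
have cFl : continuous (fun w : (I * I) * (I * I) => F w.1).
  by apply: (comp_continuous (f := fst) _ cF) => w; exact: cvg_fst.
have cFr : continuous (fun w : (I * I) * (I * I) => F w.2).
  by apply: (comp_continuous (f := snd) _ cF) => w; exact: cvg_snd.
have [|||||s|s|G [cG uG qG G0 Gc]] := @transport_lift R _ _ (@GL n.+1) (row 0) F d D g.
- by move=> v; exact: (near_neq0 (cvg_hdot (cFr (v, v)) (cFl (v, v))) (nF v)).
- move=> v w _.
  have A := cFl (v, w); have B := cFr (v, w).
  exact: (cvg_row_transport A B (nF v)).
- move=> v w A Dvw /= uA qA; split.
    by rewrite /GL /= unitmx_mul uA; exact: (row_transport_unit (nF v) Dvw).
  rewrite row_mul qA; exact: (mul_row_transport _ (nF v)).
- by move=> v w _ Fvw; rewrite /d /row_transport Fvw subrr mulmx0 scaler0 addr0.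
- exact: cg.
- exact: ug.
- by rewrite /F uval0 subr0 !(rmorph1, rmorph0) scale1r scale0r addr0.
exists (fun s => G (s, one)); split.
- move=> s.
  have : continuous (fun s : I => G (s, one)); last exact.
  apply: (comp_continuous (f := fun s : I => (s, one : I)) _ cG).
  apply: (@pair_continuous I I I id (fun=> one)) => t; first exact: cvg_id.
  exact: (@cvg_cst (I : topologicalType) (one : I) I (nbhs t) _).
(* At both endpoints of the loop the row does not move, hence neither does the lift. *)
- exists G; split=> // t; split; apply: Gc => t'.
  + by rewrite /F /= e0 -!scalerDl -!rmorphD /= !subrK.
  + by rewrite /F /= e1 -!scalerDl -!rmorphD /= !subrK.
- by move=> s; rewrite qG /F /= uval1 subrr rmorph0 rmorph1 scale0r add0r scale1r.
Qed.

End GeneralLinearLoops.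

Lemma fst_continuous (U V : topologicalType) : continuous (@fst U V).
Proof. by move=> u; exact: cvg_fst. Qed.

Lemma snd_continuous (U V : topologicalType) : continuous (@snd U V).
Proof. by move=> u; exact: cvg_snd. Qed.

(** * Polygonal approximation of loops of non-zero rows *)

Section Detour.
Variable R : realType.
Local Notation C := R[i].
Local Notation I := (unitI R).

Lemma hat_index (N : nat) (s : I) : exists2 k : nat, (k <= N)%N &
  (k%:R <= N.+1%:R * uval s) /\ (N.+1%:R * uval s <= k.+1%:R).
Proof.
have : N.+1%:R * uval s <= N.+1%:R by rewrite ler_piMr ?uval_le1.
have : 0 <= N.+1%:R * uval s by rewrite mulr_ge0 ?uval_ge0.
move: (N.+1%:R * uval s) => x x0; elim: N => [|N IH] xN.
  by exists 0%N.
have [xN'|xN'] := lerP x N.+1%:R; last by exists N.+1 => //; rewrite ltW.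
by have [k kN kx] := IH xN'; exists k => //; exact: leqW.
Qed.

(** The tent function of the node [k / N.+1], supported on the two adjacent cells. *)
Definition hat (N k : nat) (s : I) : R := Num.max 0 (1 - `|N.+1%:R * uval s - k%:R|).

Lemma hat_ge0 N k s : 0 <= hat N k s.
Proof. by rewrite /hat le_max lexx. Qed.

Lemma hat_continuous N k : continuous (hat N k).
Proof.
have c0 := @cst_continuous I R 0.
have c1 : continuous (fun s : I => 1 - `|N.+1%:R * uval s - k%:R| : R).
  move=> s.
  have := cvgB (@cvg_cst R 1 I (nbhs s) _) (cvg_norm (cvgB
    (cvgM (@cvg_cst R N.+1%:R I (nbhs s) _) (@uval_continuous R s))
    (@cvg_cst R k%:R I (nbhs s) _))).
  exact.
exact: (max_fun_continuous c0 c1).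
Qed.

Lemma hat_eq0 N k s : 1 <= `|N.+1%:R * uval s - k%:R| -> hat N k s = 0.
Proof. by move=> h; rewrite /hat max_l // subr_le0. Qed.

Lemma hat_gt0 N k s : 0 < hat N k s ->  `|uval s - k%:R / N.+1%:R| <= N.+1%:R^-1.
Proof.
rewrite /hat lt_max ltxx subr_gt0 /= => h.
rewrite -(ler_pM2l (_ : 0 < N.+1%:R)) ?ltr0n // divff ?pnatr_eq0 //.
rewrite -{1}(ger0_norm (_ : 0 <= N.+1%:R)) // -normrM mulrBr mulrCA divff ?pnatr_eq0 //.
by rewrite mulr1 ltW.
Qed.

Definition node (N k : nat) : I := clip (k%:R / N.+1%:R).

Lemma uval_node N k : (k <= N.+1)%N -> uval (node N k) = k%:R / N.+1%:R.
Proof.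
move=> kN; rewrite uval_clip clipR_id // ?mulr_ge0 //.
by rewrite ler_pdivrMr ?mul1r ?ler_nat // ltr0n.
Qed.

(** Piecewise linear interpolation of [c] at the nodes, written with tents so that continuity needs
    no pasting. *)
Definition polyline n (c : I -> 'rV[C]_n) N (s : I) : 'rV[C]_n :=
  \sum_(k < N.+2) (hat N k s)%:C%C *: c (node N k).

Lemma polyline_continuous n (c : I -> 'rV[C]_n) N : continuous (polyline c N).
Proof.
move=> s; apply: (@cvg_mx I (nbhs s) (nbhs_filter s)) => i j; rewrite /polyline summxE.
under eq_fun do rewrite summxE; apply: cvg_sumC => k.
rewrite mxE; under eq_fun do rewrite mxE.
exact: (cvg_mulC (cvg_real (@hat_continuous N k s)) (@cvg_cst C (c (node N k) i j) I (nbhs s) _)).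
Qed.

Lemma polyline0 n (c : I -> 'rV[C]_n) N : polyline c N zero = c zero.
Proof.
rewrite /polyline big_ord_recl big1 => [|k _]; last first.
  by rewrite hat_eq0 ?scale0r // uval0 mulr0 sub0r normrN /= ger0_norm // ler1n.
have -> : node N 0 = zero by apply: uval_inj; rewrite uval_node // uval0 mul0r.
by rewrite /hat uval0 mulr0 subrr normr0 subr0 max_r // scale1r addr0.
Qed.

Lemma polyline1 n (c : I -> 'rV[C]_n) N : polyline c N one = c one.
Proof.
rewrite /polyline big_ord_recr big1 => [|k _]; last first.
  rewrite hat_eq0 ?scale0r // uval1 mulr1 /= ger0_norm ?subr_ge0 ?ler_nat 1?ltnW //.
  by rewrite lerBrDl natr1 ler_nat.
have -> : node N N.+1 = one.
  by apply: uval_inj; rewrite uval_node // uval1 divff // pnatr_eq0.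
rewrite /hat uval1 mulr1 subrr normr0 subr0 max_r // scale1r.
exact: add0r.
Qed.

(** For a fine mesh, the values of [c] at the nodes near [s] lie in the open half-space of vectors
    whose Hermitian product with [c s] has positive real part. This half-space is a convex cone
    containing [c s], so the polygon and the segments to it stay inside. *)
Lemma polyline_homotopy n (c : I -> 'rV[C]_n) : continuous c -> (forall s, c s != 0) ->
  exists N, forall s t : I,
    (1 - uval t)%:C%C *: c s + (uval t)%:C%C *: polyline c N s != 0.
Proof.
move=> cc nc.
pose D (v w : I * I) := 0 < complex.Re (hdot (c w.1) (c v.1)).
have [v|N DN] := @square_lebesgue R D.
  have c1 := comp_continuous (comp_continuous (@fst_continuous (I * I)%type (I * I)%type) (@fst_continuous I I)) cc.
  have c2 := comp_continuous (comp_continuous (@snd_continuous (I * I)%type (I * I)%type) (@fst_continuous I I)) cc.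
  exact: (cvgr_gt _ (cvg_Re (cvg_hdot (c2 (v, v)) (c1 (v, v)))) _ (Re_hdot_gt0 (nc v.1))).
exists N => s t; pose L u := complex.Re (hdot u (c s)).
have LD u v : L (u + v) = L u + L v by rewrite /L hdotDl raddfD.
have LZ (a : R) u : L (a%:C%C *: u) = a * L u.
  by rewrite /L hdotZl; case: (hdot u _) => x y /=; rewrite mul0r subr0.
have L0 : L 0 = 0 by have := LZ 0 0; rewrite scaler0 mul0r.
have Lc : 0 < L (c s) by exact: Re_hdot_gt0.
have Lh (k : 'I_N.+2) : 0 < hat N k s -> 0 < L (c (node N k)).
  move=> /hat_gt0 h; apply: (DN (s, zero) (node N k, zero)) => /=.
    by rewrite uval_node // -ltnS.
  by rewrite subrr normr0 invr_ge0.
have Lpoly : L (polyline c N s) = \sum_(k < N.+2) hat N k s * L (c (node N k)).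
  rewrite /polyline (big_morph L LD L0); apply: eq_bigr => k _; exact: LZ.
have Lterm (k : 'I_N.+2) : 0 <= hat N k s * L (c (node N k)).
  have := hat_ge0 N k s; rewrite le0r => /orP[/eqP ->|h]; first by rewrite mul0r.
  by rewrite mulr_ge0 // ltW // Lh.
have [k kN [k1 k2]] := hat_index N s.
have Lp : 0 < L (polyline c N s).
  (* Positivity is strict because some tent is non-zero at [s]: that of the left node of the cell,
     or that of the right node when [s] is that node. *)
  suff [j hj] : exists j : 'I_N.+2, 0 < hat N j s.
    rewrite Lpoly (bigD1 j) //= ltr_wpDr ?sumr_ge0 // mulr_gt0 //; exact: Lh.
  have kN2 : (k < N.+2)%N by rewrite ltnS leqW.
  have kN1 : (k.+1 < N.+2)%N by rewrite ltnS.
  move: k2; rewrite -natr1 => k2.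
  have [h|h] := ltrP (N.+1%:R * uval s - k%:R) 1.
    by exists (Ordinal kN2); rewrite /hat lt_max subr_gt0 /= ger0_norm ?subr_ge0 // h orbT.
  exists (Ordinal kN1); rewrite /hat lt_max subr_gt0 /= -natr1.
  by rewrite (_ : _ - _ = 0) ?normr0 ?ltr01 ?orbT //; apply/eqP; rewrite eq_le; apply/andP; split; lra.
apply: contraPneq (_ : L 0 = 0) => // <-; rewrite LD !LZ.
have t0 := uval_ge0 t; have t1 := uval_le1 t.
have [->|tn0] := eqVneq (uval t) 0; first by rewrite subr0 mul1r mul0r addr0; lra.
have := mulr_gt0 (_ : 0 < uval t) Lp; rewrite lt_neqAle eq_sym tn0 t0 => /(_ isT) h.
have := mulr_ge0 (_ : 0 <= 1 - uval t) (ltW Lc); rewrite subr_ge0 t1 => /(_ isT) h'.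
lra.
Qed.

End Detour.

(** A 3 by 2 matrix has a non-zero left kernel. It supplies the equation of a plane through 0 and
    two consecutive nodes. *)
Lemma annihilator2 (K : fieldType) (u v : 'rV[K]_3) :
  exists a : 'rV[K]_3, [/\ a != 0, a *m u^T = 0 & a *m v^T = 0].
Proof.
pose M : 'M[K]_(3, 1 + 1) := row_mx u^T v^T.
have kM : kermx M != 0.
  rewrite -mxrank_eq0 mxrank_ker subn_eq0 -ltnNge.
  exact: leq_ltn_trans (rank_leq_col M) _.
exists (nz_row (kermx M)); rewrite nz_row_eq0 kM.
have : nz_row (kermx M) *m M = 0 by apply/sub_kermxP; exact: nz_row_sub.
by rewrite mul_mx_row -[X in _ = X]row_mx0 => /eq_row_mx[].
Qed.

Lemma unitmx_block1 (K : comUnitRingType) n (L : 'M[K]_(n, 1)) (B : 'M[K]_n) :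
  (block_mx (1%:M : 'M[K]_1) 0 L B \in unitmx) = (B \in unitmx).
Proof. by rewrite !unitmxE det_lblock det1 mul1r. Qed.

(** * Contracting the first row and reducing the size of the matrices *)

Section Contraction.
Variable R : realType.
Local Notation C := R[i].
Local Notation I := (unitI R).

(* Three of the four real coordinates of the first two entries; the missing one
   is the only one not vanishing on the base point [delta_mx 0 0]. *)
Definition real_part3 n (z : 'rV[C]_n.+2) : 'rV[R]_3 :=
  \row_j [:: complex.Im (z 0 0); complex.Re (z 0 1); complex.Im (z 0 1)]`_j.

Lemma real_part3D n (u v : 'rV[C]_n.+2) : real_part3 (u + v) = real_part3 u + real_part3 v.
Proof. by apply/rowP => -[[|[|[|]]] ?] //; rewrite !mxE /= !raddfD. Qed.

Lemma real_part3Z n (a : R) (u : 'rV[C]_n.+2) : real_part3 (a%:C%C *: u) = a *: real_part3 u.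
Proof.
by apply/rowP => -[[|[|[|]]] ?] //; rewrite !mxE /=;
  [case: (u 0 0)|case: (u 0 1)|case: (u 0 1)] => x y /=; ring.
Qed.

Lemma real_part3_base n : real_part3 (delta_mx 0 0 : 'rV[C]_n.+2) = 0.
Proof. by apply/rowP => -[[|[|[|]]] ?] //; rewrite !mxE. Qed.

(** General position by the moment curve: the three real coordinates of [w] are [(1, x, x ^+ 2)],
    and such points lie in a given plane through 0 for at most two values of [x]. The entry ['i]
    also keeps the real part of the first coordinate free for the last contraction. *)
Lemma exists_detour n (c : I -> 'rV[C]_n.+2) N :
  exists w : 'rV[C]_n.+2, w 0 0 = 'i%C /\
   forall k, (k <= N)%N -> exists a : 'rV[R]_3,
    [/\ a *m (real_part3 (c (node R N k)))^T = 0,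
        a *m (real_part3 (c (node R N k.+1)))^T = 0 & a *m (real_part3 w)^T != 0].
Proof.
have [a aP] := choice (fun k => annihilator2 (real_part3 (c (node R N k))) (real_part3 (c (node R N k.+1)))).
(* The [k]-th plane equation evaluated along the moment curve; [x] is taken off the roots of the
   product of these polynomials. *)
pose q k := \poly_(j < 3) (a k 0 (inord j)).
have q0 k : q k != 0.
  have [ak _ _] := aP k; apply: contraNneq ak => qk; apply/eqP/rowP => j.
  have := congr1 (fun p : {poly R} => p`_j) qk.
  by rewrite coef_poly ltn_ord coef0 inord_val mxE.
have [x xP] : exists x : R, (\prod_(k < N.+1) q k).[x] != 0.
  by apply: poly_nonroot; apply/prodf_neq0 => k _; exact: q0.
exists (\row_j (if j == 0 then 'i%C else if j == 1 then (x +i* x ^+ 2)%C else 0)).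
split=> [|k kN]; first by rewrite mxE.
exists (a k); have [_ h1 h2] := aP k; split=> //.
move: xP; rewrite horner_prod => /prodf_neq0/(_ (Ordinal (kN : (k < N.+1)%N)) isT) /=.
apply: contra => /eqP/matrixP/(_ 0 0); rewrite !mxE !big_ord_recl big_ord0 !mxE /=.
rewrite /q horner_poly !big_ord_recl big_ord0 /= => h; apply/eqP; rewrite -[RHS]h.
have E0 : inord 0 = ord0 :> 'I_3 by apply/val_inj; rewrite /= inordK.
have E1 : inord 1 = lift ord0 ord0 :> 'I_3 by apply/val_inj; rewrite /= inordK.
have E2 : inord 2 = lift ord0 (lift ord0 ord0) :> 'I_3 by apply/val_inj; rewrite /= inordK.
by rewrite -![bump 0 0]/1%N -[bump 0 1]/2%N E0 E1 E2 expr0 expr1.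
Qed.

(** On a given cell only the two tents of its ends survive, so the plane equation [a] of that cell
    kills the polygon as well as the base vector, but not [w]. A zero on a segment thus forces
    [t = 0] or an endpoint in [s], and there the curves are visibly non-zero. *)
Lemma detour_homotopy n (c : I -> 'rV[C]_n.+2) N (w : 'rV[C]_n.+2) :
  c zero = delta_mx 0 0 -> c one = delta_mx 0 0 ->
  (forall k, (k <= N)%N -> exists a : 'rV[R]_3,
    [/\ a *m (real_part3 (c (node R N k)))^T = 0,
        a *m (real_part3 (c (node R N k.+1)))^T = 0 & a *m (real_part3 w)^T != 0]) ->
  (forall s, polyline c N s != 0) ->
  forall s t : I, (1 - uval t)%:C%C *: polyline c N s +
    (uval t)%:C%C *: (delta_mx 0 0 + (uval s * (1 - uval s))%:C%C *: w) != 0.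
Proof.
move=> c0 c1 wP nP s t.
have [k kN [k1 k2]] := hat_index N s; have [a [ak ak1 aw]] := wP k kN.
pose L (u : 'rV[C]_n.+2) : 'M[R]_1 := a *m (real_part3 u)^T.
have LD u v : L (u + v) = L u + L v by rewrite /L real_part3D linearD /= mulmxDr.
have LZ (r : R) u : L (r%:C%C *: u) = r *: L u.
  by rewrite /L real_part3Z linearZ /= -scalemxAr.
have L0 : L 0 = 0 by have := LZ 0 0; rewrite scaler0 scale0r.
have Lp : L (polyline c N s) = 0.
  rewrite /polyline (big_morph L LD L0) big1 // => j _; rewrite LZ.
  have [->|jk] := eqVneq (j : nat) k; first by rewrite /L ak scaler0.
  have [->|jk1] := eqVneq (j : nat) k.+1; first by rewrite /L ak1 scaler0.
  rewrite hat_eq0 ?scale0r //.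
  have [jlt|jge] := ltnP j k.
    have : (j.+1%:R : R) <= k%:R by rewrite ler_nat.
    rewrite -natr1 => h; rewrite ger0_norm; lra.
  have : (k.+2%:R : R) <= j%:R by rewrite ler_nat ltn_neqAle eq_sym jk1 ltn_neqAle eq_sym jk.
  rewrite -natr1 => h; rewrite ler0_norm; lra.
apply/eqP => sum0; move: (L0); rewrite -{1}sum0 LD !LZ Lp scaler0 add0r LD LZ.
rewrite {1}/L real_part3_base trmx0 mulmx0 add0r scalerA => /eqP.
rewrite scaler_eq0 (negbTE aw) orbF mulf_eq0 => /orP[/eqP t0|/eqP s0].
  move: sum0; rewrite t0 subr0 scale1r scale0r addr0 => p0.
  by have := nP s; rewrite p0 eqxx.
have Ps : polyline c N s = delta_mx 0 0.
  move/eqP: s0; rewrite mulf_eq0 => /orP[/eqP s0|]; last rewrite subr_eq0 eq_sym => /eqP s1.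
    by rewrite (_ : s = zero) ?polyline0 //; apply: uval_inj; rewrite uval0.
  by rewrite (_ : s = one) ?polyline1 //; apply: uval_inj; rewrite uval1.
move: sum0; rewrite s0 scale0r addr0 Ps -scalerDl -rmorphD subrK rmorph1 scale1r.
by move/rowP/(_ 0)/eqP; rewrite !mxE oner_eq0.
Qed.

(** The first entry keeps real part 1, because [w 0 0] is purely imaginary. *)
Lemma detour_contract n (w : 'rV[C]_n.+2) (s t : I) : w 0 0 = 'i%C ->
  (1 - uval t)%:C%C *: (delta_mx 0 0 + (uval s * (1 - uval s))%:C%C *: w) +
    (uval t)%:C%C *: delta_mx 0 0 != 0 :> 'rV[C]_n.+2.
Proof.
move=> w0; apply/eqP => /rowP/(_ 0); rewrite !mxE w0 /= !mulr1n.
move/(congr1 (@complex.Re R)) => /=; lra.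
Qed.

Lemma cvg_block_mx (Z : Type) (F : set_system Z) {FF : Filter F} m1 m2 n1 n2
    (f1 : Z -> 'M[C]_(m1, n1)) (f2 : Z -> 'M[C]_(m1, n2)) (f3 : Z -> 'M[C]_(m2, n1))
    (f4 : Z -> 'M[C]_(m2, n2)) a1 a2 a3 a4 :
  f1 @ F --> (a1 : 'M[C]_(m1, n1)) -> f2 @ F --> (a2 : 'M[C]_(m1, n2)) ->
  f3 @ F --> (a3 : 'M[C]_(m2, n1)) -> f4 @ F --> (a4 : 'M[C]_(m2, n2)) ->
  (fun z => block_mx (f1 z) (f2 z) (f3 z) (f4 z)) @ F -->
    (block_mx a1 a2 a3 a4 : 'M[C]_(m1 + m2, n1 + n2)).
Proof.
move=> h1 h2 h3 h4; apply: cvg_mx => i j; rewrite mxE; under eq_fun do rewrite mxE.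
case: (fintype.split i) => i'; rewrite mxE; under eq_fun do rewrite mxE;
  case: (fintype.split j) => j'; exact: cvg_entry.
Qed.

Lemma homotopic_in_right (T : topologicalType) (E : set T) (f g : I -> T) :
  homotopic_in E f g -> forall s, E (g s).
Proof. by move=> [H [_ EH _ H1 _]] s; rewrite -H1. Qed.

Lemma homotopic_in_ends (T : topologicalType) (E : set T) (f g : I -> T) :
  homotopic_in E f g -> g zero = f zero /\ g one = f one.
Proof. by move=> [H [_ _ _ H1 He]]; rewrite -!H1 (He one).1 (He one).2. Qed.

Lemma cvg_row (Z : Type) (F : set_system Z) {FF : Filter F} m n i
    (f : Z -> 'M[C]_(m, n)) (a : 'M[C]_(m, n)) :
  f @ F --> a -> (fun z => row i (f z)) @ F --> (row i a : 'rV[C]_n).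
Proof.
move=> fa; apply: cvg_mx => k j; rewrite mxE; under eq_fun do rewrite mxE.
exact: cvg_entry.
Qed.

(** Three straight-line homotopies of the first row, each lifted to matrices by [row_homotopy]: onto
    the polygon, onto the detour [Q], onto the constant base vector. *)
Lemma row0_contract n (g : I -> 'M[C]_n.+2) : continuous g ->
  (forall s, g s \in unitmx) -> g zero = 1%:M -> g one = 1%:M ->
  exists g', [/\ continuous g', homotopic_in (@GL R n.+2) g g' &
    forall s, row 0 (g' s) = delta_mx 0 0].
Proof.
move=> cg ug g0 g1; pose c s := row 0 (g s).
have cc : continuous c by move=> s; exact: (cvg_row (cg s)).
have nc s : c s != 0.
  apply/eqP => cs0; have /eqP := congr1 (mulmx^~ (invmx (g s))) cs0.
  rewrite /c rowE mulmxK // mul0mx => /eqP/rowP/(_ 0)/eqP.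
  by rewrite !mxE oner_eq0.
have c0 : c zero = delta_mx 0 0 by rewrite /c g0 row1.
have c1 : c one = delta_mx 0 0 by rewrite /c g1 row1.
have [N PN] := polyline_homotopy cc nc.
have [w [w0 wP]] := exists_detour c N.
have nP s : polyline c N s != 0.
  by have := PN s one; rewrite uval1 subrr scale0r add0r scale1r.
(* The factor [s (1 - s)] makes the detour leave the base vector in the direction [w] and return to
   it. *)
pose Q (s : I) : 'rV[C]_n.+2 := delta_mx 0 0 + (uval s * (1 - uval s))%:C%C *: w.
have cQ : continuous Q.
  move=> s; have ch : (fun s : I => uval s * (1 - uval s)) @ s --> uval s * (1 - uval s).
    have := cvgM (@uval_continuous R s) (cvgB (@cvg_cst R 1 I (nbhs s) _) (@uval_continuous R s)).
    exact.
  have := cvg_addmx (@cvg_cst 'rV[C]_n.+2 (delta_mx 0 0) I (nbhs s) _)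
    (cvg_scalemx (cvg_real ch) (@cvg_cst 'rV[C]_n.+2 w I (nbhs s) _)).
  exact.
have Q0 : Q zero = delta_mx 0 0 by rewrite /Q uval0 mul0r scale0r addr0.
have Q1 : Q one = delta_mx 0 0 by rewrite /Q uval1 subrr mulr0 scale0r addr0.
have [|||p1 [cp1 hp1 rp1]] := row_homotopy cg ug (@polyline_continuous R _ c N).
- by rewrite polyline0.
- by rewrite polyline1.
- exact: PN.
have [|||p2 [cp2 hp2 rp2]] := @row_homotopy R _ p1 Q cp1 (homotopic_in_right hp1) cQ.
- by rewrite rp1 polyline0 Q0.
- by rewrite rp1 polyline1 Q1.
- by move=> s t; rewrite rp1; exact: detour_homotopy.
have [||||p3 [cp3 hp3 rp3]] := @row_homotopy R _ p2 (fun=> delta_mx 0 0) cp2 (homotopic_in_right hp2).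
- by move=> s; exact: (@cvg_cst _ _ I (nbhs s) _).
- by rewrite rp2.
- by rewrite rp2.
- by move=> s t; rewrite rp2; exact: detour_contract.
exists p3; split=> //; apply: homotopic_in_trans hp3.
exact: homotopic_in_trans hp2.
Qed.

(** With first row [(1, 0, ..., 0)] the loop is block lower triangular. Its lower left column can be
    scaled to 0 without leaving GL, since the determinant depends on the diagonal blocks only. *)
Lemma loop_reduction n (g : I -> 'M[C]_(1 + n.+1)) : continuous g ->
  (forall s, g s \in unitmx) -> g zero = 1%:M -> g one = 1%:M ->
  exists B : I -> 'M[C]_n.+1,
    [/\ continuous B, forall s, B s \in unitmx, B zero = 1%:M, B one = 1%:M &
      homotopic_in (@GL R (1 + n.+1)) g (fun s => block_mx 1%:M 0 0 (B s))].
Proof.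
move=> cg ug g0 g1; have [h [ch gh rh]] := row0_contract cg ug g0 g1.
have hE s : h s = block_mx (1%:M : 'M[C]_1) 0 (dlsubmx (h s : 'M[C]_(1 + n.+1))) (drsubmx (h s : 'M[C]_(1 + n.+1))).
  have Eul : ulsubmx (h s : 'M[C]_(1 + n.+1)) = 1%:M.
    apply/matrixP => i j; rewrite !ord1; have /rowP/(_ 0) := rh s.
    by rewrite !mxE => <-; congr (h s _ _); apply: val_inj.
  have Eur : ursubmx (h s : 'M[C]_(1 + n.+1)) = 0.
    apply/matrixP => i j; rewrite !ord1; have /rowP/(_ (rshift 1 j)) := rh s.
    rewrite !mxE /= => E; transitivity (h s 0 (rshift 1 j)); last by rewrite E.
    by congr (h s _ _); apply: val_inj.
  by rewrite -Eul -Eur submxK.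
have [h0 h1] := homotopic_in_ends gh; rewrite g0 in h0; rewrite g1 in h1.
pose L s := dlsubmx (h s : 'M[C]_(1 + n.+1)); pose B s := drsubmx (h s : 'M[C]_(1 + n.+1)).
have cL : continuous L.
  move=> s; apply: (@cvg_mx I (nbhs s) (nbhs_filter s)) => i j; rewrite !mxE.
  by under eq_fun do rewrite !mxE; exact: (cvg_entry (ch s)).
have cB : continuous B.
  move=> s; apply: (@cvg_mx I (nbhs s) (nbhs_filter s)) => i j; rewrite !mxE.
  by under eq_fun do rewrite !mxE; exact: (cvg_entry (ch s)).
have uB s : B s \in unitmx.
  rewrite -(unitmx_block1 (L s)) -[block_mx _ _ _ _]hE.
  exact: (homotopic_in_right gh s).
have B0 : B zero = 1%:M by rewrite /B h0 (scalar_mx_block 1 n.+1) block_mxKdr.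
have B1 : B one = 1%:M by rewrite /B h1 (scalar_mx_block 1 n.+1) block_mxKdr.
have L0 : L zero = 0 by rewrite /L h0 (scalar_mx_block 1 n.+1) block_mxKdl.
have L1 : L one = 0 by rewrite /L h1 (scalar_mx_block 1 n.+1) block_mxKdl.
have cL1 := comp_continuous (@fst_continuous I I) cL.
have cB1 := comp_continuous (@fst_continuous I I) cB.
exists B; split=> //; apply: homotopic_in_trans gh _.
have cs := comp_continuous (@snd_continuous I I) (@uval_continuous R).
exists (fun v => block_mx 1%:M 0 ((1 - uval v.2)%:C%C *: L v.1) (B v.1)); split=> [v|v|s|s|t].
- have cu : (fun v : I * I => 1 - uval v.2) @ v --> 1 - uval v.2.
    have := cvgB (@cvg_cst R 1 _ (nbhs v) _) (cs v); exact.
  have := cvg_block_mx (@cvg_cst 'M[C]_1 1%:M _ (nbhs v) _) (@cvg_cst 'M[C]_(1, n.+1) 0 _ (nbhs v) _)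
    (cvg_scalemx (cvg_real cu) (cL1 v)) (cB1 v).
  exact.
- by rewrite /GL /= unitmx_block1; exact: uB.
- by rewrite uval0 subr0 scale1r /= [RHS]hE.
- by rewrite uval1 subrr scale0r.
- by rewrite /= L0 L1 !scaler0 B0 B1 h0 h1 -scalar_mx_block.
Qed.

End Contraction.

(** * Simple and path connectedness of SL_3(C) *)

Section SpecialLinear.
Variable R : realType.
Local Notation C := R[i].
Local Notation I := (unitI R).

Definition SL n : set 'M[C]_n := [set A | \det A = 1].

(* The retraction of GL_3 onto SL_3 dividing the last column by the determinant. *)
Definition SL_retract (M : 'M[C]_(1 + (1 + 1))) : 'M[C]_(1 + (1 + 1)) :=
  M *m block_mx (1%:M : 'M[C]_1) 0 0 (block_mx (1%:M : 'M[C]_1) 0 0 ((\det M)^-1%:M : 'M[C]_1)).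

Lemma det_SL_retract (M : 'M[C]_(1 + (1 + 1))) : M \in unitmx -> \det (SL_retract M) = 1.
Proof.
rewrite unitmxE unitfE => uM.
by rewrite /SL_retract det_mulmx !det_lblock !det1 !mul1r det_scalar1 divff.
Qed.

Lemma SL_retract_id (M : 'M[C]_(1 + (1 + 1))) : \det M = 1 -> SL_retract M = M.
Proof. by move=> M1; rewrite /SL_retract M1 invr1 -!scalar_mx_block mulmx1. Qed.

Lemma SL_retract_continuous (M : 'M[C]_(1 + (1 + 1))) : M \in unitmx -> SL_retract @ M --> SL_retract M.
Proof.
rewrite unitmxE unitfE => uM.
have cd : (fun A : 'M[C]_(1 + (1 + 1)) => ((\det A)^-1%:M : 'M[C]_1)) @ M --> ((\det M)^-1%:M : 'M[C]_1).
  apply: (@cvg_mx _ (nbhs M) (nbhs_filter M)) => i j; rewrite !ord1 !mxE; under eq_fun do rewrite mxE.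
  exact: (cvg_invC uM (cvg_det (@cvg_id _ (nbhs M)))).
have := cvg_mulmx (@cvg_id _ (nbhs M)) (cvg_block_mx
   (@cvg_cst 'M[C]_1 1%:M _ (nbhs M) _) (@cvg_cst 'M[C]_(1, 1 + 1) 0 _ (nbhs M) _)
   (@cvg_cst 'M[C]_(1 + 1, 1) 0 _ (nbhs M) _)
   (cvg_block_mx (@cvg_cst 'M[C]_1 1%:M _ (nbhs M) _) (@cvg_cst 'M[C]_1 0 _ (nbhs M) _)
   (@cvg_cst 'M[C]_1 0 _ (nbhs M) _) cd)).
exact.
Qed.

(** Two reductions leave the loop [diag(1, 1, b)], and the loop [b] in the non-zero complex numbers
    may wind around 0. The retraction onto SL_3 divides it away: it fixes the given loop and sends
    [diag(1, 1, b)] to the identity. *)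
Lemma SL3_loop_contract1 (g : I -> 'M[C]_(1 + (1 + 1))) : continuous g ->
  (forall s, \det (g s) = 1) -> g zero = 1%:M -> g one = 1%:M ->
  homotopic_in (@SL (1 + (1 + 1))) g (fun=> 1%:M).
Proof.
move=> cg dg g0 g1.
have ug s : g s \in unitmx by rewrite unitmxE dg unitr1.
have [B [cB uB B0 B1 gB]] := @loop_reduction R 1 g cg ug g0 g1.
have [B' [cB' uB' B0' B1' BB']] := @loop_reduction R 0 B cB uB B0 B1.
pose phi (A : 'M[C]_(1 + 1)) : 'M[C]_(1 + (1 + 1)) := block_mx (1%:M : 'M[C]_1) 0 0 A.
have hB : homotopic_in (@GL R (1 + (1 + 1))) (fun s => phi (B s)) (fun s => phi (block_mx (1%:M : 'M[C]_1) 0 0 (B' s))).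
  apply: (homotopic_in_map (E := @GL R (1 + 1)) (phi := phi) _ _ BB') => A uA.
    have := cvg_block_mx (@cvg_cst 'M[C]_1 1%:M _ (nbhs A) _) (@cvg_cst 'M[C]_(1, 1 + 1) 0 _ (nbhs A) _)
      (@cvg_cst 'M[C]_(1 + 1, 1) 0 _ (nbhs A) _) (@cvg_id _ (nbhs A)).
    exact.
  by rewrite /GL /= /phi unitmx_block1.
have := homotopic_in_map (E' := @SL (1 + (1 + 1))) SL_retract_continuous det_SL_retract (homotopic_in_trans gB hB).
rewrite (_ : SL_retract \o g = g); last by apply/funext => s /=; exact: SL_retract_id.
congr homotopic_in; apply/funext => s /=.
have : \det (B' s) != 0 by rewrite -unitfE -unitmxE.
rewrite /SL_retract /phi !det_lblock !det1 !mul1r [B' s]mx11_scalar det_scalar1 => b0.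
rewrite !mulmx_block !(mulmx0, mul0mx, addr0, add0r, mulmx1, mul1mx).
by rewrite -scalar_mxM divff // -!scalar_mx_block.
Qed.

Lemma SL3_loop_contract (g : I -> 'M[C]_3) A : continuous g ->
  (forall s, \det (g s) = 1) -> g zero = A -> g one = A ->
  homotopic_in (@SL 3) g (fun=> A).
Proof.
move=> cg dg g0 g1; have dA : \det A = 1 by rewrite -g0.
have uA : A \in unitmx by rewrite unitmxE dA unitr1.
have cM B : continuous (mulmx B : 'M[C]_3 -> 'M[C]_3).
  move=> M; have := cvg_mulmx (@cvg_cst 'M[C]_3 B _ (nbhs M) _) (@cvg_id _ (nbhs M)).
  exact.
have dV : \det (invmx A) = 1 by rewrite det_inv dA invr1.
have cVg := comp_continuous cg (cM (invmx A)).
have [|||H HP] := @SL3_loop_contract1 (fun s => invmx A *m g s) cVg.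
- by move=> s; rewrite det_mulmx dg dV mulr1.
- by rewrite g0 mulVmx.
- by rewrite g1 mulVmx.
have hH : homotopic_in (@SL 3) (fun s => invmx A *m g s) (fun=> 1%:M) by exists H.
have AE B : @SL 3 B -> @SL 3 (A *m B) by rewrite /SL /= det_mulmx dA mul1r.
have [K [cK EK K0 K1 Ke]] := homotopic_in_map (fun B _ => cM A B) AE hH.
exists K; split=> // [s|s|t].
- by rewrite K0 /= mulKVmx.
- by rewrite K1 /= mulmx1.
- by have := Ke t; rewrite /= !mulKVmx.
Qed.

(* The arc t + i x t(1 - t) joins 0 to 1 off the roots of p when x avoids
   finitely many values. *)
Lemma arc_avoiding_roots (p : {poly C}) : p.[0] != 0 -> p.[1] != 0 ->
  exists x : R, forall t : I, p.[(uval t +i* (x * (uval t * (1 - uval t))))%C] != 0.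
Proof.
move=> p0 p1; have pn0 : p != 0 by apply: contraNneq p0 => ->; rewrite horner0.
have [rs prs] := closed_field_poly_normal p.
(* The only parameter whose arc meets [z], when the real part of [z] is neither 0 nor 1; at those
   two real parts the arc is at its ends, which are not roots. *)
pose bad (z : C) := complex.Im z / (complex.Re z * (1 - complex.Re z)).
have [|x xP] := @poly_nonroot R (\prod_(b <- map bad rs) ('X - b%:P)).
  exact/monic_neq0/monic_prod_XsubC.
exists x => t; apply/negP => zr; move: xP; rewrite -[_ == 0]/(root _ x) root_prod_XsubC.
apply/negP; rewrite negbK; apply/mapP.
move: (zr); rewrite -[_ == 0]/(root _ _) prs rootZ ?lead_coef_eq0 // root_prod_XsubC => zrs.
exists (uval t +i* (x * (uval t * (1 - uval t))))%C => //.
rewrite /bad /= mulfK // mulf_neq0 //.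
  by apply: contraTneq zr => ->; rewrite mul0r mulr0.
apply: contraTneq zr => t1; have -> : uval t = 1 by lra.
by rewrite subrr !mulr0.
Qed.

(** Along the complex line through [1] and [A] the determinant is a polynomial, non-zero at both
    points. An arc avoiding its roots gives a path of invertible matrices, which is then retracted
    onto SL_3. *)
Lemma SL3_path (A : 'M[C]_3) : \det A = 1 ->
  exists g : I -> 'M[C]_3, [/\ continuous g, forall s, \det (g s) = 1, g zero = 1%:M & g one = A].
Proof.
move=> dA.
pose p : {poly C} := \det (1%:M + 'X *: map_mx polyC (A - 1%:M)).
have pE z : p.[z] = \det (1%:M + z *: (A - 1%:M)).
  rewrite -[LHS]/(horner_eval z p) /p -det_map_mx; congr (\det _).
  apply/matrixP => i j; rewrite !mxE.
  rewrite -[LHS]/((_ + 'X * _).[z]) hornerD hornerM hornerX hornerC.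
  by rewrite hornerMn hornerC.
have [||x xP] := @arc_avoiding_roots p.
- by rewrite pE scale0r addr0 det1 oner_neq0.
- by rewrite pE scale1r addrC subrK dA oner_neq0.
pose z (t : I) : C := (uval t +i* (x * (uval t * (1 - uval t))))%C.
pose h t := 1%:M + z t *: (A - 1%:M).
have uh t : h t \in unitmx by rewrite unitmxE unitfE /h -pE xP.
have cz : continuous z.
  move=> t; have ch : (fun t : I => x * (uval t * (1 - uval t))) @ t --> x * (uval t * (1 - uval t)).
    have := cvgM (@cvg_cst R x I (nbhs t) _) (cvgM (@uval_continuous R t) (cvgB (@cvg_cst R 1 I (nbhs t) _) (@uval_continuous R t))).
    exact.
  exact: (cvg_complex (@uval_continuous R t) ch).
have ch : continuous h.
  move=> t; have := cvg_addmx (@cvg_cst 'M[C]_3 1%:M I (nbhs t) _)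
    (cvg_scalemx (cz t) (@cvg_cst 'M[C]_3 (A - 1%:M) I (nbhs t) _)).
  exact.
have z0 : z zero = 0 by rewrite /z uval0 mul0r mulr0.
have z1 : z one = 1 by rewrite /z uval1 subrr !mulr0.
exists (fun t => SL_retract (h t)); split=> [t|t||].
- have := cvg_comp _ _ (ch t) (SL_retract_continuous (uh t)); exact.
- exact: det_SL_retract.
- by rewrite SL_retract_id /h z0 scale0r addr0 ?det1.
- by rewrite SL_retract_id /h z1 scale1r addrC subrK.
Qed.

End SpecialLinear.

(** * Quotients of SL_3(C) by finite subgroups *)

Lemma closed_of_near (T : topologicalType) (B : set T) :
  (forall x, ~ B x -> \forall y \near x, ~ B y) -> closed B.
Proof. by move=> h; rewrite -openC openE => x /h. Qed.

Lemma cvg_nbhs (T : Type) (F : set_system T) (U : topologicalType) (f : T -> U) (y : U) W :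
  f @ F --> y -> nbhs y W -> F (fun t => W (f t)).
Proof. by move=> fy yW; exact: fy yW. Qed.

Lemma mulmx_continuous (R : realType) m n p (B : 'M[R[i]]_(m, n)) :
  continuous (mulmx B : 'M[R[i]]_(n, p) -> 'M[R[i]]_(m, p)).
Proof.
move=> A; have := cvg_mulmx (@cvg_cst 'M[R[i]]_(m, n) B _ (nbhs A) _) (@cvg_id _ (nbhs A)).
exact.
Qed.

(** * Compact boxes of complex matrices *)

Section Compactness.
Variable R : realType.
Local Notation C := R[i].

Definition cbox (M : R) : set C := [set z | `[-M, M]%classic (complex.Re z) /\ `[-M, M]%classic (complex.Im z)].

Lemma cbox_compact M : compact (cbox M).
Proof.
have -> : cbox M = (fun xy : R * R => (xy.1 +i* xy.2)%C : C) @` (`[-M, M]%classic `*` `[-M, M]%classic).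
  apply/seteqP; split=> [[x y] [/= hx hy]|_ [[x y] /= [hx hy] <-]]; last by split.
  by exists (x, y).
apply: continuous_compact; last by apply: compact_setX; exact: segment_compact.
apply: continuous_subspaceT => xy.
exact: (cvg_complex (@fst_continuous R R xy) (@snd_continuous R R xy)).
Qed.

Lemma mx_box_compact m n M : compact [set A : 'M[C]_(m, n) | forall i j, cbox M (A i j)].
Proof.
have -> : [set A : 'M[C]_(m, n) | forall i j, cbox M (A i j)] =
    vec_mx @` [set v : 'rV[C]_(m * n) | forall k, cbox M (v ord0 k)].
  apply/seteqP; split=> [A hA|_ [v hv <-] i j]; last by rewrite mxE; exact: hv.
  exists (mxvec A); last exact: mxvecK.
  by move=> k; case/mxvec_indexP: k => i j; rewrite mxvecE.
apply: continuous_compact;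
  last exact: (@rV_compact C (m * n)%N (fun=> cbox M) (fun=> @cbox_compact M)).
apply: continuous_subspaceT => v.
apply: (@cvg_mx _ (nbhs v) (nbhs_filter v)) => i j; rewrite mxE; under eq_fun do rewrite mxE.
exact: (cvg_entry (@cvg_id _ (nbhs v))).
Qed.

Lemma norm_cbox (M : R) (z : C) : `|z| <= M%:C%C -> cbox M z.
Proof.
move=> zM; have re (w : C) : `|w| <= M%:C%C -> `[-M, M]%classic (complex.Re w).
  move=> wM; rewrite /= in_itv /= -ler_norml -lecR; exact: le_trans (normc_ge_Re w) wM.
split; first exact: re.
have -> : complex.Im z = complex.Re (- 'i%C * z) by case: z {zM} => x y /=; simpc => /=.
by apply: re; rewrite normrM normrN (normc_def 'i%C) /= expr0n add0r expr1n sqrtr1 mul1r.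
Qed.

End Compactness.

(** * Lifting through the quotient map, and monodromy *)

Section Covering.
Variables (R : realType) (X : topologicalType) (K : finType).
Local Notation C := R[i].
Local Notation I := (unitI R).
Variables (rho : K -> 'M[C]_3) (p : 'M[C]_3 -> X).
(* X is the quotient of SL_3(C) by the finite group of the matrices rho k. In place
   of even covering: p_bounded makes p open by compactness, and tr_rho keeps the
   conjugates of rho k away from 1, which separates the sheets uniformly. *)
Hypothesis p_cts : forall A : 'M[C]_3, \det A = 1 -> p @ (within (@SL R 3) (nbhs A)) --> p A.
Hypothesis p_surj : forall x, exists2 A : 'M[C]_3, \det A = 1 & p A = x.
Hypothesis p_fib : forall A B : 'M[C]_3, \det A = 1 -> \det B = 1 ->
  p A = p B <-> exists k, B = rho k *m A.
Hypothesis det_rho : forall k, \det (rho k) = 1.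
Hypothesis tr_rho : forall k, rho k <> 1%:M -> \tr (rho k) <> 3%:R.
Hypothesis X_hausdorff : hausdorff_space X.
Hypothesis p_bounded : forall x : X, exists M : R,
  \forall y \near x, forall A : 'M[C]_3, \det A = 1 -> p A = y -> forall i j, `|A i j| <= M%:C%C.

(** On SL_3 the adjugate is the inverse; being polynomial, it is continuous on all matrices with no
    side condition. *)
Lemma SL_adjK (A : 'M[C]_3) : \det A = 1 -> \adj A *m A = 1%:M.
Proof. by move=> dA; rewrite mul_adj_mx dA. Qed.

Lemma SL_mulK_adj (A : 'M[C]_3) : \det A = 1 -> A *m \adj A = 1%:M.
Proof. by move=> dA; rewrite mul_mx_adj dA. Qed.

Lemma det_adj_SL (A : 'M[C]_3) : \det A = 1 -> \det (\adj A) = 1.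
Proof.
by move=> dA; have := congr1 determinant (SL_adjK dA); rewrite det_mulmx dA mulr1 det1.
Qed.

Lemma p_comp (Z : topologicalType) (g : Z -> 'M[C]_3) : continuous g ->
  (forall z, \det (g z) = 1) -> continuous (p \o g).
Proof.
move=> cg dg z W pW.
have gW : nbhs (g z) [set A | \det A = 1 -> W (p A)] := p_cts (dg z) pW.
have zW : nbhs z (g @^-1` [set A | \det A = 1 -> W (p A)]) := cg z _ gW.
by apply: (filterS _ zW) => z' /=; apply; exact: dg.
Qed.

Lemma p_rho k (A : 'M[C]_3) : \det A = 1 -> p (rho k *m A) = p A.
Proof.
by move=> dA; apply/esym/p_fib => //; [rewrite det_mulmx det_rho dA mulr1|exists k].
Qed.

(** Bounded matrices of determinant 1 with no translate in the interior of [U] form a compact set.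
    Its image is closed, as [X] is Hausdorff, and misses [p A0]. A preimage of a point near [p A0]
    is bounded, so one of its translates must lie in [U]. *)
Lemma p_open (A0 : 'M[C]_3) (U : set 'M[C]_3) : \det A0 = 1 -> nbhs A0 U ->
  \forall y \near p A0, exists A : 'M[C]_3, [/\ U A, \det A = 1 & p A = y].
Proof.
move=> dA0 AU; have [M yM] := p_bounded (p A0).
pose B := [set A : 'M[C]_3 | \det A = 1 /\ forall k, ~ U° (rho k *m A)].
pose L := [set A : 'M[C]_3 | forall i j, cbox M (A i j)] `&` B.
have cB : closed B.
  apply: closed_of_near => A nB; have [dA|/eqP dA] := eqVneq (\det A) 1; last first.
    have : \det A - 1 != 0 by rewrite subr_eq0; apply/eqP.
    move/(near_neq0 (cvg_addC (cvg_det (@cvg_id _ (nbhs A))) (@cvg_cst C (- 1) _ (nbhs A) _))).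
    by apply: filterS => A' /eqP h [dA' _]; apply: h; rewrite dA' subrr.
  have [k Uk] : exists k, U° (rho k *m A).
    by apply: contrapT => nk; apply: nB; split=> // k Uk; apply: nk; exists k.
  have kU : nbhs (rho k *m A : 'M[C]_3) U° := open_nbhs_nbhs (conj (open_interior U) Uk).
  have kA' : nbhs A [set B : 'M[C]_3 | U° (rho k *m B)].
    exact: (cvg_nbhs (@mulmx_continuous R 3 3 3 (rho k) A) kU).
  by apply: (filterS _ kA') => A' /= Uk' [_ /(_ k)].
have cL : compact L by apply: compact_closedI => //; exact: mx_box_compact.
have cpL : closed (p @` L).
  apply: compact_closed => //; apply: continuous_compact => //.
  apply/subspace_continuousP => A [_ [dA _]] W pW.
  have AW : nbhs A [set A' | \det A' = 1 -> W (p A')] := p_cts dA pW.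
  by apply: (filterS _ AW) => A' h [_ [dA' _]]; exact: h.
have npL : ~ (p @` L) (p A0).
  move=> [A [_ [dA /= nU]] pA]; have [k Ak] := (p_fib dA dA0).1 pA.
  by apply: (nU k); rewrite -Ak.
have : nbhs (p A0) (~` (p @` L)).
  by apply: open_nbhs_nbhs; split => //; rewrite openC.
apply: filterS2 yM => y yb yL; have [A dA pA] := p_surj y.
have [k Uk] : exists k, U° (rho k *m A).
  apply: contrapT => nk; apply: yL; exists A => //; split=> [i j|].
    exact/norm_cbox/yb.
  by split=> // k Uk; apply: nk; exists k.
exists (rho k *m A); split; first exact: interior_subset.
  by rewrite det_mulmx det_rho dA mulr1.
by rewrite p_rho.
Qed.

Lemma near_pairs (T U : topologicalType) (t : T) (u : U) (W : set (T * U)) :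
  nbhs (t, u) W -> exists P Q, [/\ nbhs t P, nbhs u Q & forall x y, P x -> Q y -> W (x, y)].
Proof.
by move=> [[P Q] /= [tP uQ] sub]; exists P, Q; split=> // x y Px Qy; exact: (sub (x, y)).
Qed.

Lemma cvg_adj_mul (A A' : 'M[C]_3) :
  (fun B : 'M[C]_3 * 'M[C]_3 => \adj B.1 *m B.2) @ (A, A') --> (\adj A *m A' : 'M[C]_3).
Proof.
exact: (cvg_mulmx (cvg_adj (@fst_continuous 'M[C]_3 'M[C]_3 (A, A')))
  (@snd_continuous 'M[C]_3 'M[C]_3 (A, A'))).
Qed.

(* Traces separate [A^-1 rho_k A] from 1 uniformly in [A]. *)
Lemma separating_nbhs : exists V : set 'M[C]_3, [/\ open V, V 1%:M &
  forall B B' k, V B -> V B' -> rho k <> 1%:M -> \tr (B' *m \adj B) <> \tr (rho k)].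
Proof.
(* At [(1, 1)] the trace is 3, which [tr_rho] keeps off the finitely many traces to be avoided, so
   avoiding them is a condition valid near [(1, 1)]. *)
pose P := [set B : 'M[C]_3 * 'M[C]_3 | forall k, rho k <> 1%:M -> \tr (B.2 *m \adj B.1) <> \tr (rho k)].
pose O : 'M[C]_3 * 'M[C]_3 := (1%:M, 1%:M).
suff Pk k : nbhs O [set B | rho k <> 1%:M -> \tr (B.2 *m \adj B.1) <> \tr (rho k)].
  have OP : nbhs O P.
    have := @filter_forall ('M[C]_3 * 'M[C]_3)%type K _ (nbhs O) (nbhs_filter O) Pk; exact.
  have [V1 [V2 [V1n V2n VP]]] := near_pairs OP.
  exists ((V1 `&` V2)°); split; first exact: open_interior.
    exact: (filterI V1n V2n).
  move=> B B' k /interior_subset[VB _] /interior_subset[_ VB'] rk.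
  exact: (VP B B' VB VB' k rk).
have [->|/eqP rk] := eqVneq (rho k) 1%:M.
  by apply: (filterS _ (@filterT _ (nbhs O) _)) => B _ /(_ erefl).
have ct : (fun B : 'M[C]_3 * 'M[C]_3 => \tr (B.2 *m \adj B.1) - \tr (rho k)) @ (nbhs O)
    --> (\tr (1%:M *m \adj (1%:M : 'M[C]_3)) - \tr (rho k) : C).
  apply: (@cvg_addC _ _ _ _ (fun B : 'M[C]_3 * 'M[C]_3 => \tr (B.2 *m \adj B.1)) (fun=> - \tr (rho k))).
    apply: cvg_sumC => i.
    exact: (cvg_entry (cvg_mulmx (@snd_continuous 'M[C]_3 'M[C]_3 O)
       (cvg_adj (@fst_continuous 'M[C]_3 'M[C]_3 O)))).
  exact: (@cvg_cst C _ _ _ _).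
have /(near_neq0 ct) : \tr (1%:M *m \adj (1%:M : 'M[C]_3)) - \tr (rho k) != 0.
  rewrite mul1mx (_ : \adj 1%:M = 1%:M) ?mxtrace1 ?subr_eq0; last first.
    by rewrite -[LHS]mulmx1 SL_adjK ?det1.
  by rewrite eq_sym; apply/eqP; exact: tr_rho.
by apply: filterS => B /= /eqP h _ BE; apply: h; rewrite BE subrr.
Qed.

Section Transport.
Variable V : set 'M[C]_3.
Hypothesis V_open : open V.
Hypothesis V1 : V 1%:M.
Hypothesis V_sep : forall B B' k, V B -> V B' -> rho k <> 1%:M ->
  \tr (B' *m \adj B) <> \tr (rho k).

(** Right multiplication by [B] sends [A] to [A']. The matrices [rho k] multiply on the left, so the
    same [B] carries the whole fibre over [x] into the fibre over [y]. *)
Definition transports (x y : X) (B : 'M[C]_3) : Prop :=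
  exists A A', [/\ \det A = 1, \det A' = 1, p A = x, p A' = y & V B /\ B = \adj A *m A'].

(** Other lifts replace [B] by [B' = (A^-1 rho_m A) B]. Then [B' B^-1] is conjugate to [rho m] and
    has its trace, which [V_sep] forbids unless [rho m] is 1. *)
Lemma transports_unique x y B B' : transports x y B -> transports x y B' -> B = B'.
Proof.
move=> [A [A' [dA dA' pA pA' [VB BE]]]] [A1 [A1' [dA1 dA1' pA1 pA1' [VB' BE']]]].
have [k A1E] := (p_fib dA dA1).1 (etrans pA (esym pA1)).
pose A2 := \adj (rho k) *m A1'.
have dA2 : \det A2 = 1 by rewrite det_mulmx dA1' det_adj_SL ?mulr1.
have A1'E : A1' = rho k *m A2 by rewrite mulmxA SL_mulK_adj ?mul1mx.
have pA2 : p A2 = y by rewrite -pA1' A1'E p_rho.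
have [m A2E] := (p_fib dA' dA2).1 (etrans pA' (esym pA2)).
have adjM : \adj A1 *m rho k = \adj A.
  have e : \adj A1 *m rho k *m A = 1%:M by rewrite -mulmxA -A1E SL_adjK.
  by rewrite -[LHS]mulmx1 -(SL_mulK_adj dA) mulmxA e mul1mx.
have B'E : B' = \adj A *m rho m *m A'.
  by rewrite BE' A1'E mulmxA adjM A2E mulmxA.
have [rm|/eqP rm] := eqVneq (rho m) 1%:M; first by rewrite B'E rm mulmx1.
case: (V_sep VB VB' rm).
have dB : \det B = 1 by rewrite BE det_mulmx det_adj_SL // mul1r.
have A'E : A' = A *m B by rewrite BE mulmxA SL_mulK_adj ?mul1mx.
rewrite B'E A'E -!mulmxA SL_mulK_adj // mulmx1 mxtrace_mulC -mulmxA.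
by rewrite SL_mulK_adj // mulmx1.
Qed.

End Transport.

Lemma near_lift (Z : topologicalType) (f : Z -> X) z (A : 'M[C]_3) (U : set 'M[C]_3) :
  f @ z --> f z -> \det A = 1 -> p A = f z -> nbhs A U ->
  \forall z' \near z, exists A' : 'M[C]_3, [/\ U A', \det A' = 1 & p A' = f z'].
Proof.
move=> cf dA pA AU; have := p_open dA AU; rewrite pA => /(cvg_nbhs cf); exact.
Qed.

(** An application of [transport_lift], with [D] the pairs joined by a transport in [V] and [d] that
    transport. Openness of [p] gives transports near a given one, and uniqueness turns their
    existence into continuity of [d]. *)
Lemma lift_square (F : I * I -> X) (g : I -> 'M[C]_3) : continuous F -> continuous g ->
  (forall s, \det (g s) = 1) -> (forall s, p (g s) = F (s, zero)) ->
  exists G : I * I -> 'M[C]_3,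
    [/\ continuous G, forall v, \det (G v) = 1, forall v, p (G v) = F v,
        forall s, G (s, zero) = g s &
        forall s, (forall t, F (s, t) = F (s, zero)) -> forall t, G (s, t) = g s].
Proof.
move=> cF cg dg pg; have [V [oV V1 Vsep]] := separating_nbhs.
pose T v w B := transports V (F v) (F w) B.
pose D v w := exists B, T v w B.
pose d (v w : I * I) : 'M[C]_3 := xget 1%:M (T v w).
have dT v w : D v w -> T v w (d v w) by exact: xgetPex.
have dE v w B : T v w B -> d v w = B.
  by move=> TB; exact: (transports_unique Vsep (dT v w (ex_intro _ B TB)) TB).
(* Used with [W] the whole space to see that [D] surrounds the diagonal, and with arbitrary [W] for
   the continuity of [d]. *)
have near_T v w A A' (W : set 'M[C]_3) : \det A = 1 -> \det A' = 1 -> p A = F v -> p A' = F w ->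
    V (\adj A *m A') -> nbhs (\adj A *m A' : 'M[C]_3) W ->
    nbhs (v, w) [set u | exists2 B, T u.1 u.2 B & W B].
  move=> dA dA' pA pA' VA WA.
  have VW : nbhs (\adj A *m A' : 'M[C]_3) (V `&` W).
    by apply: filterI => //; exact: open_nbhs_nbhs.
  have [P [Q [AP AQ PQ]]] := near_pairs (cvg_nbhs (@cvg_adj_mul A A') VW).
  exists ([set v' | exists A1 : 'M[C]_3, [/\ P A1, \det A1 = 1 & p A1 = F v']],
          [set w' | exists A1 : 'M[C]_3, [/\ Q A1, \det A1 = 1 & p A1 = F w']]).
    by split=> /=; [exact: (near_lift (cF v) dA pA)|exact: (near_lift (cF w) dA' pA')].
  move=> [v' w'] /= [[A1 [PA1 dA1 pA1]] [A2 [QA2 dA2 pA2]]].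
  have [VB WB] := PQ A1 A2 PA1 QA2.
  by exists (\adj A1 *m A2) => //; exists A1, A2.
have [|||||||G GP] := @transport_lift R X 3 (@SL R 3) p F d D g; last by exists G.
- move=> v; have [A dA pA] := p_surj (F v).
  have VA : V (\adj A *m A) by rewrite SL_adjK.
  apply: filterS (near_T v v A A setT dA dA pA pA VA filterT) => u [B TB _].
  by exists B.
- move=> v w /dT[A [A' [dA dA' pA pA' [VB BE]]]] W; rewrite BE in VB * => WB.
  apply: filterS (near_T v w A A' W dA dA' pA pA' VB WB) => u [B /dE <-].
  exact.
- move=> v w A2 /dT[A [A' [dA dA' pA pA' [VB ->]]]] dA2 pA2.
  have [k ->] := (p_fib dA dA2).1 (etrans pA (esym pA2)).
  rewrite -mulmxA (mulmxA A) SL_mulK_adj // mul1mx p_rho //; split=> //.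
  by rewrite /SL /= det_mulmx det_rho dA' mulr1.
- move=> v w [_ _] Fvw; apply: dE; rewrite /T -Fvw; have [A dA pA] := p_surj (F v).
  by exists A, A; rewrite SL_adjK.
- exact: cg.
- exact: dg.
- exact: pg.
Qed.

(** The path is read as a homotopy constant in [s], starting from the constant lift [A]. *)
Lemma lift_path (f : I -> X) (A : 'M[C]_3) : continuous f -> \det A = 1 -> p A = f zero ->
  exists a : I -> 'M[C]_3,
    [/\ continuous a, forall t, \det (a t) = 1, forall t, p (a t) = f t & a zero = A].
Proof.
move=> cf dA pA.
have [||||G [cG dG pG G0 _]] := @lift_square (fun v => f v.2) (fun=> A).
- exact: (comp_continuous (@snd_continuous I I) cf).
- by move=> s; exact: (@cvg_cst 'M[C]_3 A I (nbhs s) _).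
- by [].
- by [].
exists (fun t => G (zero, t)); split => //.
apply: (comp_continuous (f := fun t : I => (zero : I, t)) _ cG).
apply: (@pair_continuous I I I (fun=> zero) id) => t; last exact: cvg_id.
exact: (@cvg_cst I (zero : I) I (nbhs t) _).
Qed.

(** The coincidence set contains [zero], is closed, and is open because nearby lifts differ by some
    [rho k] whose conjugate is close to 1, hence by 1. *)
Lemma lift_unique (a b : I -> 'M[C]_3) : continuous a -> continuous b ->
  (forall t, \det (a t) = 1) -> (forall t, \det (b t) = 1) -> (forall t, p (a t) = p (b t)) ->
  a zero = b zero -> a = b.
Proof.
move=> ca cb da db pab ab0; have [V [oV V1 Vsep]] := separating_nbhs.
pose S := [set t | a t = b t].
suff ST : S = [set: I] by apply/funext => t; have : [set: I] t by []; rewrite -ST.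
apply: unitI_connected; first by exists zero.
- exists S; last by rewrite setTI.
  rewrite openE => t /= St.
  have cab := pair_continuous ca cb.
  have Vt : nbhs (\adj (a t) *m b t : 'M[C]_3) V.
    by rewrite -St SL_adjK //; exact: open_nbhs_nbhs.
  have cV := cvg_nbhs (cab t) (cvg_nbhs (@cvg_adj_mul (a t) (b t)) Vt).
  apply: filterS cV => s /= Vs.
  have [k bE] := (p_fib (da s) (db s)).1 (pab s).
  have [rk|/eqP rk] := eqVneq (rho k) 1%:M; first by rewrite /S /= bE rk mul1mx.
  case: (Vsep _ _ k V1 Vs rk); rewrite bE.
  rewrite (_ : \adj 1%:M = 1%:M) ?mulmx1; last by rewrite -[LHS]mulmx1 SL_adjK ?det1.
  by rewrite mulmxA mxtrace_mulC mulmxA SL_mulK_adj // mul1mx.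
- exists S; last by rewrite setTI.
  apply: closed_of_near => t nS.
  have [i [j ij]] : exists i j, a t i j - b t i j != 0.
    apply: contrapT => nij; apply: nS; apply/matrixP => i j; apply/eqP.
    rewrite -subr_eq0; apply/negP => /negP h; apply: nij; by exists i, j.
  have cij : (fun s => a s i j - b s i j) @ t --> (a t i j - b t i j : C).
    have := cvg_entry (i := i) (j := j) (cvg_addmx (ca t) (cvg_oppmx (cb t))).
    by under eq_fun do rewrite !mxE; rewrite !mxE; exact.
  apply: filterS (near_neq0 cij ij) => s /eqP h sS; apply: h.
  by rewrite (_ : a s = b s) ?subrr.
Qed.

(** * The monodromy isomorphism *)

Section Monodromy.
Variable A0 : 'M[C]_3.
Hypothesis dA0 : \det A0 = 1.
Local Notation x0 := (p A0).
Local Notation loop := {path I from x0 to x0}.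

Lemma loop_lift_subproof (f : loop) : exists a : I -> 'M[C]_3,
  [/\ continuous a, forall t, \det (a t) = 1, forall t, p (a t) = f t & a zero = A0].
Proof. by apply: lift_path => //; [exact: cts_fun|rewrite path_zero]. Qed.

Definition loop_lift (f : loop) : I -> 'M[C]_3 := projT1 (cid (loop_lift_subproof f)).

Lemma loop_liftP (f : loop) : [/\ continuous (loop_lift f), forall t, \det (loop_lift f t) = 1,
  forall t, p (loop_lift f t) = f t & loop_lift f zero = A0].
Proof. exact: projT2 (cid (loop_lift_subproof f)). Qed.

Lemma loop_liftE (f : loop) (a : I -> 'M[C]_3) : continuous a -> (forall t, \det (a t) = 1) ->
  (forall t, p (a t) = f t) -> a zero = A0 -> loop_lift f = a.
Proof.
move=> ca da pa a0; have [cf df pf f0] := loop_liftP f.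
by apply: lift_unique => // [t|]; rewrite ?pf ?pa ?f0 ?a0.
Qed.

Definition end_lift (f : loop) : 'M[C]_3 := loop_lift f one *m \adj A0.

Lemma end_lift_rho (f : loop) : exists k, end_lift f = rho k.
Proof.
have [cf df pf f0] := loop_liftP f.
have [k kE] : exists k, loop_lift f one = rho k *m A0.
  by apply/p_fib; rewrite ?pf ?path_one.
by exists k; rewrite /end_lift kE -mulmxA SL_mulK_adj // mulmx1.
Qed.

Lemma end_liftK (f : loop) : end_lift f *m A0 = loop_lift f one.
Proof. by rewrite /end_lift -mulmxA SL_adjK // mulmx1. Qed.

(** The lifted homotopy is constant along the two sides where the base point does not move, so its
    last row is the lift of [g] and ends where the lift of [f] does. *)
Lemma end_lift_homotopic (f g : loop) : homotopic f g -> end_lift f = end_lift g.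
Proof.
move=> [H [cH H0 H1 Hx Hy]]; have [cf df pf f0] := loop_liftP f.
have [||||G [cG dG pG G0 Gc]] := @lift_square H (loop_lift f) => //.
  by move=> s; rewrite pf H0.
have cG1 : continuous (fun s => G (s, one)).
  apply: (comp_continuous (f := fun s : I => (s, one : I)) _ cG).
  apply: (@pair_continuous I I I id (fun=> one)) => t; first exact: cvg_id.
  exact: (@cvg_cst I (one : I) I (nbhs t) _).
have pG1 t : p (G (t, one)) = g t by rewrite pG H1.
have G10 : G (zero, one) = A0 by rewrite Gc // => t; rewrite !Hx.
have E := loop_liftE cG1 (fun t => dG (t, one)) pG1 G10.
by rewrite /end_lift E Gc // => t; rewrite !Hy.
Qed.

(** The lift of [g] multiplied on the left by [end_lift f] is again a lift, and it starts where the
    lift of [f] ends. Reading endpoints as left factors of [A0] keeps the order of the product. *)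
Lemma end_lift_concat (f g : loop) : end_lift (concat f g) = end_lift f *m end_lift g.
Proof.
have [cf df pf f0] := loop_liftP f; have [cg dg pg g0] := loop_liftP g.
have [k kE] := end_lift_rho f.
have cg' : continuous (fun t => end_lift f *m loop_lift g t).
  by apply: (comp_continuous cg); exact: mulmx_continuous.
pose a : {path I from A0 to loop_lift f one} := mk_path cf f0 erefl.
have b0 : end_lift f *m loop_lift g zero = loop_lift f one by rewrite g0 end_liftK.
pose b : {path I from loop_lift f one to end_lift f *m loop_lift g one} := mk_path cg' b0 erefl.
have dab t : \det (concat a b t) = 1.
  rewrite /= /mk_path /concat_fun /= /mk_path; case: ifP => _; rewrite ?df //.
  by rewrite det_mulmx dg kE det_rho mulr1.
have pab t : p (concat a b t) = concat f g t.
  rewrite /= /mk_path /concat_fun /= /mk_path; case: ifP => _; rewrite ?pf //.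
  by rewrite kE p_rho ?pg.
have E := loop_liftE (@cts_fun _ _ (concat a b)) dab pab (@path_zero _ _ _ _ (concat a b)).
have e1 : loop_lift (concat f g) one = end_lift f *m loop_lift g one.
  by rewrite E; exact: (@path_one _ _ _ _ (concat a b)).
by rewrite /end_lift e1 -mulmxA.
Qed.

Lemma end_lift_const : end_lift (const_path R x0) = 1%:M.
Proof.
have cA : continuous (fun _ : I => A0) by move=> s; exact: (@cvg_cst 'M[C]_3 A0 I (nbhs s) _).
have E := @loop_liftE (const_path R x0) (fun=> A0) cA (fun=> dA0) (fun=> erefl) erefl.
by rewrite /end_lift E SL_mulK_adj.
Qed.

Lemma end_lift_inj (f : loop) : end_lift f = 1%:M -> homotopic f (const_path R x0).
Proof.
move=> f1; have [cf df pf f0] := loop_liftP f.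
have e1 : loop_lift f one = A0 by rewrite -end_liftK f1 mul1mx.
have [H [cH dH H0 H1 He]] := SL3_loop_contract cf df f0 e1.
exists (p \o H); split=> [|s|s|t|t] /=.
- exact: p_comp.
- by rewrite H0 pf.
- by rewrite H1.
- by rewrite (He t).1 f0.
- by rewrite (He t).2 e1.
Qed.

(** Project a path in SL_3 from [A0] to [rho k *m A0]; it exists since SL_3 is path connected. *)
Lemma end_lift_surj k : exists f : loop, end_lift f = rho k.
Proof.
have [|g [cg dg g0 g1]] := @SL3_path R (\adj A0 *m rho k *m A0).
  by rewrite !det_mulmx det_rho dA0 det_adj_SL // !mulr1.
have ca : continuous (fun t => A0 *m g t) by apply: (comp_continuous cg); exact: mulmx_continuous.
have da t : \det (A0 *m g t) = 1 by rewrite det_mulmx dA0 dg mulr1.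
have a0 : A0 *m g zero = A0 by rewrite g0 mulmx1.
have a1 : A0 *m g one = rho k *m A0 by rewrite g1 !mulmxA SL_mulK_adj // mul1mx.
have cf : continuous (p \o (fun t => A0 *m g t)) by exact: p_comp.
have f0 : (p \o (fun t => A0 *m g t)) zero = x0 by rewrite /= a0.
have f1 : (p \o (fun t => A0 *m g t)) one = x0 by rewrite /= a1 p_rho.
exists (mk_path cf f0 f1 : loop).
have E := @loop_liftE (mk_path cf f0 f1 : loop) (fun t => A0 *m g t) ca da (fun=> erefl) a0.
by rewrite /end_lift E a1 -mulmxA SL_mulK_adj // mulmx1.
Qed.

(** The target is the set of matrices, with [K] a bare index type: the image serves equally for
    counting and for comparison with an explicit group. *)
Lemma covering_pi1 : exists theta : pi1 R x0 -> 'M[C]_3,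
  [/\ injective theta, forall a b, theta (a * b)%g = theta a *m theta b &
      forall M, (exists a, theta a = M) <-> exists k, M = rho k].
Proof.
pose theta (a : pi1 R x0) := end_lift (repr a).
have thetaE f : theta (\pi_(pi1 R x0) f)%qT = end_lift f.
  by apply: end_lift_homotopic; apply/pi1_eqP; rewrite reprK.
have thetaM a b : theta (a * b)%g = theta a *m theta b.
  by rewrite -[(a * b)%g]/(pi1_mul a b) /pi1_mul thetaE end_lift_concat.
have theta1 : theta 1%g = 1%:M by rewrite -[1%g]/(pi1_one R x0) thetaE end_lift_const.
exists theta; split=> // [a b ab|M].
  have : (b^-1 * a)%g = 1%g.
    have : theta (b^-1 * a)%g = 1%:M by rewrite thetaM ab -thetaM mulVg.
    rewrite -{2}[(b^-1 * a)%g]reprK => /end_lift_inj/pi1_eqP; exact.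
  by move/(canRL (mulKVg b)); rewrite mulg1.
split=> [[a <-]|[k ->]]; first exact: end_lift_rho.
by have [f fE] := end_lift_surj k; exists (\pi_(pi1 R x0) f)%qT; rewrite thetaE.
Qed.

End Monodromy.

End Covering.

(** * Topology of spaces of matrices up to scalars *)

Lemma nbhs_set_type (T : topologicalType) (A : set T) (x : A) (U : set A) :
  nbhs x U -> nbhs (set_val x) [set y | forall z : A, set_val z = y -> U z].
Proof.
case=> _ /= [] [W oW <- /=] Wx sWU.
apply: filterS (open_nbhs_nbhs (conj oW Wx)) => y Wy z zy.
by apply: sWU; rewrite /= zy.
Qed.

Section ProjectivizationTopology.
Variables (R : realType) (m n : nat) (A : set 'M[R[i]]_(m, n)).
Local Notation C := R[i].

Lemma nbhs_proj_class (M : A) (W : set (Defs.proj A)) : nbhs (proj_class M) W ->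
  nbhs (set_val M) [set N | forall z : A, set_val z = N -> W (proj_class z)].
Proof.
move=> MW; apply: (@nbhs_set_type _ A M [set z | W (proj_class z)]).
exact: (@pi_continuous _ (Defs.proj A) M _ MW).
Qed.

Lemma continuous_proj (Z : topologicalType) (g : 'M[C]_(m, n) -> Z) :
  (forall M, A M -> g @ M --> g M) ->
  (forall c M, c != 0 -> A M -> g (c *: M) = g M) ->
  continuous (fun x : Defs.proj A => g (Defs.proj_mx x)).
Proof.
move=> cg hg.
have cgv : continuous (fun M : A => g (set_val M)).
  move=> M; apply: (@continuous_comp _ _ _ (set_val : A -> _) g); first exact: initial_continuous.
  by apply: cg; exact: set_valP.
apply: (@repr_comp_continuous _ (Defs.proj A) Z _ cgv) => a b /eqP/proj_classP[c c0 ->].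
by rewrite hg //; exact: set_valP.
Qed.

Lemma proj_class_mx (x : Defs.proj A) : exists M : A, proj_class M = x /\ Defs.proj_mx x = set_val M.
Proof. by exists (repr x); rewrite /proj_class reprK. Qed.

Lemma proj_eq (x y : Defs.proj A) c : c != 0 -> Defs.proj_mx y = c *: Defs.proj_mx x -> x = y.
Proof.
move=> c0; have [M [<- ->]] := proj_class_mx x; have [N [<- ->]] := proj_class_mx y => NE.
by apply/proj_classP; exists c.
Qed.

Hypothesis A_neq0 : forall M, A M -> M != 0.

(* The orthogonal projection onto the line spanned by M separates lines. *)
Definition line_proj (M : 'M[C]_(m, n)) : 'M[C]_(m * n) :=
  (hdot (mxvec M) (mxvec M))^-1 *: (ctrmx (mxvec M) *m mxvec M).

Lemma cvg_mxvec (M : 'M[C]_(m, n)) : mxvec @ M --> mxvec M.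
Proof.
apply: (@cvg_mx _ (nbhs M) (nbhs_filter M)) => i k; rewrite ord1.
case/mxvec_indexP: k => i' j; rewrite mxvecE; under eq_fun do rewrite mxvecE.
exact: (cvg_entry (@cvg_id _ (nbhs M))).
Qed.

Lemma hdot_mxvec_neq0 M : A M -> hdot (mxvec M) (mxvec M) != 0.
Proof.
move=> /A_neq0 M0; rewrite hdot_eq0; apply: contra M0 => /eqP h.
by rewrite -(mxvecK M) h linear0.
Qed.

Lemma line_proj_cvg M : A M -> line_proj @ M --> line_proj M.
Proof.
move=> AM; have cv := @cvg_mxvec M.
exact: (cvg_scalemx (cvg_invC (hdot_mxvec_neq0 AM) (cvg_hdot cv cv))
  (cvg_mulmx (cvg_ctrmx cv) cv)).
Qed.

Lemma ctrmxZ k l (c : C) (M : 'M[C]_(k, l)) : ctrmx (c *: M) = c^*%C *: ctrmx M.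
Proof. by apply/matrixP => i j; rewrite !mxE rmorphM. Qed.

Lemma hdotZr k (c : C) (u w : 'rV[C]_k) : hdot u (c *: w) = c^*%C * hdot u w.
Proof. by rewrite /hdot ctrmxZ -scalemxAr mxE. Qed.

Lemma line_projZ c M : c != 0 -> A M -> line_proj (c *: M) = line_proj M.
Proof.
move=> c0 AM; have h0 := hdot_mxvec_neq0 AM.
have cc0 : c^*%C != 0 by rewrite conjc_eq0.
rewrite /line_proj linearZ /= hdotZl hdotZr ctrmxZ -scalemxAl -scalemxAr !scalerA.
by congr (_ *: _); field; rewrite c0 cc0 h0.
Qed.

(** A row of the projector at an index where [M] has a non-zero entry is a non-zero multiple of [M];
    so equal projectors have proportional matrices. *)
Lemma line_proj_inj M N : A M -> A N -> line_proj M = line_proj N ->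
  exists2 c, c != 0 & N = c *: M.
Proof.
move=> AM AN MN; have hM := hdot_mxvec_neq0 AM; have hN := hdot_mxvec_neq0 AN.
set u := mxvec M; set w := mxvec N.
have [i ui] : exists i, u 0 i != 0.
  apply: contrapT => nu; move/eqP: hM; apply; apply/eqP; rewrite hdot_eq0.
  apply/eqP/rowP => i; rewrite [RHS]mxE; apply/eqP/negPn/negP => h; apply: nu; by exists i.
pose a := (hdot u u)^-1 * (u 0 i)^*%C; pose b := (hdot w w)^-1 * (w 0 i)^*%C.
have a0 : a != 0 by rewrite mulf_neq0 ?invr_eq0 // conjc_eq0.
have uw : a *: u = b *: w.
  have rowE (v : 'rV[C]_(m * n)) : row i ((hdot v v)^-1 *: (ctrmx v *m v)) = ((hdot v v)^-1 * (v 0 i)^*%C) *: v.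
    by apply/rowP => j; rewrite !mxE big_ord_recl big_ord0 !mxE addr0 mulrA.
  by rewrite -!rowE; congr row.
have b0 : b != 0.
  apply: contraNneq ui => b0; move: uw; rewrite b0 scale0r => /eqP.
  by rewrite scaler_eq0 (negbTE a0) /= => /eqP ->; rewrite mxE.
exists (b^-1 * a); first by rewrite mulf_neq0 ?invr_eq0.
apply: (can_inj mxvecK); rewrite linearZ /= -scalerA -/u uw scalerA mulVf // scale1r.
by [].
Qed.

Lemma separated_hausdorff (T : topologicalType) :
  (forall x y : T, (forall f : T -> C, continuous f -> f x = f y) -> x = y) -> hausdorff_space T.
Proof.
move=> h x y xy; apply: h => f cf; apply: (@norm_hausdorff C C) => U V fU fV.
have [z [Uz Vz]] := xy _ _ (cvg_nbhs (cf x) fU) (cvg_nbhs (cf y) fV).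
by exists (f z).
Qed.

Lemma proj_separated (x y : Defs.proj A) :
  (forall f : Defs.proj A -> C, continuous f -> f x = f y) -> x = y.
Proof.
move=> h; have cl := continuous_proj line_proj_cvg line_projZ.
have [|c c0] := @line_proj_inj (Defs.proj_mx x) (Defs.proj_mx y) (proj_mx_in x) (proj_mx_in y).
  apply/matrixP => i j; apply: (h (fun z => line_proj (Defs.proj_mx z) i j)) => z.
  exact: (cvg_entry (cl z)).
exact: proj_eq.
Qed.

End ProjectivizationTopology.

Lemma cvg_expC (R : realType) (Z : Type) (F : set_system Z) {FF : Filter F} (f : Z -> R[i])
    (a : R[i]) k : f @ F --> a -> (fun z => f z ^+ k) @ F --> (a ^+ k : R[i]).
Proof.
move=> fa; elim: k => [|k IH].
  by rewrite expr0; under eq_fun do rewrite expr0; exact: cvg_cst.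
rewrite exprS; under eq_fun do rewrite exprS; exact: (cvg_mulC fa IH).
Qed.

(** * Bounded representatives of prescribed determinant *)

Section ClassBound.
Variables (R : realType) (A : set 'M[R[i]]_3).
Local Notation C := R[i].
Hypothesis A_neq0 : forall M, A M -> M != 0.

(** The squared modulus of the determinant over the sixth power of the Frobenius norm: both scale by
    the sixth power of the modulus of the factor, so the ratio lives on projective classes. *)
Definition det_ratio (M : 'M[C]_3) : C :=
  (\det M * (\det M)^*%C) * (hdot (mxvec M) (mxvec M) ^+ 3)^-1.

Lemma det_ratio_cvg M : A M -> det_ratio @ M --> det_ratio M.
Proof.
move=> AM; have h0 := hdot_mxvec_neq0 A_neq0 AM.
have cv := @cvg_mxvec R 3 3 M.
have cd : (fun N : 'M[C]_3 => \det N) @ M --> (\det M : C) by exact: (cvg_det (@cvg_id _ (nbhs M))).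
have c2 : (fun N : 'M[C]_3 => hdot (mxvec N) (mxvec N)) @ M --> (hdot (mxvec M) (mxvec M) : C).
  exact: (cvg_hdot cv cv).
have c3 : (fun N : 'M[C]_3 => hdot (mxvec N) (mxvec N) ^+ 3) @ M -->
    (hdot (mxvec M) (mxvec M) ^+ 3 : C).
  exact: (@cvg_expC _ _ _ _ _ _ 3 c2).
exact: (cvg_mulC (cvg_mulC cd (cvg_conj cd)) (cvg_invC (expf_neq0 3 h0) c3)).
Qed.

Lemma det_ratioZ c M : c != 0 -> A M -> det_ratio (c *: M) = det_ratio M.
Proof.
move=> c0 AM; have h0 := hdot_mxvec_neq0 A_neq0 AM.
have cc0 : c^*%C != 0 by rewrite conjc_eq0.
rewrite /det_ratio detZ linearZ /= hdotZl hdotZr rmorphM rmorphXn /=.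
by field; rewrite c0 cc0 h0.
Qed.

Lemma le_add1_of_cube (h B : C) : 0 <= h -> 0 <= B -> h ^+ 3 <= B -> h <= B + 1.
Proof.
move=> h0 B0 hB.
have [//|Bh] := real_leP (ger0_real h0) (ger0_real (addr_ge0 B0 ler01)).
have h1 : 1 <= h by apply: ltW; apply: le_lt_trans Bh; rewrite lerDr.
have := le_lt_trans (ler_eXnr (isT : (0 < 3)%N) h1) (le_lt_trans hB (_ : B < B + 1)).
by rewrite ltrDl ltr01 => /(_ isT) /(lt_trans Bh); rewrite ltxx.
Qed.

(** Once the determinant is fixed to [c], the cube of the squared norm is the squared modulus of [c]
    divided by [det_ratio], a continuous function that is non-zero at [x]. *)
Lemma near_class_bounded (x : Defs.proj A) (c : C) : \det (Defs.proj_mx x) != 0 -> c != 0 ->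
  exists B : R, \forall y \near x, forall N : A, proj_class N = y ->
    \det (set_val N) = c -> forall i j, `|set_val N i j| <= B%:C%C.
Proof.
move=> dx c0; pose e (y : Defs.proj A) := det_ratio (Defs.proj_mx y).
have ce : continuous e := continuous_proj det_ratio_cvg det_ratioZ.
have eN (N : A) : e (proj_class N) = det_ratio (set_val N).
  have [k k0 kE] := proj_mxP N; rewrite /e kE det_ratioZ //; exact: set_valP.
have ex0 : e x != 0.
  rewrite mulf_neq0 ?invr_eq0 ?expf_neq0 //; last exact: (hdot_mxvec_neq0 A_neq0 (proj_mx_in x)).
  by rewrite mulf_neq0 // conjc_eq0.
(* The final 2 pays for avoiding roots twice: 1 in passing from the cube of the squared norm to the
   squared norm, 1 from the square of an entry to the entry. *)
pose B := (`|(e x)^-1| + 1) * `|c * c^*%C| + 2.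
have B0 : 0 <= (`|(e x)^-1| + 1) * `|c * c^*%C| by rewrite mulr_ge0 // addr_ge0.
exists (complex.Re B).
have BE : (complex.Re B)%:C%C = B by rewrite RRe_real // ger0_real // addr_ge0.
have H : \forall y \near x, `|(e x)^-1 - (e y)^-1| < 1.
  have ci : (fun y => (e y)^-1) @ x --> ((e x)^-1 : C) by exact: (cvg_invC ex0 (ce x)).
  exact: ((@cvgrPdist_lt C C _ (nbhs x) _ _ _).1 ci 1 ltr01).
apply: filterS H => y h N Ny dN i j; rewrite BE; subst y.
set v := mxvec (set_val N); have hv0 := hdot_ge0 v.
have hv : hdot v v != 0 by exact: (hdot_mxvec_neq0 A_neq0 (set_valP N)).
have hvB : hdot v v ^+ 3 <= (`|(e x)^-1| + 1) * `|c * c^*%C|.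
  have cc0 : c * c^*%C != 0 by rewrite mulf_neq0 // conjc_eq0.
  have -> : hdot v v ^+ 3 = `|(e (proj_class N))^-1| * `|c * c^*%C|.
    rewrite eN /det_ratio dN -normrM invfM invrK mulrC mulrA divff // mul1r.
    by rewrite ger0_norm // exprn_ge0.
  rewrite ler_wpM2r // -lerBlDl; apply: le_trans (ltW h).
  by rewrite distrC; exact: lerB_dist.
have nB : `|set_val N i j| ^+ 2 <= hdot v v.
  rewrite hdotE (bigD1 (mxvec_index i j)) //= mxvecE -sqr_normc lerDl sumr_ge0 // => k _.
  by rewrite -sqr_normc exprn_ge0.
set t := `|set_val N i j| in nB *; have t0 : 0 <= t by exact: normr_ge0.
have tr : t \is Num.real by exact: ger0_real.
have t2 : t <= t ^+ 2 + 1.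
  have [t1|t1] := real_leP tr (real1 C); first by rewrite (le_trans t1) // lerDr exprn_ge0.
  by rewrite (le_trans (ler_eXnr (isT : (0 < 2)%N) (ltW t1))) // lerDl.
apply: (le_trans t2); rewrite /B -[2]/(1 + 1) addrA lerD2r.
by apply: (le_trans nB); exact: le_add1_of_cube.
Qed.

End ClassBound.

(** * The projective linear group *)

Section Isomorphism.
Variables (G H : groupType).

(** The proof [fM] is kept as an argument so that the morphism structure can be attached to the
    function it concerns. *)
Definition mk_multiplicative (f : G -> H) (fM : {morph f : x y / (x * y)%g}) : G -> H :=
  let _ := fM in f.

HB.instance Definition _ f fM := isMultiplicative.Build G H (@mk_multiplicative f fM) fM.

Lemma isomorphic_through (T : Type) (mul : T -> T -> T) (theta : G -> T) (rho : H -> T) :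
  injective theta -> injective rho ->
  (forall a b, theta (a * b)%g = mul (theta a) (theta b)) ->
  (forall a b, rho (a * b)%g = mul (rho a) (rho b)) ->
  (forall M, (exists a, theta a = M) <-> exists k, M = rho k) ->
  isomorphic_groups G H.
Proof.
move=> thetaI rhoI thetaM rhoM im.
have ex a : exists k, theta a = rho k by apply/im; exists a.
have ex' k : exists a, theta a = rho k by apply/im; exists k.
pose f a := projT1 (cid (ex a)); pose g k := projT1 (cid (ex' k)).
have fE a : theta a = rho (f a) by exact: (projT2 (cid (ex a))).
have gE k : theta (g k) = rho k by exact: (projT2 (cid (ex' k))).
have fM : {morph f : x y / (x * y)%g}.
  by move=> a b; apply: rhoI; rewrite -fE thetaM rhoM !fE.
exists (mk_multiplicative fM); exists g => [a|k].
  by apply: thetaI; rewrite gE fE.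
by apply: rhoI; rewrite /= /mk_multiplicative -fE gE.
Qed.

End Isomorphism.

(** * Cube roots of unity *)

Section Omega.
Variable R : realType.
Local Notation C := R[i].
Local Notation w := (omega R).

Lemma cis_mul (a b : R) : ((cos a +i* sin a) * (cos b +i* sin b))%C = (cos (a + b) +i* sin (a + b))%C.
Proof. by rewrite cosD sinD; apply/eqP; rewrite eq_complex /=; apply/andP; split; apply/eqP; ring. Qed.

Lemma omega3 : w ^+ 3 = 1.
Proof.
rewrite !exprS expr0 mulr1 /omega !cis_mul.
have -> : 2 * pi / 3 + (2 * pi / 3 + 2 * pi / 3) = pi *+ 2 :> R by rewrite mulr2n; field.
by rewrite cos2pi sin2pi.
Qed.

Lemma omega_neq1 : w != 1.
Proof.
rewrite /omega eq_complex /= negb_and; apply/orP; right.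
rewrite gt_eqF // sin_gt0_pi // divr_gt0 ?mulr_gt0 ?pi_gt0 //=.
by rewrite ltr_pdivrMr // mulrC ltr_pM2l ?pi_gt0 // ltr_nat.
Qed.

Lemma omega_sum : 1 + w + w ^+ 2 = 0.
Proof.
apply: (mulfI (_ : w - 1 != 0)); first by rewrite subr_eq0 omega_neq1.
have -> : (w - 1) * (1 + w + w ^+ 2) = w ^+ 3 - 1 by ring.
by rewrite omega3 subrr mulr0.
Qed.

Lemma omega_neq0 : w != 0.
Proof. by apply/eqP => w0; have := omega3; rewrite w0 expr0n => /eqP; rewrite eq_sym oner_eq0. Qed.

Lemma cube_root1 (x : C) : x ^+ 3 = 1 -> exists k : 'I_3, x = w ^+ k.
Proof.
move=> x3; have : (x - 1) * (x - w) * (x - w ^+ 2) = 0.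
  have -> : (x - 1) * (x - w) * (x - w ^+ 2) = x ^+ 3 - x ^+ 2 * (1 + w + w ^+ 2)
     + x * w * (1 + w + w ^+ 2) - w ^+ 3 by ring.
  by rewrite omega_sum x3 omega3 !mulr0 subr0 addr0 subrr.
move=> /eqP; rewrite !mulf_eq0 !subr_eq0 => /orP[/orP[]|] /eqP ->.
- by exists ord0.
- by exists (Ordinal (isT : (1 < 3)%N)).
- by exists (Ordinal (isT : (2 < 3)%N)).
Qed.

Lemma omega_expI : injective (fun k : 'I_3 => w ^+ k).
Proof.
have w1 := negbTE omega_neq1.
have w2 : (w ^+ 2 == 1) = false.
  by apply/negP => /eqP w2; have := omega3; rewrite exprS w2 mulr1 => /eqP; rewrite w1.
have ww : (w ^+ 2 == w) = false.
  by rewrite expr2 -[X in _ == X]mulr1 (inj_eq (mulfI omega_neq0)) w1.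
move=> -[[|[|[|k]]] ik] -[[|[|[|l]]] il] //=; rewrite ?expr0 ?expr1 => /eqP;
  rewrite ?w1 ?w2 ?ww ?[1 == _]eq_sym ?w1 ?w2 ?[w == _]eq_sym ?ww // => _;
  exact: val_inj.
Qed.

Lemma cube_root (z : C) : exists c, c ^+ 3 = z.
Proof. by exists (3.-root z); rewrite rootCK. Qed.

(** The group law of ['Z_3] is addition modulo 3, which exponents of [w] respect. *)
Lemma omega_expD (k l : 'Z_3) : w ^+ (k * l)%g = w ^+ k * w ^+ l.
Proof. by rewrite -exprD /= expr_mod // omega3. Qed.

End Omega.

Section ClassOfMatrix.
Variables (R : realType) (m n : nat) (A : set 'M[R[i]]_(m, n)) (a0 : A).
Local Notation C := R[i].

(** Total on matrices, with value the class of [a0] outside [A]: the quotient map of the covering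
    argument must be defined on all of ['M[C]_3]. *)
Definition proj_at (M : 'M[C]_(m, n)) : Defs.proj A := proj_class (insubd a0 M).

Lemma set_val_insubd M : A M -> set_val (insubd a0 M) = M.
Proof. by move=> AM; rewrite set_valE; apply: insubdK; exact: mem_set. Qed.

Lemma proj_atP M N : A M -> A N ->
  proj_at M = proj_at N <-> exists2 c : C, c != 0 & N = c *: M.
Proof.
by move=> AM AN; rewrite /proj_at; split => [/proj_classP|NM];
  [rewrite !set_val_insubd|apply/proj_classP; rewrite !set_val_insubd].
Qed.

Lemma proj_at_class (M : A) : proj_at (set_val M) = proj_class M.
Proof.
apply/proj_classP; exists 1; first exact: oner_neq0.
by rewrite scale1r set_val_insubd //; exact: set_valP.
Qed.

Lemma nbhs_proj_at M (W : set (Defs.proj A)) : A M -> nbhs (proj_at M) W ->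
  nbhs M [set N | A N -> W (proj_at N)].
Proof.
move=> AM /nbhs_proj_class; rewrite set_val_insubd //.
by apply: filterS => N NW AN; apply: NW; rewrite set_val_insubd.
Qed.

End ClassOfMatrix.

Section ProjectiveLinear.
Variable R : realType.
Local Notation C := R[i].
Local Notation w := (omega R).

Lemma unit_one_in : (1%:M : 'M[C]_3) \in [set M : 'M[C]_3 | M \in unitmx].
Proof. by apply/mem_set; exact: unitmx1. Qed.

Definition PGL3_one : [set M : 'M[C]_3 | M \in unitmx] :=
  exist (fun M => M \in [set M : 'M[C]_3 | M \in unitmx]) 1%:M unit_one_in.

Lemma SL_unitmx (A : 'M[C]_3) : \det A = 1 -> A \in unitmx.
Proof. by move=> dA; rewrite unitmxE dA unitr1. Qed.

Lemma unitmx_neq0 (M : 'M[C]_3) : M \in unitmx -> M != 0.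
Proof. by apply: contraTneq => ->; rewrite unitmxE det0 unitr0. Qed.

Lemma PGL3_pi1 (g : PGL3 R) : isomorphic_groups (pi1 R g) 'Z_3.
Proof.
pose p := proj_at PGL3_one.
pose rho (k : 'Z_3) : 'M[C]_3 := (w ^+ k)%:M.
have scaleE (c : C) (A : 'M[C]_3) : \det A = 1 -> \det (c *: A) = 1 -> exists k : 'Z_3, c = w ^+ k.
  by move=> dA; rewrite detZ dA mulr1; exact: cube_root1.
have p_cts (A : 'M[C]_3) : \det A = 1 -> p @ within (@SL R 3) (nbhs A) --> p A.
  move=> dA W pW; have AW := nbhs_proj_at (SL_unitmx dA) pW.
  by apply: (filterS _ AW) => B h dB; exact: (h (SL_unitmx dB)).
(* Dividing by a cube root of the determinant brings a representative into SL_3; the choice of the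
   root accounts for the fibre. *)
have p_surj x : exists2 A : 'M[C]_3, \det A = 1 & p A = x.
  have [M [<- _]] := proj_class_mx x; have [c c3] := cube_root (\det (set_val M)).
  have uM : set_val M \in unitmx by exact: (set_valP M).
  have c0 : c != 0.
    by apply: contraTneq uM => c0; rewrite unitmxE -c3 c0 expr0n unitr0.
  have dA : \det (c^-1 *: set_val M) = 1 by rewrite detZ -c3 -exprMn mulVf // expr1n.
  exists (c^-1 *: set_val M) => //; rewrite -(proj_at_class PGL3_one M).
  apply/proj_atP => //; first exact: SL_unitmx.
  by exists c; rewrite // scalerA divff // scale1r.
have p_fib (A B : 'M[C]_3) : \det A = 1 -> \det B = 1 -> p A = p B <-> exists k, B = rho k *m A.
  move=> dA dB; split => [/(proj_atP _ (SL_unitmx dA) (SL_unitmx dB))[c c0 BE]|[k BE]].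
    have [k kE] := scaleE c A dA (etrans (congr1 determinant (esym BE)) dB).
    by exists k; rewrite /rho mul_scalar_mx -kE.
  apply/(proj_atP _ (SL_unitmx dA) (SL_unitmx dB)); exists (w ^+ k).
    by rewrite expf_neq0 // omega_neq0.
  by rewrite BE mul_scalar_mx.
have det_rho k : \det (rho k) = 1 by rewrite det_scalar -exprM mulnC exprM omega3 expr1n.
have tr_rho k : rho k <> 1%:M -> \tr (rho k) <> 3%:R.
  move=> nk tk; apply: nk; congr (_%:M); move: tk; rewrite mxtrace_scalar.
  by move=> tk; apply: (mulIf (_ : 3%:R != 0 :> C)); rewrite ?pnatr_eq0 // mulr_natr tk mul1r.
have hd : hausdorff_space (PGL3 R).
  by apply: separated_hausdorff => x y; apply: proj_separated => M; exact: unitmx_neq0.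
have p_bounded (x : PGL3 R) : exists M : R, \forall y \near x,
    forall A : 'M[C]_3, \det A = 1 -> p A = y -> forall i j, `|A i j| <= M%:C%C.
  have dx : \det (Defs.proj_mx x) != 0 by rewrite -unitfE -unitmxE; exact: (proj_mx_in x).
  have [||M xM] := @near_class_bounded R _ _ x 1 dx; first by move=> N; exact: unitmx_neq0.
    exact: oner_neq0.
  exists M; apply: filterS xM => y h A dA pA i j.
  have AE := set_val_insubd PGL3_one (SL_unitmx dA).
  by have := h (insubd PGL3_one A) pA; rewrite AE; exact.
have [A0 dA0 <-] := p_surj g.
have [theta [thI thM im]] := covering_pi1 p_cts p_surj p_fib det_rho tr_rho hd p_bounded dA0.
apply: (isomorphic_through (mul := mulmx) thI _ thM _ im) => [k l kl|k l].
  apply: (@omega_expI R); have := congr1 (fun M : 'M[C]_3 => M 0 0) kl.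
  by rewrite /rho !mxE eqxx !mulr1n.
by rewrite /rho omega_expD scalar_mxM.
Qed.

End ProjectiveLinear.

(** * Orbits of diagonal pairs *)

Section BoundedFamilies.
Variables (R : realType) (T : Type) (P : set T).
Local Notation C := R[i].

Definition bounded_on (f : T -> C) : Prop := exists B : R, forall x, P x -> `|f x| <= B%:C%C.

Lemma bounded_cst (c : C) : bounded_on (fun=> c).
Proof. by exists (complex.Re `|c|) => x _; rewrite RRe_real // normr_real. Qed.

Lemma bounded_add f g : bounded_on f -> bounded_on g -> bounded_on (fun x => f x + g x).
Proof.
move=> [B fB] [B' gB]; exists (B + B') => x Px.
by rewrite rmorphD (le_trans (ler_normD _ _)) // lerD ?fB ?gB.
Qed.

Lemma bounded_mul f g : bounded_on f -> bounded_on g -> bounded_on (fun x => f x * g x).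
Proof.
move=> [B fB] [B' gB]; exists (B * B') => x Px.
by rewrite rmorphM normrM ler_pM ?normr_ge0 ?fB ?gB.
Qed.

Lemma bounded_sum (I : Type) (r : seq I) (f : I -> T -> C) :
  (forall i, bounded_on (f i)) -> bounded_on (fun x => \sum_(i <- r) f i x).
Proof.
move=> fb; elim: r => [|i r IH].
  by under eq_fun do rewrite big_nil; exact: bounded_cst.
by under eq_fun do rewrite big_cons; exact: bounded_add.
Qed.

Definition mx_bounded_on m n (f : T -> 'M[C]_(m, n)) := forall i j, bounded_on (fun x => f x i j).

Lemma mx_bounded_mul m n k (f : T -> 'M[C]_(m, n)) (g : T -> 'M[C]_(n, k)) :
  mx_bounded_on f -> mx_bounded_on g -> mx_bounded_on (fun x => f x *m g x).
Proof.
move=> fb gb i j; under eq_fun do rewrite mxE.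
by apply: bounded_sum => l; exact: bounded_mul.
Qed.

Lemma bounded_prod (I : Type) (r : seq I) (f : I -> T -> C) :
  (forall i, bounded_on (f i)) -> bounded_on (fun x => \prod_(i <- r) f i x).
Proof.
move=> fb; elim: r => [|i r IH].
  by under eq_fun do rewrite big_nil; exact: bounded_cst.
by under eq_fun do rewrite big_cons; exact: bounded_mul.
Qed.

Lemma bounded_det n (f : T -> 'M[C]_n) : mx_bounded_on f -> bounded_on (fun x => \det (f x)).
Proof.
move=> fb; apply: bounded_sum => s; apply: bounded_mul; first exact: bounded_cst.
by apply: bounded_prod => i; exact: fb.
Qed.

Lemma mx_bounded_adj n (f : T -> 'M[C]_n) : mx_bounded_on f -> mx_bounded_on (fun x => \adj (f x)).
Proof.
move=> fb i j; under eq_fun do rewrite mxE.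
apply: bounded_mul; first exact: bounded_cst.
by apply: bounded_det => k k'; under eq_fun do rewrite !mxE; exact: fb.
Qed.

Lemma bounded_sqrt f : bounded_on (fun x => f x ^+ 2) -> bounded_on f.
Proof.
move=> [B fB]; exists (B + 1) => x Px; rewrite rmorphD rmorph1.
have tr : `|f x| \is Num.real := normr_real _.
have h := fB x Px; rewrite normrX in h; apply: le_trans (_ : `|f x| ^+ 2 + 1 <= _); last by rewrite lerD2r.
have [t1|t1] := real_leP tr (real1 C); first by rewrite (le_trans t1) // lerDr exprn_ge0.
by rewrite (le_trans (ler_eXnr (isT : (0 < 2)%N) (ltW t1))) // lerDl.
Qed.

End BoundedFamilies.

(** * The orbit of a diagonal pair as a quotient of SL_3(C) *)

Section DiagonalOrbit.
Variable R : realType.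
Local Notation C := R[i].
Variables (l : 'rV[C]_3).
Hypothesis l_neq0 : forall i, l 0 i != 0.
Hypothesis l_inj : injective (l 0).

Local Notation Lam := (diag_mx l).

Lemma diag_conic_mx : Lam \in @conic_mx R.
Proof.
apply/mem_set; split; first by rewrite tr_diag_mx.
apply/eqP => /matrixP/(_ 0 0); rewrite !mxE eqxx mulr1n => /eqP.
by rewrite (negbTE (l_neq0 0)).
Qed.

Lemma det_diag_neq0 : \det Lam != 0.
Proof. by rewrite det_diag; apply/prodf_neq0 => i _; exact: l_neq0. Qed.

Definition diag_pair : conic R * conic R := (proj_of (@id_conic_mx R), proj_of diag_conic_mx).

Lemma gram_entry (d : 'rV[C]_3) (A : 'M[C]_3) j k :
  (A^T *m diag_mx d *m A) j k = \sum_i d 0 i * (A i j * A i k).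
Proof.
rewrite mxE; apply: eq_bigr => i _; rewrite mul_mx_diag !mxE.
by rewrite mulrAC mulrC mulrA mulrC mulrCA.
Qed.

(* Lagrange interpolation: the rank one form of the i-th row is a combination
   of A^T A, A^T L A and A^T L^2 A = (A^T L A) (A^T A)^-1 (A^T L A). *)
Lemma diag_bounded (P : set 'M[C]_3) :
  (forall A, P A -> \det A = 1) ->
  mx_bounded_on P (fun A => A^T *m A) -> mx_bounded_on P (fun A => A^T *m Lam *m A) ->
  mx_bounded_on P id.
Proof.
move=> dP b1 b2 i j; apply: bounded_sqrt.
have b3 : mx_bounded_on P (fun A => A^T *m Lam *m A *m (\adj (A^T *m A)) *m (A^T *m Lam *m A)).
  by apply: mx_bounded_mul => //; apply: mx_bounded_mul => //; exact: mx_bounded_adj.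
pose i1 := lift i (0 : 'I_2); pose i2 := lift i (1 : 'I_2).
have h1 : i1 != i by rewrite eq_sym neq_lift.
have h2 : i2 != i by rewrite eq_sym neq_lift.
have hi k : k != i -> k = i1 \/ k = i2.
  rewrite eq_sym; case: (unliftP i k) => [k' ->|->]; last by rewrite eqxx.
  by case: k' => [[|[|//]] k2] _; [left|right]; congr (lift i _); apply: val_inj.
(* The denominator of the Lagrange polynomial that is 1 at [l 0 i] and 0 at the other two entries;
   expanding its numerator gives the coefficients in [E]. *)
pose D := (l 0 i - l 0 i1) * (l 0 i - l 0 i2).
have D0 : D != 0 by rewrite mulf_neq0 // subr_eq0 (inj_eq l_inj) eq_sym.
have E (A : 'M[C]_3) : P A -> A i j ^+ 2 = D^-1 *
   ((A^T *m Lam *m A *m (\adj (A^T *m A)) *m (A^T *m Lam *m A)) j j +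
    (- (l 0 i1 + l 0 i2)) * (A^T *m Lam *m A) j j + (l 0 i1 * l 0 i2) * (A^T *m A) j j).
  move=> /dP dA; apply: (canRL (mulKf D0)).
  have dG : \det (A^T *m A) = 1 by rewrite det_mulmx det_tr dA mulr1.
  (* Inserted between the two copies of [Lam], this turns the product into [A^T Lam^2 A]. *)
  have AGA : A *m \adj (A^T *m A) *m A^T = 1%:M.
    have -> : A *m \adj (A^T *m A) *m A^T = A *m (\adj (A^T *m A) *m (A^T *m A)) *m \adj A.
      by rewrite -!mulmxA SL_mulK_adj // mulmx1.
    by rewrite SL_adjK // mulmx1 SL_mulK_adj.
  have -> : A^T *m Lam *m A *m \adj (A^T *m A) *m (A^T *m Lam *m A) =
      A^T *m diag_mx (\row_k (l 0 k * l 0 k)) *m A.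
    have -> : A^T *m Lam *m A *m \adj (A^T *m A) *m (A^T *m Lam *m A) =
        A^T *m Lam *m (A *m \adj (A^T *m A) *m A^T) *m Lam *m A by rewrite !mulmxA.
    by rewrite AGA mulmx1 -mulmx_diag !mulmxA.
  have -> : A^T *m A = A^T *m diag_mx (const_mx 1) *m A by rewrite diag_const_mx mulmx1.
  rewrite !gram_entry.
  rewrite !mulr_sumr -!big_split /= (bigD1 i) //= big1 => [|k /hi ki].
    by rewrite addr0 !mxE expr2 /D; ring.
  by rewrite !mxE; case: ki => ->; ring.
have [B0 hB] : bounded_on P (fun A => D^-1 *
   ((A^T *m Lam *m A *m (\adj (A^T *m A)) *m (A^T *m Lam *m A)) j j +
    (- (l 0 i1 + l 0 i2)) * (A^T *m Lam *m A) j j + (l 0 i1 * l 0 i2) * (A^T *m A) j j)).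
  apply: bounded_mul; first exact: bounded_cst.
  apply: bounded_add; last by apply: bounded_mul; [exact: bounded_cst|exact: b1].
  apply: bounded_add; first exact: b3.
  by apply: bounded_mul; [exact: bounded_cst|exact: b2].
by exists B0 => A PA; rewrite /= (E A PA); exact: hB.
Qed.

Local Notation S := (Defs.orbit diag_pair).

Definition one_conic : @conic_mx R := exist (fun M => M \in @conic_mx R) 1%:M (@id_conic_mx R).

Definition pair_at (A : 'M[C]_3) : conic R * conic R :=
  (proj_at one_conic (A^T *m A), proj_at one_conic (A^T *m Lam *m A)).

Lemma gram_conic_mx (A M : 'M[C]_3) : A \in unitmx -> conic_mx M -> conic_mx (A^T *m M *m A).
Proof. by move=> uA cM; apply: set_mem; exact: congruence_subproof. Qed.

Lemma gram1_conic_mx (A : 'M[C]_3) : A \in unitmx -> conic_mx (A^T *m A).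
Proof.
move=> uA; rewrite -[A^T]mulmx1; apply: gram_conic_mx => //.
exact: set_mem (@id_conic_mx R).
Qed.

Lemma gramL_conic_mx (A : 'M[C]_3) : A \in unitmx -> conic_mx (A^T *m Lam *m A).
Proof. by move=> uA; apply: gram_conic_mx => //; exact: set_mem diag_conic_mx. Qed.

(** Scaling the acting matrix to determinant 1 multiplies both congruent matrices by the same
    non-zero scalar, so the classes do not change. *)
Lemma orbit_pair_at (y : conic R * conic R) :
  S y <-> exists2 A : 'M[C]_3, \det A = 1 & pair_at A = y.
Proof.
have E (M : [set M : 'M[C]_3 | M \in unitmx]) :
    (congruence (proj_class M) diag_pair.1, congruence (proj_class M) diag_pair.2) = pair_at (set_val M).
  have uM : set_val M \in unitmx := set_valP M.
  rewrite /pair_at /proj_at; congr (_, _); apply: congruenceE; rewrite set_val_insubd //.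
  - by rewrite [in RHS]set_valE /= mulmx1.
  - exact: gram1_conic_mx.
  - exact: gramL_conic_mx.
split=> [[a _ <-]|[A dA <-]].
  have [M [<- _]] := proj_class_mx a; rewrite E.
  have uM : set_val M \in unitmx := set_valP M.
  have [c c3] := cube_root (\det (set_val M)).
  have c0 : c != 0.
    by apply: contraTneq uM => c0; rewrite unitmxE -c3 c0 expr0n unitr0.
  have dA : \det (c^-1 *: set_val M) = 1 by rewrite detZ -c3 -exprMn mulVf // expr1n.
  have cc0 : c * c != 0 by rewrite mulf_neq0.
  have cE : c * c * (c^-1 * c^-1) = 1 by field.
  exists (c^-1 *: set_val M) => //; congr (_, _); apply/proj_atP.
  - by apply: gram1_conic_mx; exact: SL_unitmx.
  - exact: gram1_conic_mx.
  - exists (c * c) => //.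
    by rewrite [(_ *: _)^T]linearZ /= -!(scalemxAl, scalemxAr) !scalerA -mulrA cE scale1r.
  - by apply: gramL_conic_mx; exact: SL_unitmx.
  - exact: gramL_conic_mx.
  - exists (c * c) => //.
    by rewrite [(_ *: _)^T]linearZ /= -!(scalemxAl, scalemxAr) !scalerA -mulrA cE scale1r.
have AE := set_val_insubd (PGL3_one R) (SL_unitmx dA).
by exists (proj_class (insubd (PGL3_one R) A)) => //; rewrite E AE.
Qed.

Lemma diag_pair_in : pair_at 1%:M \in S.
Proof. by apply/mem_set/orbit_pair_at; exists 1%:M; rewrite ?det1. Qed.

Definition orbit_base : S := exist (fun y => y \in S) (pair_at 1%:M) diag_pair_in.

Definition orbit_point (A : 'M[C]_3) : S := insubd orbit_base (pair_at A).

Lemma orbit_pointE (A : 'M[C]_3) : \det A = 1 -> set_val (orbit_point A) = pair_at A.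
Proof.
move=> dA; rewrite set_valE; apply: insubdK; apply/mem_set.
by apply/orbit_pair_at; exists A.
Qed.

Lemma orbit_point_cts (A : 'M[C]_3) : \det A = 1 ->
  orbit_point @ within (@SL R 3) (nbhs A) --> orbit_point A.
Proof.
move=> dA W /nbhs_set_type; rewrite orbit_pointE // => /near_pairs[P [Q [PA QA PQ]]].
have uA := SL_unitmx dA.
have ctr : (fun B : 'M[C]_3 => B^T) @ A --> (A^T : 'M[C]_3) by exact: (cvg_trmx (@cvg_id _ (nbhs A))).
have c1 : (fun B : 'M[C]_3 => B^T *m B) @ A --> (A^T *m A : 'M[C]_3).
  exact: (cvg_mulmx ctr (@cvg_id _ (nbhs A))).
have c2 : (fun B : 'M[C]_3 => B^T *m Lam *m B) @ A --> (A^T *m Lam *m A : 'M[C]_3).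
  exact: (cvg_mulmx (cvg_mulmx ctr (@cvg_cst 'M[C]_3 Lam _ (nbhs A) _)) (@cvg_id _ (nbhs A))).
have n1 := cvg_nbhs c1 (nbhs_proj_at (gram1_conic_mx uA) PA).
have n2 := cvg_nbhs c2 (nbhs_proj_at (gramL_conic_mx uA) QA).
have n12 : nbhs A [set B : 'M[C]_3 | \det B = 1 -> W (orbit_point B)].
  apply: filterS2 n1 n2 => B h1 h2 dB.
  apply: (PQ _ _ (h1 (gram1_conic_mx (SL_unitmx dB))) (h2 (gramL_conic_mx (SL_unitmx dB)))).
  exact: orbit_pointE.
exact: n12.
Qed.

Lemma orbit_point_surj (y : S) : exists2 A : 'M[C]_3, \det A = 1 & orbit_point A = y.
Proof.
have [A dA Ay] := (orbit_pair_at (set_val y)).1 (set_valP y).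
by exists A => //; apply: val_inj; rewrite -[RHS]Ay -orbit_pointE // set_valE.
Qed.

Lemma orbit_point_eq (A B : 'M[C]_3) : \det A = 1 -> \det B = 1 ->
  orbit_point A = orbit_point B <-> pair_at A = pair_at B.
Proof.
move=> dA dB; split=> [AB|AB]; first by rewrite -!orbit_pointE // AB.
by apply: val_inj; have := orbit_pointE dA; rewrite AB -(orbit_pointE dB) set_valE.
Qed.

(** Two independent scalars, because each conic is fixed only as a projective class. *)
Definition stabilizes (h : 'M[C]_3) : Prop :=
  (exists2 c, c != 0 & h^T *m h = c%:M) /\ (exists2 d, d != 0 & h^T *m Lam *m h = d *: Lam).

(** Congruence is a right action, so matrices with the same image differ by a stabilizing factor on
    the left, as the covering argument requires. *)
Lemma pair_at_eq (A B : 'M[C]_3) : \det A = 1 -> \det B = 1 ->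
  pair_at A = pair_at B <-> stabilizes (B *m \adj A).
Proof.
move=> dA dB; have uA := SL_unitmx dA; have uB := SL_unitmx dB.
have AVA := SL_mulK_adj dA; have VAA := SL_adjK dA.
have AVAT : (\adj A)^T *m A^T = 1%:M by rewrite -trmx_mul AVA trmx1.
have VAAT : A^T *m (\adj A)^T = 1%:M by rewrite -trmx_mul VAA trmx1.
have key (M : 'M[C]_3) (c : C) : B^T *m M *m B = c *: (A^T *m M *m A) <->
    (B *m \adj A)^T *m M *m (B *m \adj A) = c *: M.
  rewrite trmx_mul; split=> h.
    have -> : (\adj A)^T *m B^T *m M *m (B *m \adj A) = (\adj A)^T *m (B^T *m M *m B) *m \adj A.
      by rewrite !mulmxA.
    rewrite h -scalemxAr -scalemxAl !mulmxA AVAT mul1mx -mulmxA AVA mulmx1 //.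
  have -> : B^T *m M *m B = A^T *m ((\adj A)^T *m B^T *m M *m (B *m \adj A)) *m A.
    by rewrite !mulmxA VAAT mul1mx -!mulmxA VAA mulmx1.
  by rewrite h -scalemxAr -scalemxAl.
have key1 (c : C) : B^T *m B = c *: (A^T *m A) <-> (B *m \adj A)^T *m (B *m \adj A) = c%:M.
  by have := key 1%:M c; rewrite !mulmx1 scalemx1.
split=> [[/(proj_atP _ (gram1_conic_mx uA) (gram1_conic_mx uB))[c c0 cE]
   /(proj_atP _ (gramL_conic_mx uA) (gramL_conic_mx uB))[d d0 dE]]|[[c c0 cE] [d d0 dE]]].
  by split; [exists c => //; apply/key1|exists d => //; apply/key].
congr (_, _).
  by apply/(proj_atP _ (gram1_conic_mx uA) (gram1_conic_mx uB)); exists c => //; apply/key1.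
by apply/(proj_atP _ (gramL_conic_mx uA) (gramL_conic_mx uB)); exists d => //; apply/key.
Qed.

Lemma conic_mx_neq0 (M : 'M[C]_3) : conic_mx M -> M != 0.
Proof. by case. Qed.

Lemma orbit_hausdorff : hausdorff_space S.
Proof.
apply: separated_hausdorff => x y xy; apply: val_inj.
have sv : continuous (set_val : S -> conic R * conic R) by exact: initial_continuous.
have h1 : (set_val x).1 = (set_val y).1.
  apply: proj_separated => [|f cf]; first exact: conic_mx_neq0.
  apply: (xy (fun z => f (set_val z).1)).
  exact: (comp_continuous (comp_continuous sv (@fst_continuous _ _)) cf).
have h2 : (set_val x).2 = (set_val y).2.
  apply: proj_separated => [|f cf]; first exact: conic_mx_neq0.
  apply: (xy (fun z => f (set_val z).2)).
  exact: (comp_continuous (comp_continuous sv (@snd_continuous _ _)) cf).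
by move: h1 h2; rewrite set_valE; case: (val x) (val y) => [a b] [a' b'] /= -> ->.
Qed.

Lemma mx_bounded_unif (T : Type) (P : set T) m n (f : T -> 'M[C]_(m, n)) :
  mx_bounded_on P f -> exists B : R, forall x, P x -> forall i j, `|f x i j| <= B%:C%C.
Proof.
move=> fb; have [b bP] := choice (fun ij : 'I_m * 'I_n => fb ij.1 ij.2).
exists (\sum_ij `|b ij|) => x Px i j; apply: le_trans (bP (i, j) x Px) _.
rewrite lecR (bigD1 (i, j)) //=; apply: le_trans (ler_norm _) _.
by rewrite lerDl sumr_ge0.
Qed.

(** For [\det A = 1] the matrices [A^T *m A] and [A^T *m Lam *m A] represent the two conics with the
    fixed determinants 1 and [\det Lam]. [near_class_bounded] bounds both, and [diag_bounded] then
    bounds [A]. *)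
Lemma orbit_bounded (x : S) : exists M : R, \forall y \near x,
  forall A : 'M[C]_3, \det A = 1 -> orbit_point A = y -> forall i j, `|A i j| <= M%:C%C.
Proof.
have sv : continuous (set_val : S -> conic R * conic R) by exact: initial_continuous.
have cf := comp_continuous sv (@fst_continuous _ _).
have cs := comp_continuous sv (@snd_continuous _ _).
have [A0 dA0 A0x] := orbit_point_surj x.
have xE : set_val x = pair_at A0 by rewrite -A0x orbit_pointE.
have d1 : \det (Defs.proj_mx (set_val x).1) != 0.
  rewrite xE; apply/nondegenerateE; rewrite set_val_insubd; last exact/gram1_conic_mx/SL_unitmx.
  by rewrite det_mulmx det_tr dA0 mulr1 oner_neq0.
have d2 : \det (Defs.proj_mx (set_val x).2) != 0.
  rewrite xE; apply/nondegenerateE; rewrite set_val_insubd; last exact/gramL_conic_mx/SL_unitmx.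
  by rewrite !det_mulmx det_tr dA0 mulr1 mul1r det_diag_neq0.
have [M1 n1] := near_class_bounded conic_mx_neq0 d1 (oner_neq0 C).
have [M2 n2] := near_class_bounded conic_mx_neq0 d2 det_diag_neq0.
pose P := [set A : 'M[C]_3 | [/\ \det A = 1, forall i j, `|(A^T *m A) i j| <= M1%:C%C &
  forall i j, `|(A^T *m Lam *m A) i j| <= M2%:C%C]].
have [B hB] : exists B : R, forall A, P A -> forall i j, `|A i j| <= B%:C%C.
  apply: (@mx_bounded_unif _ P 3 3 id); apply: diag_bounded => [A []//|i j|i j].
    by exists M1 => A [_ h _].
  by exists M2 => A [_ _ h].
exists B; apply: filterS2 (cvg_nbhs (cf x) n1) (cvg_nbhs (cs x) n2) => y h1 h2 A dA Ay.
have yE : set_val y = pair_at A by rewrite -Ay orbit_pointE.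
apply: hB; split=> //.
  have := h1 (insubd one_conic (A^T *m A)); rewrite set_val_insubd; last exact/gram1_conic_mx/SL_unitmx.
  by apply; [rewrite yE|rewrite det_mulmx det_tr dA mulr1].
have := h2 (insubd one_conic (A^T *m Lam *m A)); rewrite set_val_insubd; last exact/gramL_conic_mx/SL_unitmx.
by apply; [rewrite yE|rewrite !det_mulmx det_tr dA mulr1 mul1r].
Qed.

Lemma orbit_covering (K : finType) (rho : K -> 'M[C]_3) :
  (forall k, \det (rho k) = 1) -> (forall k, rho k <> 1%:M -> \tr (rho k) <> 3%:R) ->
  (forall h, \det h = 1 -> stabilizes h <-> exists k, h = rho k) ->
  forall x : S, exists theta : pi1 R x -> 'M[C]_3,
  [/\ injective theta, forall a b, theta (a * b)%g = theta a *m theta b &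
      forall M, (exists a, theta a = M) <-> exists k, M = rho k].
Proof.
move=> det_rho tr_rho stab x; have [A0 dA0 <-] := orbit_point_surj x.
have fib (A B : 'M[C]_3) : \det A = 1 -> \det B = 1 ->
    orbit_point A = orbit_point B <-> exists k, B = rho k *m A.
  move=> dA dB; have dh : \det (B *m \adj A) = 1 by rewrite det_mulmx dB det_adj_SL ?mulr1.
  split=> [/(orbit_point_eq dA dB)/(pair_at_eq dA dB)/(stab _ dh)[k kE]|[k kE]].
    by exists k; rewrite -kE -mulmxA SL_adjK // mulmx1.
  apply/(orbit_point_eq dA dB)/(pair_at_eq dA dB)/(stab _ dh).
  by exists k; rewrite kE -mulmxA SL_mulK_adj // mulmx1.
exact: (covering_pi1 orbit_point_cts orbit_point_surj fib det_rho tr_rho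
  orbit_hausdorff orbit_bounded dA0).
Qed.

End DiagonalOrbit.

(** * Stabilizers of diagonal pairs *)

Lemma det_mx33 (K : comRingType) (M : 'M[K]_3) :
  let m i j := M (inord i) (inord j) in
  \det M = m 0%N 0%N * (m 1%N 1%N * m 2%N 2%N - m 1%N 2%N * m 2%N 1%N)
    - m 0%N 1%N * (m 1%N 0%N * m 2%N 2%N - m 1%N 2%N * m 2%N 0%N)
    + m 0%N 2%N * (m 1%N 0%N * m 2%N 1%N - m 1%N 1%N * m 2%N 0%N).
Proof.
move=> m.
have mE p q : M p q = m p q by rewrite /m !inord_val.
rewrite (expand_det_row _ ord0) !big_ord_recl big_ord0 /cofactor.
rewrite !(expand_det_row _ ord0) !big_ord_recl !big_ord0 /cofactor !det_mx11 !mxE !mE /=.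
rewrite /bump /= ?addn0 ?add0n ?addn1 /=; ring.
Qed.

(** * Monomial matrices indexed by signs, cube roots of unity and rotations *)

Section Monomial.
Variable R : realType.
Local Notation C := R[i].
Local Notation w := (omega R).

(** Addition in ['I_3] is modulo 3, so this is a diagonal matrix times the rotation of the indices
    by [m]. *)
Definition mono (m : 'I_3) (x : 'I_3 -> C) : 'M[C]_3 :=
  \matrix_(i, j) (x i *+ (i == j + m)).

Lemma mono_gram (d : 'rV[C]_3) m x :
  (mono m x)^T *m diag_mx d *m mono m x = diag_mx (\row_j (d 0 (j + m) * x (j + m) ^+ 2)).
Proof.
apply/matrixP => j k; rewrite gram_entry (bigD1 (j + m)) //= big1 => [|i ij].
  rewrite !mxE eqxx mulr1n addr0 (inj_eq (addIr m)) eq_sym.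
  by have [->|_] := eqVneq j k; rewrite ?mulr1n ?mulr0n ?mulr0 // expr2.
by rewrite !mxE (negbTE ij) mulr0n mul0r mulr0.
Qed.

(** Rotations of three indices are even permutations, hence no sign. *)
Lemma det_mono m x : \det (mono m x) = \prod_i x i.
Proof.
have eqE a b : (a < 3)%N -> (b < 3)%N ->
    (inord a == inord b + m :> 'I_3) = (a == (b + m) %% 3)%N.
  by move=> a3 b3; rewrite -val_eqE /= !inordK.
have o1 : lift ord0 ord0 = inord 1 :> 'I_3 by apply: val_inj; rewrite /= inordK.
have o2 : lift ord0 (lift ord0 ord0) = inord 2 :> 'I_3 by apply: val_inj; rewrite /= inordK.
have o0 : ord0 = inord 0 :> 'I_3 by apply: val_inj; rewrite /= inordK.
rewrite det_mx33 !mxE !eqE // !big_ord_recl big_ord0 o2 o1 o0.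
by case: m {eqE} => [[|[|[|//]]] m3] /=; rewrite !(mulr0n, mulr1n); ring.
Qed.

Lemma tr_mono m x : m != 0 -> \tr (mono m x) = 0.
Proof.
move=> m0; apply: big1 => i _; rewrite mxE -[X in X == _]addr0 (inj_eq (addrI i)) eq_sym.
by rewrite (negbTE m0).
Qed.

(** The third sign is the product of the first two, which forces determinant 1 and leaves a Klein
    four-group. *)
Definition sgn3 (a b : 'Z_2) (i : 'I_3) : C :=
  [:: (-1) ^+ a; (-1) ^+ b; (-1) ^+ a * (-1) ^+ b]`_i.

(** There are 4 sign patterns, 3 scalars and 3 rotations, 36 indices in all; the 12 with rotation 0
    serve the standard orbits. *)
Definition stab_mx (t : 'Z_2 * 'Z_2 * 'Z_3 * 'I_3) : 'M[C]_3 :=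
  mono t.2 (fun i => w ^+ t.1.2 * sgn3 t.1.1.1 t.1.1.2 i).

Lemma sgn3_sqr a b i : sgn3 a b i ^+ 2 = 1.
Proof.
by case: i => [[|[|[|//]]] ?]; rewrite /sgn3 /= ?exprMn !sqrr_sign ?mulr1.
Qed.

Lemma det_stab_mx t : \det (stab_mx t) = 1.
Proof.
case: t => [[[a b] k] m]; rewrite /stab_mx det_mono /= !big_ord_recl big_ord0 /sgn3 /=.
have a2 : ((-1) ^+ a : C) ^+ 2 = 1 by exact: sqrr_sign.
have b2 : ((-1) ^+ b : C) ^+ 2 = 1 by exact: sqrr_sign.
have k3 : (w ^+ k) ^+ 3 = 1 by rewrite -exprM mulnC exprM omega3 expr1n.
rewrite mulr1 (_ : _ * _ = (w ^+ k) ^+ 3 * (((-1) ^+ a) ^+ 2 * ((-1) ^+ b) ^+ 2)); last by ring.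
by rewrite a2 b2 k3 !mulr1.
Qed.

(** Squaring the product gives [c ^+ 3 = 1], so [c] has a square root that is a power of [w]. Each
    [x i] is this root up to sign, and the product condition determines the third sign. *)
Lemma stab_mx_coords (x : 'I_3 -> C) (c : C) : (forall i, x i ^+ 2 = c) -> \prod_i x i = 1 ->
  exists a b k, x =1 (fun i => w ^+ (k : 'Z_3) * sgn3 a b i).
Proof.
move=> x2 px.
have c3 : c ^+ 3 = 1.
  by rewrite -(expr1n C 2) -px -prodrXl (eq_bigr (fun=> c)) // prodr_const card_ord.
have c0 : c != 0 by apply/eqP => c0; move/eqP: c3; rewrite c0 expr0n eq_sym oner_eq0.
(* The required root is [c ^+ 2], whose square is [c ^+ 4 = c]. *)
have c6 : (c ^+ 2) ^+ 3 = 1 by rewrite exprAC c3 expr1n.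
have [k kE] := cube_root1 c6.
have xE i : x i = w ^+ k \/ x i = - w ^+ k.
  have : x i ^+ 2 == (w ^+ k) ^+ 2 by rewrite x2 -kE -exprM (_ : (2 * 2)%N = (1 + 3)%N) // exprD c3 mulr1.
  by rewrite eqf_sqr => /orP[]/eqP ->; [left|right].
have xS i : exists a : 'Z_2, x i = w ^+ k * (-1) ^+ a.
  case: (xE i) => ->; first by exists 0; rewrite mulr1.
  by exists 1; rewrite mulrN1.
have [a aE] := xS 0; have [b bE] := xS 1.
pose i2 := lift ord0 (lift ord0 ord0) : 'I_3.
have o1 : lift ord0 ord0 = 1 :> 'I_3 by apply: val_inj.
have k3 : (w ^+ k) ^+ 3 = 1 by rewrite -exprM mulnC exprM omega3 expr1n.
have x2E : x i2 = w ^+ k * ((-1) ^+ a * (-1) ^+ b).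
  have x01 : w ^+ k * (-1) ^+ a * (w ^+ k * (-1) ^+ b) != 0.
    by rewrite !mulf_neq0 ?signr_eq0 ?expf_neq0 ?omega_neq0.
  have P : x 0 * x 1 * x i2 = 1.
    by move: px; rewrite !big_ord_recl big_ord0 mulr1 o1 -/i2 mulrA.
  have a2 : ((-1) ^+ a : C) ^+ 2 = 1 by exact: sqrr_sign.
  have b2 : ((-1) ^+ b : C) ^+ 2 = 1 by exact: sqrr_sign.
  apply: (mulfI x01); move: P; rewrite aE bE => ->.
  transitivity ((w ^+ k) ^+ 3 * (((-1) ^+ a) ^+ 2 * ((-1) ^+ b) ^+ 2) : C); last by ring.
  by rewrite a2 b2 k3 !mulr1.
exists a, b, k => -[[|[|[|//]]] i3]; rewrite /sgn3 /=.
- by rewrite -aE; congr x; apply: val_inj.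
- by rewrite -bE; congr x; apply: val_inj.
- by rewrite -x2E; congr x; apply: val_inj.
Qed.

(** A rotation has trace 0. Otherwise the trace is [w ^+ k] times 3 or -1: in the second case trace
    3 would give 27 = -1 after cubing, in the first it gives the identity. *)
Lemma tr_stab_mx t : stab_mx t <> 1%:M -> \tr (stab_mx t) <> 3%:R.
Proof.
case: t => [[[a b] k] m]; rewrite /stab_mx /=.
have [->|m0] := eqVneq m 0; last by move=> _; rewrite tr_mono // => /eqP; rewrite eq_sym pnatr_eq0.
have k3 : (w ^+ k) ^+ 3 = 1 by rewrite -exprM mulnC exprM omega3 expr1n.
have trE : \tr (mono 0 (fun i => w ^+ k * sgn3 a b i)) =
    w ^+ k * ((-1) ^+ a + (-1) ^+ b + (-1) ^+ a * (-1) ^+ b).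
  rewrite /mxtrace !big_ord_recl big_ord0 !mxE !addr0 !eqxx !mulr1n /sgn3 /=; ring.
have h27 : (3%:R : C) ^+ 3 != -1.
  by rewrite -subr_eq0 opprK -natrX natr1 pnatr_eq0.
have neg : w ^+ k * -1 <> 3%:R.
  by move=> E; move/eqP: h27; apply; rewrite -E exprMn k3 mul1r; ring.
move=> nt; rewrite trE; case: a b nt {trE} => [[|[|//]] ?] [[|[|//]] ?] nt /= E.
- apply: nt; have k1 : w ^+ k = 1.
    by apply: (mulIf (_ : 3%:R != 0 :> C)); rewrite ?pnatr_eq0 // mul1r -[RHS]E; ring.
  apply/matrixP => i j; rewrite !mxE addr0 k1 mul1r.
  by case: i => [[|[|[|//]]] ?]; rewrite /sgn3 /= ?mulr1.
- by apply: neg; rewrite -[RHS]E; ring.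
- by apply: neg; rewrite -[RHS]E; ring.
- by apply: neg; rewrite -[RHS]E; ring.
Qed.

Lemma mono_inj m m' x x' : (forall i, x i != 0) -> mono m x = mono m' x' -> m = m' /\ x =1 x'.
Proof.
move=> x0 /matrixP E; have mm : m = m'.
  have := E m 0; rewrite !mxE !add0r eqxx mulr1n => xE; apply/eqP.
  by apply: contraTT (x0 m) => /negbTE mm; rewrite xE mm mulr0n eqxx.
by split=> // i; have := E i (i - m); rewrite !mxE -mm subrK eqxx !mulr1n.
Qed.

Lemma stab_mx_inj : injective stab_mx.
Proof.
move=> [[[a b] k] m] [[[a' b'] k'] m'] /mono_inj[i|/= -> xE].
  have : sgn3 a b i ^+ 2 != 0 by rewrite sgn3_sqr oner_neq0.
  by rewrite expf_eq0 /= => s0; rewrite mulf_neq0 // expf_neq0 // omega_neq0.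
(* Fourth powers erase the signs and leave powers of [w] unchanged, which separates [k] from [a] and
   [b]. *)
have e4 (l : 'Z_3) : (w ^+ l) ^+ 4 = w ^+ l.
  by rewrite exprS -exprM mulnC exprM omega3 expr1n mulr1.
have kk : k = k'.
  apply: (@omega_expI R) => /=; rewrite -[LHS]e4 -[RHS]e4.
  have := congr1 (fun z : C => z ^+ 4) (xE 0); rewrite !exprMn.
  by rewrite !(exprM _ 2 2) !sgn3_sqr !expr1n !mulr1.
have sE i : sgn3 a b i = sgn3 a' b' i.
  by have := xE i; rewrite kk; apply: mulfI; rewrite expf_neq0 // omega_neq0.
have n1 : (-1 : C) <> 1 by move/eqP; rewrite eq_sym -subr_eq0 opprK -(natrD _ 1 1) pnatr_eq0.
have sI (c c' : 'Z_2) : (-1) ^+ c = (-1) ^+ c' :> C -> c = c'.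
  case: c c' => [[|[|//]] ?] [[|[|//]] ?] /=; rewrite ?expr0 ?expr1 => E; try exact: val_inj.
  by case: n1; exact: esym.
by rewrite kk (sI _ _ (sE 0)) (sI _ _ (sE 1)).
Qed.

Lemma sgn3_mul (a b a' b' : 'Z_2) i : sgn3 (a * a')%g (b * b')%g i = sgn3 a b i * sgn3 a' b' i.
Proof.
have E (c c' : 'Z_2) : (-1) ^+ (c * c')%g = (-1) ^+ c * (-1) ^+ c' :> C.
  by rewrite -exprD -[LHS]signr_odd -[RHS]signr_odd /= modn2 oddb.
by case: i => [[|[|[|//]]] ?]; rewrite /sgn3 /= !E; ring.
Qed.

Lemma mono0_mul x y : mono 0 x *m mono 0 y = mono 0 (fun i => x i * y i).
Proof.
apply/matrixP => i j; rewrite !mxE (bigD1 i) //= big1 => [|k ki].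
  by rewrite !mxE !addr0 eqxx mulr1n mulrnAr.
by rewrite !mxE addr0 eq_sym (negbTE ki) mulr0n mul0r.
Qed.

End Monomial.

Local Open Scope card_scope.

Lemma card_eq_through (T U : Type) (K : finType) (theta : T -> U) (rho : K -> U) :
  injective theta -> injective rho ->
  (forall M, (exists a, theta a = M) <-> exists k, M = rho k) -> [set: T] #= `I_#|K|.
Proof.
move=> thI rhoI im.
have h1 : theta @` [set: T] #= [set: T] by apply: inj_card_eq => x y _ _; exact: thI.
have h2 : rho @` [set: K] #= [set: K] by apply: inj_card_eq => x y _ _; exact: rhoI.
have h3 : @enum_rank K @` [set: K] #= [set: K].
  by apply: inj_card_eq => x y _ _; exact: enum_rank_inj.
have e1 : theta @` [set: T] = rho @` [set: K].
  apply/seteqP; split=> [_ [a _ <-]|_ [k _ <-]].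
    by have [k ->] := (im (theta a)).1 (ex_intro _ a erefl); exists k.
  by have [a aE] := (im (rho k)).2 (ex_intro _ k erefl); exists a.
have e2 : @enum_rank K @` [set: K] = [set: 'I_#|K|].
  by apply/seteqP; split=> // i _; exists (enum_val i) => //; exact: enum_valK.
rewrite card_eq_sym in h1; apply: (card_eq_trans h1); rewrite e1.
apply: (card_eq_trans h2); rewrite card_eq_sym in h3; apply: (card_eq_trans h3).
by rewrite e2 card_eq_sym; exact: card_II.
Qed.

(** * Stabilizers and fundamental groups of diagonal orbits *)

Section Stabilizers.
Variable R : realType.
Local Notation C := R[i].
Local Notation w := (omega R).

Lemma stab_of_support (h : 'M[C]_3) (c : C) (m : 'I_3) : \det h = 1 -> h^T *m h = c%:M ->
  (forall i j, i != j + m -> h i j = 0) -> exists t, h = stab_mx R (t, m).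
Proof.
move=> dh hh sup; pose x i := h i (i - m).
have hE : h = mono m x.
  apply/matrixP => i j; rewrite mxE /x; have [->|ij] := eqVneq i (j + m).
    by rewrite mulr1n addrK.
  by rewrite mulr0n sup.
have x2 i : x i ^+ 2 = c.
  have := mono_gram (const_mx 1) m x; rewrite diag_const_mx mulmx1 -hE hh.
  move/matrixP/(_ (i - m) (i - m)); rewrite !mxE eqxx !mulr1n subrK mul1r.
  by move=> <-.
have [|a [b [k xE]]] := stab_mx_coords x2; first by rewrite -(det_mono m) -hE.
by exists (a, b, k); rewrite hE /stab_mx /=; congr mono; exact/funext.
Qed.

Lemma stab_mx_stabilizes (l : 'rV[C]_3) t (e : C) : e != 0 ->
  (forall j, l 0 (j + t.2) = e * l 0 j) -> stabilizes l (stab_mx R t).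
Proof.
case: t => [[[a b] k] m] e0 /= lE.
have wk : (w ^+ k) ^+ 2 != 0 by rewrite !expf_neq0 // omega_neq0.
have x2 i : (w ^+ k * sgn3 R a b i) ^+ 2 = (w ^+ k) ^+ 2 by rewrite exprMn sgn3_sqr mulr1.
split.
  exists ((w ^+ k) ^+ 2) => //; rewrite -diag_const_mx -[X in X *m _]mulmx1 -[1%:M]diag_const_mx mono_gram.
  by congr diag_mx; apply/rowP => j; rewrite !mxE mul1r x2.
exists ((w ^+ k) ^+ 2 * e); first by rewrite mulf_neq0.
rewrite mono_gram; apply/matrixP => i j; rewrite !mxE x2 lE mulrnAr; congr (_ *+ _).
by rewrite mulrC mulrA.
Qed.

(** Multiply [h^T L h = d L] by [h] on the left and use [h h^T = c]; then [mu = d / c], and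
    determinants show that [c] and [d] are cube roots of unity. *)
Lemma stabilizes_intertwines (l : 'rV[C]_3) (h : 'M[C]_3) : (forall i, l 0 i != 0) ->
  \det h = 1 -> stabilizes l h ->
  exists c mu : C, [/\ h^T *m h = c%:M, mu ^+ 3 = 1 & forall i j, l 0 i * h i j = mu * (h i j * l 0 j)].
Proof.
move=> l0 dh [[c c0 hc] [d d0 hd]].
have dL : \det (diag_mx l) != 0 by exact: det_diag_neq0.
have c3 : c ^+ 3 = 1 by have := congr1 determinant hc; rewrite det_mulmx det_tr dh det_scalar mulr1.
have d3 : d ^+ 3 = 1.
  have := congr1 determinant hd; rewrite !det_mulmx det_tr dh detZ mul1r mulr1 => E.
  by apply: (mulIf dL); rewrite mul1r -E.
exists c, (c^-1 * d); split=> //; first by rewrite exprMn exprVn c3 d3 invr1 mulr1.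
have hhT : h *m h^T = c%:M.
  have : (c^-1 *: h^T) *m h = 1%:M by rewrite -scalemxAl hc scale_scalar_mx mulVf.
  move/mulmx1C; rewrite -scalemxAr => /(congr1 (fun M => c *: M)).
  by rewrite scalerA divff // scale1r scalemx1.
have : c *: (diag_mx l *m h) = d *: (h *m diag_mx l).
  by rewrite [RHS]scalemxAr -hd !mulmxA hhT mul_scalar_mx -scalemxAl.
rewrite mul_diag_mx mul_mx_diag => /matrixP E i j; have := E i j; rewrite !mxE => e.
by apply: (mulfI c0); rewrite e !mulrA divff // mul1r.
Qed.

Lemma row_support (h : 'M[C]_3) i : \det h = 1 -> exists j, h i j != 0.
Proof.
move=> dh; apply: contrapT => nj.
have h0 : row i h = 0.
  apply/rowP => j; rewrite !mxE; apply/eqP/negPn/negP => hj; apply: nj; by exists j.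
have := congr1 (mulmx^~ (\adj h)) h0; rewrite rowE -mulmxA SL_mulK_adj // mulmx1 mul0mx.
by move/rowP/(_ i)/eqP; rewrite !mxE !eqxx oner_eq0.
Qed.

(** Every row of [h] has a non-zero entry, so multiplication by [mu] relates each [l_i] to some
    [l_j], and the third hypothesis gives [mu = 1]. A non-zero [h i j] then forces [l_i = l_j], so
    [h] is diagonal. *)
Lemma standard_stabilizer (l : 'rV[C]_3) (h : 'M[C]_3) :
  (forall i, l 0 i != 0) -> injective (l 0) ->
  (forall mu : C, mu ^+ 3 = 1 -> (forall i, exists j, l 0 i = mu * l 0 j) -> mu = 1) ->
  \det h = 1 -> stabilizes l h <-> exists t, h = stab_mx R (t, 0).
Proof.
move=> l0 lI norot dh; split=> [/(stabilizes_intertwines l0 dh)[c [mu [hc mu3 hE]]]|[t ->]].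
  have mu1 : mu = 1.
    apply: norot => // i; have [j hij] := row_support i dh.
    by exists j; apply: (mulIf hij); rewrite hE mulrA mulrAC.
  apply: (stab_of_support dh hc) => i j; rewrite addr0 => ij.
  apply/eqP; apply: contraTT ij => hij; rewrite negbK; apply/eqP/lI.
  by apply: (mulIf hij); rewrite hE mu1 mul1r mulrC.
by apply: (@stab_mx_stabilizes _ _ 1) => [|j /=]; rewrite ?oner_neq0 // addr0 mul1r.
Qed.

Definition omega_row : 'rV[C]_3 := \row_j [:: 1; w; w ^+ 2]`_j.

Lemma omega_rowE i : omega_row 0 i = w ^+ i.
Proof. by rewrite mxE; case: i => [[|[|[|//]]] ?]. Qed.

Lemma omega_rowD i m : omega_row 0 (i + m) = w ^+ m * omega_row 0 i.
Proof. by rewrite !omega_rowE /= expr_mod ?omega3 // exprD mulrC. Qed.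

Lemma omega_row_neq0 i : omega_row 0 i != 0.
Proof. by rewrite omega_rowE expf_neq0 // omega_neq0. Qed.

Lemma omega_row_inj : injective (omega_row 0).
Proof. by move=> i j; rewrite !omega_rowE; exact: omega_expI. Qed.

(** Here [mu = w ^+ m] shifts the entries of [omega_row] by [m], so [h i j] vanishes unless
    [i = j + m]. *)
Lemma special_stabilizer (h : 'M[C]_3) : \det h = 1 ->
  stabilizes omega_row h <-> exists t, h = stab_mx R t.
Proof.
move=> dh; split=> [/(stabilizes_intertwines omega_row_neq0 dh)[c [mu [hc mu3 hE]]]|[t ->]].
  have [m mE] := cube_root1 mu3.
  have [|t tE] := stab_of_support dh hc (m := m); last by exists (t, m).
  move=> i j ij; apply/eqP; apply: contraTT ij => hij; rewrite negbK; apply/eqP/omega_row_inj.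
  by apply: (mulIf hij); rewrite hE omega_rowD mE; ring.
by apply: (@stab_mx_stabilizes _ _ (w ^+ t.2)); [rewrite expf_neq0 // omega_neq0|by move=> j; rewrite omega_rowD].
Qed.

Lemma special_orbitE : special_orbit R = Defs.orbit (diag_pair omega_row_neq0).
Proof.
rewrite /special_orbit; congr Defs.orbit; congr (_, _); apply/proj_classP.
by exists 1; rewrite ?oner_neq0 // scale1r.
Qed.

Lemma special_pi1 (x : special_orbit R) : [set: pi1 R x] #= `I_36.
Proof.
move: x; rewrite special_orbitE => x.
have [theta [thI thM im]] := orbit_covering omega_row_inj (@det_stab_mx R) (@tr_stab_mx R)
  special_stabilizer x.
have := card_eq_through thI (@stab_mx_inj R) im.
by rewrite !card_prod !card_ord.
Qed.

Lemma diag_standard_pi1 (l : 'rV[C]_3) (l0 : forall i, l 0 i != 0) : injective (l 0) ->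
  (forall mu : C, mu ^+ 3 = 1 -> (forall i, exists j, l 0 i = mu * l 0 j) -> mu = 1) ->
  forall x : Defs.orbit (diag_pair l0), [set: pi1 R x] #= `I_12 /\
    isomorphic_groups (pi1 R x) (klein4 * 'Z_3)%type.
Proof.
move=> lI norot x; pose rho (t : 'Z_2 * 'Z_2 * 'Z_3) := stab_mx R (t, 0).
have rhoI : injective rho by move=> s t /stab_mx_inj[].
have [theta [thI thM im]] := orbit_covering lI (fun t => det_stab_mx R (t, 0))
  (fun t => @tr_stab_mx R (t, 0)) (fun h dh => standard_stabilizer l0 lI norot dh) x.
split; first by have := card_eq_through thI rhoI im; rewrite !card_prod !card_ord.
apply: (@isomorphic_through _ (klein4 * 'Z_3)%type _ mulmx theta rho) => // -[[a b] k] [[a' b'] k'].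
rewrite /rho /stab_mx /= mono0_mul; congr mono; apply/funext => i.
by rewrite sgn3_mul omega_expD; ring.
Qed.

End Stabilizers.

(** * Comparing orbits by congruence *)

Section OrbitCongruence.
Variable R : realType.
Local Notation C := R[i].
Local Notation w := (omega R).
Local Notation cl := (proj_at (one_conic R)).

Lemma orbitE (M N : 'M[C]_3) y : conic_mx M -> conic_mx N ->
  Defs.orbit (cl M, cl N) y <->
  exists2 A : 'M[C]_3, A \in unitmx & y = (cl (A^T *m M *m A), cl (A^T *m N *m A)).
Proof.
move=> cM cN.
have E (A : [set A : 'M[C]_3 | A \in unitmx]) (P : 'M[C]_3) : conic_mx P ->
    congruence (proj_class A) (cl P) = cl ((set_val A)^T *m P *m set_val A).
  move=> cP; apply: congruenceE; rewrite !set_val_insubd //.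
  exact: (gram_conic_mx (set_valP A)).
split=> [[a _ <-]|[A uA ->]].
  have [A [<- _]] := proj_class_mx a; exists (set_val A); first exact: (set_valP A).
  by rewrite !E.
exists (proj_class (insubd (PGL3_one R) A)) => //.
by rewrite !E // !set_val_insubd.
Qed.

Lemma cl_scale (M N : 'M[C]_3) c : conic_mx M -> conic_mx N -> c != 0 -> N = c *: M -> cl M = cl N.
Proof. by move=> cM cN c0 NE; apply/proj_atP => //; exists c. Qed.

Lemma orbit_congr_sub (M N M' N' B : 'M[C]_3) (a b : C) : conic_mx M -> conic_mx N ->
  conic_mx M' -> conic_mx N' -> B \in unitmx -> a != 0 -> b != 0 ->
  M' = a *: (B^T *m M *m B) -> N' = b *: (B^T *m N *m B) ->
  Defs.orbit (cl M', cl N') `<=` Defs.orbit (cl M, cl N).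
Proof.
move=> cM cN cM' cN' uB a0 b0 ME NE y /(orbitE _ cM' cN')[A uA ->].
have uBA : B *m A \in unitmx by rewrite unitmx_mul uB uA.
have key (P Q : 'M[C]_3) (c : C) : conic_mx P -> conic_mx Q -> c != 0 -> Q = c *: (B^T *m P *m B) ->
    cl (A^T *m Q *m A) = cl ((B *m A)^T *m P *m (B *m A)).
  move=> cP cQ c0 QE; apply/esym; apply: (@cl_scale _ _ c) => //.
  - exact: gram_conic_mx.
  - exact: gram_conic_mx.
  - by rewrite QE trmx_mul -scalemxAr -scalemxAl !mulmxA.
apply/(orbitE _ cM cN); exists (B *m A) => //.
by rewrite (key M M' a) // (key N N' b).
Qed.

Lemma orbit_congr (M N M' N' B : 'M[C]_3) (a b : C) : conic_mx M -> conic_mx N ->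
  B \in unitmx -> a != 0 -> b != 0 ->
  M' = a *: (B^T *m M *m B) -> N' = b *: (B^T *m N *m B) ->
  Defs.orbit (cl M, cl N) = Defs.orbit (cl M', cl N').
Proof.
move=> cM cN uB a0 b0 ME NE.
have scale_conic (P : 'M[C]_3) (c : C) : conic_mx P -> c != 0 -> conic_mx (c *: (B^T *m P *m B)).
  move=> cP c0; have [sP P0] := gram_conic_mx uB cP; split; first by rewrite linearZ /= sP.
  by rewrite scaler_eq0 negb_or c0.
have cM' : conic_mx M' by rewrite ME; exact: scale_conic.
have cN' : conic_mx N' by rewrite NE; exact: scale_conic.
have inv (P Q : 'M[C]_3) (c : C) : c != 0 -> Q = c *: (B^T *m P *m B) ->
    P = c^-1 *: ((invmx B)^T *m Q *m invmx B).
  move=> c0 ->; rewrite -scalemxAr -scalemxAl scalerA mulVf // scale1r !mulmxA -trmx_mul.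
  by rewrite mulmxV // trmx1 mul1mx mulmxK.
apply/seteqP; split; last exact: (orbit_congr_sub cM cN cM' cN' uB a0 b0).
by apply: (orbit_congr_sub cM' cN' cM cN (B := invmx B) (a := a^-1) (b := b^-1));
  rewrite ?unitmx_inv ?invr_eq0 //; exact: inv.
Qed.

Lemma diag_pairE (l : 'rV[C]_3) (l0 : forall i, l 0 i != 0) :
  diag_pair l0 = (cl 1%:M, cl (diag_mx l)).
Proof.
rewrite /diag_pair; congr (_, _); apply/proj_classP; exists 1; rewrite ?oner_neq0 // scale1r
  set_val_insubd //; apply: set_mem; [exact: id_conic_mx|exact: diag_conic_mx].
Qed.

(** Congruence by the permutation matrix of [s] reorders the diagonal, and [e] is absorbed in the
    projective scalar of the second conic. *)
Lemma reindex_orbit (l l' : 'rV[C]_3) (l0 : forall i, l 0 i != 0) (l0' : forall i, l' 0 i != 0)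
    (s : 'I_3 -> 'I_3) (e : C) : injective s -> e != 0 -> (forall i, l 0 (s i) = e * l' 0 i) ->
  Defs.orbit (diag_pair l0) = Defs.orbit (diag_pair l0').
Proof.
move=> sI e0 lE; pose B : 'M[C]_3 := \matrix_(i, j) (i == s j)%:R.
have gram (d : 'rV[C]_3) : B^T *m diag_mx d *m B = diag_mx (\row_j d 0 (s j)).
  apply/matrixP => j k; rewrite gram_entry (bigD1 (s j)) //= big1 => [|i ij].
    by rewrite !mxE eqxx addr0 (inj_eq sI) mul1r mulr_natr.
  by rewrite !mxE (negbTE ij) mul0r mulr0.
have BB : B^T *m B = 1%:M.
  have := gram (const_mx 1); rewrite diag_const_mx mulmx1 => ->.
  by rewrite -diag_const_mx; congr diag_mx; apply/rowP => j; rewrite !mxE.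
have uB : B \in unitmx by have [] := mulmx1_unit BB.
rewrite !diag_pairE; apply: (@orbit_congr _ _ _ _ B 1 e^-1) => //; rewrite ?oner_neq0 ?invr_eq0 //.
- exact: set_mem (@id_conic_mx R).
- exact: set_mem (diag_conic_mx l0).
- by rewrite scale1r mulmx1.
- by rewrite gram; apply/matrixP => i j; rewrite !mxE lE mulrnAr mulrA mulVf // mul1r.
Qed.

(** Dividing repeatedly by [mu] stays among the entries of [l]. The powers of [mu^-1] include all
    powers of [w], so the entries are [l_0] times the cube roots of unity in some order. *)
Lemma rotation_special (l : 'rV[C]_3) (l0 : forall i, l 0 i != 0) (mu : C) :
  mu ^+ 3 = 1 -> mu != 1 -> (forall i, exists j, l 0 i = mu * l 0 j) ->
  Defs.orbit (diag_pair l0) = special_orbit R.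
Proof.
move=> mu3 mu1 rot; have mu0 : mu != 0.
  by apply/eqP => m0; move/eqP: mu3; rewrite m0 expr0n eq_sym oner_eq0.
have step n : exists j, l 0 j = (mu^-1) ^+ n * l 0 0.
  elim: n => [|n [j jE]]; first by exists 0; rewrite mul1r.
  have [k kE] := rot j; exists k.
  by apply: (mulfI mu0); rewrite -kE jE exprS !mulrA divff // mul1r.
have pw (i : 'I_3) : exists n, w ^+ i = mu^-1 ^+ n.
  have [k kE] := cube_root1 mu3.
  case: k kE mu1 => [[|[|[|//]]] k3] /= -> mu1; first by rewrite eqxx in mu1.
    (* If [mu = w] then [mu^-1 = w ^+ 2], and the exponent is doubled to recover [w]; if
       [mu = w ^+ 2] then [mu^-1] is already [w]. *)
    exists (2 * i)%N; rewrite exprVn exprM -exprVn; congr (_ ^+ _).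
    by apply: (mulIf (_ : w ^+ 1 ^+ 2 != 0)); rewrite ?expf_neq0 ?omega_neq0 // mulVf ?expf_neq0 ?omega_neq0 // -exprM -exprS omega3.
  exists i; congr (_ ^+ _).
  by apply: (mulIf (_ : w ^+ 2 != 0)); rewrite ?expf_neq0 ?omega_neq0 // mulVf ?expf_neq0 ?omega_neq0 // -exprS omega3.
have ex (i : 'I_3) : exists j, l 0 j = w ^+ i * l 0 0.
  by have [n ->] := pw i; exact: step.
have [s sE] := choice ex.
rewrite special_orbitE; apply: (@reindex_orbit _ _ _ _ s (l 0 0)) => // [i j ij|i].
  by apply: (@omega_expI R); apply: (mulIf (l0 0)); rewrite -!sE ij.
by rewrite sE omega_rowE mulrC.
Qed.

Lemma diag_orbit_pi1 (l : 'rV[C]_3) (l0 : forall i, l 0 i != 0) : injective (l 0) ->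
  Defs.orbit (diag_pair l0) <> special_orbit R ->
  forall x : Defs.orbit (diag_pair l0), [set: pi1 R x] #= `I_12 /\
    isomorphic_groups (pi1 R x) (klein4 * 'Z_3)%type.
Proof.
move=> lI ns; apply: diag_standard_pi1 => // mu mu3 rot.
by apply/eqP/negPn/negP => mu1; apply: ns; exact: rotation_special rot.
Qed.

End OrbitCongruence.

(** * Diagonalization of transverse pairs *)

Section QuadraticForms.
Variable K : numFieldType.

Definition bform (M : 'M[K]_3) (u v : 'cV[K]_3) : K := (u^T *m M *m v) 0 0.

Lemma bformDr M u v v' : bform M u (v + v') = bform M u v + bform M u v'.
Proof. by rewrite /bform mulmxDr mxE. Qed.

Lemma bformZr M u c v : bform M u (c *: v) = c * bform M u v.
Proof. by rewrite /bform -scalemxAr mxE. Qed.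

Lemma bformC M u v : M^T = M -> bform M u v = bform M v u.
Proof.
move=> sM; rewrite /bform -[in RHS](trmxK (v^T *m M *m u)) [RHS]mxE.
by rewrite !trmx_mul trmxK sM mulmxA.
Qed.

Definition indep2 (u v : 'cV[K]_3) := forall a b : K, a *: u + b *: v = 0 -> a = 0 /\ b = 0.

(* The Gram matrix of a basis of an isotropic plane would vanish, but an
   isotropic subspace of a nondegenerate form has at most half the dimension. *)
Lemma no_isotropic_plane (M : 'M[K]_3) u v : M^T = M -> \det M != 0 -> indep2 u v ->
  bform M u u = 0 -> bform M v v = 0 -> bform M u v != 0.
Proof.
move=> sM dM uv uu vv; apply/eqP => uv0.
pose U : 'M[K]_(3, 1 + 1) := row_mx u v.
have z (x y : 'cV[K]_3) : bform M x y = 0 -> x^T *m M *m y = 0.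
  by move=> xy; rewrite [LHS]mx11_scalar -/(bform M x y) xy raddf0.
have UMU : U^T *m M *m U = 0.
  rewrite /U tr_row_mx mul_col_mx mul_col_mx !mul_mx_row !z //; last by rewrite bformC.
  by rewrite !row_mx0 col_mx0.
have rU : \rank U^T = 2%N.
  apply/eqP; rewrite -[_ == _]/(row_free U^T) -kermx_eq0; apply/rowV0P => a /sub_kermxP aU.
  have aE : a = row_mx (lsubmx (a : 'rV_(1 + 1))) (rsubmx (a : 'rV_(1 + 1))) by rewrite hsubmxK.
  move: aU; rewrite aE /U tr_row_mx mul_row_col [lsubmx _]mx11_scalar [rsubmx _]mx11_scalar.
  rewrite !mul_scalar_mx => /(congr1 trmx); rewrite linearD !linearZ /= !trmxK trmx0 => /uv[-> ->].
  by rewrite !raddf0 row_mx0.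
have := mulmx0_rank_max UMU; rewrite mxrankMfree ?row_free_unit ?unitmxE ?unitfE //.
by rewrite -(mxrank_tr U) rU.
Qed.

(** A line meets a smooth conic in at most two points: if [x] is in the span of [u] and [v],
    isotropy gives [2 a b B(u, v) = 0] with [B(u, v)] non-zero, and pairwise independence
    finishes. *)
Lemma isotropic_indep3 (M : 'M[K]_3) u v x a b c : M^T = M -> \det M != 0 ->
  indep2 u v -> indep2 u x -> indep2 v x ->
  bform M u u = 0 -> bform M v v = 0 -> bform M x x = 0 ->
  a *: u + b *: v + c *: x = 0 -> c = 0.
Proof.
move=> sM dM uv ux vx uu vv xx abc; apply/eqP/negPn/negP => c0.
have xE : c *: x = (- a) *: u + (- b) *: v.
  by apply/eqP; rewrite -subr_eq0 !scaleNr opprD !opprK addrC abc.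
have uvn := no_isotropic_plane sM dM uv uu vv.
have : bform M (c *: x) (c *: x) = 0.
  by rewrite bformZr bformC // bformZr xx !mulr0.
rewrite {2}xE bformDr !bformZr !(bformC (c *: x)) // xE !bformDr !bformZr uu vv (bformC v u) //.
rewrite !mulr0 add0r addr0 => E.
have : a * b * bform M u v = 0.
  have -> : a * b * bform M u v = 2^-1 * (- a * (- b * bform M u v) + - b * (- a * bform M u v)) by field.
  by rewrite E mulr0.
move/eqP; rewrite !mulf_eq0 (negbTE uvn) orbF => /orP[/eqP a0|/eqP b0].
  by have := abc; rewrite a0 scale0r add0r => /vx[_ /eqP]; rewrite (negbTE c0).
by have := abc; rewrite b0 scale0r addr0 => /ux[_ /eqP]; rewrite (negbTE c0).
Qed.

Lemma gram_bform (Q A : 'M[K]_3) i j : (A^T *m Q *m A) i j = bform Q (col i A) (col j A).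
Proof.
rewrite /bform mxE [RHS]mxE; apply: eq_bigr => k _; congr (_ * _); last by rewrite mxE.
by rewrite mxE [RHS]mxE; apply: eq_bigr => l _; rewrite !mxE.
Qed.

Definition frame_change : 'M[K]_3 := \matrix_(i, j) (i != j)%:R.

Lemma frame_change_unit : frame_change \in unitmx.
Proof.
by rewrite unitmxE unitfE det_mx33 !mxE -!val_eqE /= !inordK //=.
Qed.

(* The columns of frame_change form a basis in which the frame e_1, e_2, e_3,
   (1 : 1 : 1) becomes (-1 : 1 : 1), (1 : -1 : 1), (1 : 1 : -1), (1 : 1 : 1); X is
   the Gram matrix of a conic through the four points of the frame. *)
Lemma gram_frame_change (X : 'M[K]_3) : X^T = X -> (forall i, X i i = 0) -> \sum_i \sum_j X i j = 0 ->
  exists2 q : 'rV[K]_3, frame_change^T *m X *m frame_change = diag_mx q & \sum_i q 0 i = 0.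
Proof.
move=> sX X0 Xsum; pose x i j := X (inord i) (inord j).
have XE p q : X p q = x p q by rewrite /x !inord_val.
have xs i j : x i j = x j i by rewrite /x -{1}sX mxE.
have x0 i : x i i = 0 by exact: X0.
have x12 : x 1%N 2%N = - x 0%N 1%N - x 0%N 2%N.
  move: Xsum; rewrite !big_ord_recl !big_ord0 !XE /= /bump /= ?addn0 ?add0n ?addn1.
  rewrite !x0 (xs 1%N 0%N) (xs 2%N 0%N) (xs 2%N 1%N) => E.
  apply: (mulfI (_ : 2%:R != 0)); first by rewrite pnatr_eq0.
  apply/eqP; rewrite -subr_eq0 -[0]E; apply/eqP; ring.
(* The [i]-th column of [frame_change] is the sum of the two basis vectors other than [e_i]; the
   form takes there twice the off-diagonal entry at those two indices. *)
exists (\row_i [:: 2 * x 1%N 2%N; 2 * x 0%N 2%N; 2 * x 0%N 1%N]`_i).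
  apply/matrixP => i j; rewrite !mxE !big_ord_recl !big_ord0 !mxE !big_ord_recl !big_ord0 !mxE.
  rewrite !XE /= /bump /= ?addn0 ?add0n ?addn1 -!val_eqE /= /bump /= ?addn0 ?add0n ?addn1.
  rewrite !x0 (xs 1%N 0%N) (xs 2%N 0%N) (xs 2%N 1%N) x12.
  by case: i j => [[|[|[|//]]] ?] [[|[|[|//]]] ?] /=; ring.
by rewrite !big_ord_recl big_ord0 !mxE /= x12; ring.
Qed.

(** The matrix [A] is found before [Q] is given, which makes the diagonalization simultaneous.
    Scaling [v i] by [a i] turns the fourth point into [(1 : 1 : 1)]. The condition on the sum of
    [q] says that the diagonal conic passes through the points [(1 : +-1 : +-1)]. *)
Lemma diagonalize_on_frame (v : 'I_3 -> 'cV[K]_3) (v3 : 'cV[K]_3) (a : 'I_3 -> K) :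
  (\matrix_(i, j) v j i 0) \in unitmx -> (forall i, a i != 0) -> v3 = \sum_i a i *: v i ->
  exists2 A : 'M[K]_3, A \in unitmx & forall Q : 'M[K]_3, Q^T = Q ->
   (forall i, bform Q (v i) (v i) = 0) -> bform Q v3 v3 = 0 ->
   exists2 q : 'rV[K]_3, A^T *m Q *m A = diag_mx q & \sum_i q 0 i = 0.
Proof.
move=> uP a0 v3E; have [D uD colD] : exists2 D, D \in unitmx & forall i, col i D = a i *: v i.
  exists ((\matrix_(i, j) v j i 0) *m diag_mx (\row_i a i)) => [|i].
    rewrite unitmx_mul uP unitmxE unitfE det_diag; apply/prodf_neq0 => i _.
    by rewrite mxE; exact: a0.
  by apply/matrixP => k j; rewrite (ord1 j) mul_mx_diag !mxE mulrC.
exists (D *m frame_change); first by rewrite unitmx_mul uD frame_change_unit.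
move=> Q sQ vQ v3Q; have [||| q qE qs] := @gram_frame_change (D^T *m Q *m D).
- by rewrite !trmx_mul trmxK sQ mulmxA.
- by move=> i; rewrite gram_bform colD bformZr bformC // bformZr vQ !mulr0.
- have DE : D *m const_mx 1 = v3.
    rewrite v3E; apply/matrixP => k j; rewrite mxE summxE; apply: eq_bigr => i _.
    by rewrite [const_mx _ _ _]mxE mulr1 ord1 -colD [RHS]mxE.
  apply: etrans v3Q; rewrite -DE /bform trmx_mul.
  have -> : (const_mx 1)^T *m D^T *m Q *m (D *m const_mx 1) =
      (const_mx 1 : 'rV[K]_3) *m (D^T *m Q *m D *m (const_mx 1 : 'cV[K]_3)).
    by rewrite trmx_const !mulmxA.
  rewrite mxE; apply: eq_bigr => i _; rewrite mxE mul1r mxE.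
  by apply: eq_bigr => j _; rewrite [const_mx _ _ _]mxE mulr1.
by exists q => //; rewrite trmx_mul !mulmxA in qE *.
Qed.

End QuadraticForms.

Section Frames.
Variable K : numFieldType.
Implicit Types M : 'M[K]_3.

Lemma sum_ord3 (V : nmodType) (F : 'I_3 -> V) :
  \sum_i F i = F 0 + F (lift ord0 0) + F (lift ord0 (lift ord0 0)).
Proof. by rewrite !big_ord_recl big_ord0 addr0 addrA. Qed.

Lemma isotropic_frame M (v : 'I_3 -> 'cV[K]_3) (a : 'I_3 -> K) : M^T = M -> \det M != 0 ->
  (forall i j, i != j -> indep2 (v i) (v j)) -> (forall i, bform M (v i) (v i) = 0) ->
  \sum_i a i *: v i = 0 -> forall i, a i = 0.
Proof.
move=> sM dM ind iso; rewrite sum_ord3.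
set i1 := lift ord0 0; set i2 := lift ord0 (lift ord0 0) => s0 i.
have i12 : (0 != i1 :> 'I_3) && (0 != i2 :> 'I_3) && (i1 != i2) && (i1 != 0) && (i2 != 0) && (i2 != i1) by [].
move: i12 => /andP[/andP[/andP[/andP[/andP[n01 n02] n12] n10] n20] n21].
have [->|->|->] : [\/ i = 0, i = i1 | i = i2].
  by case: i => [[|[|[|//]]] ?]; [constructor 1|constructor 2|constructor 3]; apply/val_inj.
- apply: (isotropic_indep3 sM dM (ind _ _ n12) (ind _ _ n10) (ind _ _ n20) (iso _) (iso _) (iso _)
    (_ : a i1 *: v i1 + a i2 *: v i2 + _ = 0)).
  by rewrite -[RHS]s0 [RHS]addrC addrA addrC addrA.
- apply: (isotropic_indep3 sM dM (ind _ _ n02) (ind _ _ n01) (ind _ _ n21) (iso _) (iso _) (iso _)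
    (_ : a 0 *: v 0 + a i2 *: v i2 + _ = 0)).
  by rewrite addrAC.
- exact: (isotropic_indep3 sM dM (ind _ _ n01) (ind _ _ n02) (ind _ _ n12) (iso _) (iso _) (iso _) s0).
Qed.

Lemma frame_unitmx (v : 'I_3 -> 'cV[K]_3) :
  (forall a : 'I_3 -> K, \sum_i a i *: v i = 0 -> forall i, a i = 0) ->
  (\matrix_(i, j) v j i 0) \in unitmx.
Proof.
move=> ind; rewrite -unitmx_tr -row_free_unit -kermx_eq0; apply/rowV0P => a /sub_kermxP aU.
apply/rowP => i; rewrite mxE; apply: (ind (a 0)); apply/matrixP => k l.
rewrite (ord1 l) summxE; move/rowP/(_ k): aU; rewrite mxE [in RHS]mxE => aU.
by rewrite [RHS]mxE -[RHS]aU; apply: eq_bigr => j _; rewrite !mxE.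
Qed.

(** No three of the four points are collinear: if [a i] were 0, then [v3] and the two other [v j]
    would be three dependent isotropic vectors. *)
Lemma four_isotropic M (v : 'I_3 -> 'cV[K]_3) (v3 : 'cV[K]_3) : M^T = M -> \det M != 0 ->
  (forall i j, i != j -> indep2 (v i) (v j)) -> (forall i, indep2 (v i) v3) ->
  (forall i, bform M (v i) (v i) = 0) -> bform M v3 v3 = 0 ->
  (\matrix_(i, j) v j i 0) \in unitmx /\
  exists2 a : 'I_3 -> K, forall i, a i != 0 & v3 = \sum_i a i *: v i.
Proof.
move=> sM dM ind ind3 iso iso3.
have uP : (\matrix_(i, j) v j i 0) \in unitmx.
  by apply: frame_unitmx => a; exact: (isotropic_frame sM dM ind iso).
split=> //; pose P : 'M[K]_3 := \matrix_(i, j) v j i 0.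
pose a i := (invmx P *m v3) i 0.
have v3E : v3 = \sum_i a i *: v i.
  rewrite -[LHS](mulKVmx uP); apply/matrixP => k l; rewrite (ord1 l) mxE summxE.
  by apply: eq_bigr => i _; rewrite mxE [RHS]mxE mulrC.
exists a => // i; apply/eqP => ai.
(* The frame with [v i] replaced by [v3]; the relation has coefficient -1 at the replaced place. *)
pose v' j := if j == i then v3 else v j.
have H := @isotropic_frame M v' (fun j => if j == i then -1 else a j) sM dM.
suff /eqP : (-1 : K) = 0 by rewrite oppr_eq0 oner_eq0.
have {1}-> : -1 = (if i == i then -1 else a i) by rewrite eqxx.
apply: H => [j k jk|j|].
- rewrite /v'; case: eqP => [ji|_]; case: eqP => [ki|_]; last exact: ind.
  + by rewrite ji ki eqxx in jk.
  + by move=> b c; rewrite addrC => /ind3[].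
  + exact: ind3.
- by rewrite /v'; case: eqP.
- rewrite (bigD1 i) //= /v' eqxx {1}v3E (bigD1 i) //= ai scale0r add0r scaleN1r addrC.
  apply/eqP; rewrite subr_eq0; apply/eqP.
  by apply: eq_bigr => j /negbTE ->.
Qed.

End Frames.

(** * Normal form of a transverse pair *)

Section TransverseDiagonalization.
Variable R : realType.
Local Notation C := R[i].
Local Notation cl := (proj_at (one_conic R)).

Lemma bformE (M : 'M[C]_3) (u : 'cV[C]_3) : u^T *m M *m u = 0 <-> bform M u u = 0.
Proof.
split=> [uMu|uMu]; first by rewrite /bform uMu mxE.
by rewrite [LHS]mx11_scalar -/(bform M u u) uMu raddf0.
Qed.

Lemma conic_points_at (M : 'M[C]_3) (x : [set x : 'cV[C]_3 | x != 0]) : conic_mx M ->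
  conic_points (cl M) (proj_class x) <-> bform M (set_val x) (set_val x) = 0.
Proof.
move=> cM; apply: (iff_trans (conic_pointsE _ _)).
by rewrite set_val_insubd //; exact: bformE.
Qed.

Lemma proj_class_indep (x y : [set x : 'cV[C]_3 | x != 0]) : proj_class x <> proj_class y ->
  indep2 (set_val x) (set_val y).
Proof.
move=> xy a b; have x0 : set_val x != 0 := set_valP x; have y0 : set_val y != 0 := set_valP y.
have [->|a0] := eqVneq a 0.
  rewrite scale0r add0r => /eqP; rewrite scaler_eq0 (negbTE y0) orbF => /eqP ->.
  by [].
have [->|b0] := eqVneq b 0.
  by rewrite scale0r addr0 => /eqP; rewrite scaler_eq0 (negbTE x0) orbF => /eqP ->.
move=> E; exfalso; apply: xy; apply/proj_classP; exists (- (b^-1 * a)).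
  by rewrite oppr_eq0 mulf_neq0 ?invr_eq0.
apply: (scalerI b0); rewrite scaleNr scalerN scalerA mulrA divff // mul1r.
by apply/eqP; rewrite -addr_eq0 addrC E.
Qed.

Lemma transverse_points (c d : conic R) : transverse c d ->
  exists2 x : 'I_4 -> [set x : 'cV[C]_3 | x != 0],
    forall i j, i != j -> proj_class (x i) <> proj_class (x j) &
    forall i, conic_points c (proj_class (x i)) /\ conic_points d (proj_class (x i)).
Proof.
move=> /card_set_bijP[f [_ _ fs]].
have ex (i : 'I_4) : exists x : [set x : 'cV[C]_3 | x != 0],
    [/\ conic_points c (proj_class x), conic_points d (proj_class x) & f (proj_class x) = i].
  have [y [cy dy] fy] := fs i (ltn_ord i).
  by have [x [xy _]] := proj_class_mx y; exists x; rewrite xy.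
have [x xP] := choice ex; exists x => [i j ij xij|i]; last by have [] := xP i.
have [_ _ fi] := xP i; have [_ _ fj] := xP j.
by move/eqP: ij; apply; apply/val_inj; rewrite /= -fi -fj xij.
Qed.

Lemma simultaneous_diagonalization (M N : 'M[C]_3) : conic_mx M -> conic_mx N -> \det M != 0 ->
  transverse (cl M) (cl N) ->
  exists2 A : 'M[C]_3, A \in unitmx & exists m n : 'rV[C]_3,
    [/\ A^T *m M *m A = diag_mx m, A^T *m N *m A = diag_mx n, \sum_i m 0 i = 0 & \sum_i n 0 i = 0].
Proof.
move=> cM cN dM /transverse_points[x xI xP].
have sM : M^T = M by have [] := cM.
have sN : N^T = N by have [] := cN.
pose v (i : 'I_4) := set_val (x i).
have isoM i : bform M (v i) (v i) = 0 by have [/(conic_points_at _ cM)] := xP i.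
have isoN i : bform N (v i) (v i) = 0 by have [_ /(conic_points_at _ cN)] := xP i.
have ind i j : i != j -> indep2 (v i) (v j) by move=> ij; apply: proj_class_indep; exact: xI.
have [||||uP [a a0 v3E]] :=
    @four_isotropic _ M (fun i => v (lift ord_max i)) (v ord_max) sM dM.
- by move=> i j ij; apply: ind; apply: contra ij => /eqP/lift_inj ->.
- by move=> i; apply: ind; rewrite eq_sym neq_lift.
- by move=> i; exact: isoM.
- exact: isoM.
have [A uA AP] := diagonalize_on_frame uP a0 v3E; exists A => //.
have [m mE ms] := AP M sM (fun i => isoM _) (isoM _).
have [n nE ns] := AP N sN (fun i => isoN _) (isoN _).
by exists m, n.
Qed.

(** The rational parametrization of the conic [x^2 + y^2 + z^2 = 0], taken at natural parameters. *)
Definition circle_point (t : nat) : 'cV[C]_3 :=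
  \col_i [:: 1 - t%:R ^+ 2; 2 * t%:R; 'i%C * (1 + t%:R ^+ 2)]`_i.

Lemma circle_point_iso t : (circle_point t)^T *m circle_point t = 0.
Proof.
have i2 : 'i%C * 'i%C = -1 :> C by rewrite -expr2 sqr_i.
rewrite [LHS]mx11_scalar -[RHS](raddf0 (@scalar_mx C 1)); congr _%:M.
rewrite mxE !big_ord_recl big_ord0 !mxE /= addr0 [X in _ + (_ + X)]mulrACA i2; ring.
Qed.

Lemma circle_point_inj t s c : circle_point t = c *: circle_point s -> t = s.
Proof.
move=> E.
have := congr1 (fun v : 'cV[C]_3 => v 0 0) E; rewrite !mxE /= => E0.
have := congr1 (fun v : 'cV[C]_3 => v (lift ord0 0) 0) E; rewrite !mxE /= => E1.
have := congr1 (fun v : 'cV[C]_3 => v (lift ord0 (lift ord0 0)) 0) E; rewrite !mxE /=.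
rewrite mulrCA => /(mulfI (neq0Ci _)) E2.
(* The first coordinate and the third divided by ['i] add up to 2 for every parameter. *)
have c1 : c = 1.
  apply: (mulfI (_ : 2 != 0)); first by rewrite pnatr_eq0.
  rewrite mulr1 [LHS](_ : _ = c * (1 - s%:R ^+ 2) + c * (1 + s%:R ^+ 2)); last by ring.
  by rewrite -E0 -E2; ring.
move: E1; rewrite c1 mul1r => /(mulfI _) E1; apply/eqP; rewrite -(eqr_nat C) E1 //.
Qed.

Lemma circle_point_neq0 t : circle_point t != 0.
Proof.
(* A zero vector would be 0 times the next point, and injectivity would identify [t] with [t.+1]. *)
apply/eqP => t0; have /circle_point_inj : circle_point t = 0 *: circle_point t.+1.
  by rewrite t0 scale0r.
by move/eqP; rewrite -[t.+1]addn1 -[X in X == _]addn0 eqn_add2l.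
Qed.

(* A smooth conic carries more than four points. *)
Lemma conic_self_not_transverse (M B : 'M[C]_3) : conic_mx M -> B \in unitmx ->
  B^T *m M *m B = 1%:M -> ~ transverse (cl M) (cl M).
Proof.
move=> cM uB BMB; rewrite /transverse setIid => M4.
have z0 t : B *m circle_point t \in [set x : 'cV[C]_3 | x != 0].
  apply/mem_set => /=; apply: contra (circle_point_neq0 t) => /eqP Bz.
  by rewrite -(mulKmx uB (circle_point t)) Bz mulmx0.
pose f t := proj_of (z0 t).
have fI : {in `I_5 &, injective f}.
  move=> s t _ _ /esym/proj_classP[c _] /= E; apply: (@circle_point_inj _ _ c).
  by apply: (can_inj (mulKmx uB)); rewrite -scalemxAr.
have fM : f @` `I_5 `<=` conic_points (cl M).
  move=> _ [t _ <-]; apply/(conic_points_at _ cM); apply/bformE => /=.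
  by rewrite trmx_mul -!mulmxA (mulmxA M) (mulmxA B^T) (mulmxA B^T) BMB mul1mx circle_point_iso.
have := inj_card_eq fI; rewrite card_eq_sym card_eq_le => /andP[le _].
have := card_le_trans (card_le_trans le (subset_card_le fM)).
move: M4; rewrite card_eq_le => /andP[M4 _] /(_ _ _ M4).
by rewrite card_le_II.
Qed.

(** If [l_i = l_j], subtracting [l_i] times the first relation from the second leaves only the third
    term, [(l_k - l_i) m_k = 0]; then all entries of [l] agree. *)
Lemma diag_eigen_inj (l m : 'rV[C]_3) : (forall i, m 0 i != 0) -> \sum_i m 0 i = 0 ->
  \sum_i l 0 i * m 0 i = 0 -> (exists i j, l 0 i != l 0 j) -> injective (l 0).
Proof.
move=> m0 ms lms [i0 [j0 ne]] i j lij; apply/eqP/negPn/negP => ij.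
suff lE k : l 0 k = l 0 i by rewrite !lE eqxx in ne.
have [->//|ki] := eqVneq k i; have [->//|kj] := eqVneq k j.
have : \sum_t (l 0 t - l 0 i) * m 0 t = 0.
  under eq_bigr do rewrite mulrBl.
  by rewrite sumrB lms -mulr_sumr ms mulr0 subrr.
rewrite (bigD1 k) //= big1 => [|t tk].
  by rewrite addr0 => /eqP; rewrite mulf_eq0 (negbTE (m0 k)) orbF subr_eq0 => /eqP.
have [->|->] : t = i \/ t = j.
  move: i j k t ij ki kj tk {lij}; case=> [[|[|[|//]]] ?]; case=> [[|[|[|//]]] ?]; case=> [[|[|[|//]]] ?];
  case=> [[|[|[|//]]] ?] // _ _ _ _; (by left; apply/val_inj) || (by right; apply/val_inj).
  by rewrite subrr mul0r.
by rewrite lij subrr mul0r.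
Qed.

Lemma congruence_inj (B P Q : 'M[C]_3) : B \in unitmx ->
  B^T *m P *m B = B^T *m Q *m B -> P = Q.
Proof.
move=> uB /(can_inj (mulmxK uB)); apply: can_inj; apply: mulKmx.
by rewrite unitmx_tr.
Qed.

Lemma square_root (z : C) : exists c, c ^+ 2 = z.
Proof. by exists (2.-root z); rewrite rootCK. Qed.

Lemma transverse_diag_pair (p : conic R * conic R) : transverse_pairs R p ->
  exists (l : 'rV[C]_3) (l0 : forall i, l 0 i != 0), injective (l 0) /\ Defs.orbit p = Defs.orbit (diag_pair l0).
Proof.
case: p => c d [] /=; have [M' [<- _]] := proj_class_mx c; have [N' [<- _]] := proj_class_mx d.
move=> /nondegenerateE dM /nondegenerateE dN.
have cM : conic_mx (set_val M') := set_valP M'; have cN : conic_mx (set_val N') := set_valP N'.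
rewrite -!(proj_at_class (one_conic R)).
move: (set_val M') (set_val N') dM dN cM cN => {M' N'} M N dM dN cM cN MN.
have [A uA [m [n [mE nE ms ns]]]] := simultaneous_diagonalization cM cN dM MN.
have dA : \det A != 0 by rewrite -unitfE -unitmxE.
have diag0 (Q : 'M[C]_3) (q : 'rV[C]_3) : \det Q != 0 -> A^T *m Q *m A = diag_mx q -> forall i, q 0 i != 0.
  move=> dQ qE i; have : \det (diag_mx q) != 0 by rewrite -qE !det_mulmx det_tr !mulf_neq0.
  by rewrite det_diag => /prodf_neq0/(_ i isT).
have m0 := diag0 _ _ dM mE; have n0 := diag0 _ _ dN nE.
have [s sE] := choice (fun i => square_root (m 0 i)).
have s0 i : s i != 0 by rewrite -sqrf_eq0 sE.
(* Dividing the columns by square roots of the [m_i] makes the first conic the identity and the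
   second [diag(n_i / m_i)]. *)
pose S : 'M[C]_3 := diag_mx (\row_i (s i)^-1); pose B := A *m S.
have uS : S \in unitmx.
  rewrite unitmxE unitfE det_diag; apply/prodf_neq0 => i _.
  by rewrite mxE invr_eq0.
have uB : B \in unitmx by rewrite unitmx_mul uA uS.
pose l : 'rV[C]_3 := \row_i (n 0 i / m 0 i).
have gramB (Q : 'M[C]_3) (q : 'rV[C]_3) : A^T *m Q *m A = diag_mx q ->
    B^T *m Q *m B = diag_mx (\row_i (q 0 i / m 0 i)).
  move=> qE; rewrite /B trmx_mul -!mulmxA (mulmxA Q) (mulmxA A^T) (mulmxA A^T) qE.
  rewrite /S tr_diag_mx mul_mx_diag mul_diag_mx; apply/matrixP => i j.
  rewrite !mxE -sE; have [->|_] := eqVneq i j; last by rewrite !mulr0n mul0r mulr0.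
  by rewrite !mulr1n mulrCA -expr2 exprVn.
have BMB : B^T *m M *m B = 1%:M.
  rewrite (gramB _ _ mE) -diag_const_mx; congr diag_mx; apply/rowP => i.
  by rewrite !mxE divff.
have BNB := gramB _ _ nE.
have l0 i : l 0 i != 0 by rewrite mxE mulf_neq0 ?invr_eq0.
exists l, l0; split; last first.
  rewrite diag_pairE; apply: (@orbit_congr _ _ _ _ _ B 1 1); rewrite ?oner_neq0 ?scale1r //.
apply: (diag_eigen_inj m0 ms).
  by rewrite -[RHS]ns; apply: eq_bigr => i _; rewrite mxE divfK.
(* If all quotients [n_i / m_i] agreed, the two conics would coincide and share more than four
   points. *)
apply: contrapT => lE; apply: (conic_self_not_transverse cM uB BMB).
suff E : cl M = cl N by rewrite {2}E; exact: MN.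
apply: (@cl_scale _ _ _ (l 0 0)) => //.
have lc i : l 0 i = l 0 0 by apply/eqP/negPn/negP => ne; apply: lE; exists i, 0.
have BNB' : B^T *m N *m B = B^T *m (l 0 0 *: M) *m B.
  rewrite -scalemxAr -scalemxAl BMB BNB scalemx1 -diag_const_mx; congr diag_mx.
  by apply/rowP => i; rewrite [RHS]mxE; exact: lc.
exact: (congruence_inj uB BNB').
Qed.

End TransverseDiagonalization.

Theorem proposition3 (R : realType) :
  [/\ forall g : PGL3 R, isomorphic_groups (pi1 R g) 'Z_3,
      forall S : set (conic R * conic R), standard_orbit S ->
        forall p : S, [set: pi1 R p] #= `I_12 /\
          isomorphic_groups (pi1 R p) (klein4 * 'Z_3)%type
    & forall p : special_orbit R, [set: pi1 R p] #= `I_36].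
Proof.
split; first exact: PGL3_pi1.
  move=> S [[p tp ->]].
  have [l [l0 [lI ->]]] := transverse_diag_pair tp => ns.
  exact: diag_orbit_pi1.
exact: special_pi1.
Qed.
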